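(* For $a\in\{0,1,2,3\}$ let $(\pi_{\omega_a},\mathcal H_{\omega_a},\Omega_{\omega_a})$ be the GNS triple of the state $\omega_a$ on $\mathfrak B_0$, where $\omega_0$ is the vacuum, $\omega_1=\omega_0\circ\beta^{*-1}$, $\omega_2=\omega_0\circ\beta^{*-1}\circ\Delta$, $\omega_3=\omega_0\circ\Delta$. Let $T_{\omega_a}$ be the transfer matrix $T_{\omega_a}\pi_{\omega_a}(A)\Omega_{\omega_a}=\pi_{\omega_a}(\alpha_i^a(A))\Omega_{\omega_a}$, let $U_{\omega_a}(x)\pi_{\omega_a}(A)\Omega_{\omega_a}=\pi_{\omega_a}(\tau_x(A))\Omega_{\omega_a}$ ($A\in\mathfrak B_0$, $x\in\mathbb Z^2$) be the unitary translations, and let $\mathbb P_{\omega_a}$ be the momentum operator defined by $U_{\omega_a}(x)=e^{i\mathbb P_{\omega_a}\cdot x}$ with spectrum in $(-\pi,\pi]^2$. Then the joint spectrum $\mathrm{sp}(T_{\omega_a},\mathbb P_{\omega_a})$ of the transfer matrix and the momentum operator is the same for all $a$.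
   Context: **Algebras.** Fix an integer $N\ge2$; indices in $\{0,\dots,N-1\}$ are read mod $N$. On $\mathbb Z^2$ consider sites $x$, oriented bonds $b$ ($-b$ is the reversed bond) and oriented plaquettes $p$ (positive = counterclockwise). Each site $x$ carries unitary matrices $Q_H(x),P_H(x)$ on a copy of $\mathbb C^N$, and each positively oriented bond $b$ carries $Q_G(b),P_G(b)$ on another copy, each pair having matrix elements $P_{a,c}=\delta_{a,c+1\bmod N}$, $Q_{a,c}=\delta_{a,c}e^{2\pi i a/N}$; operators on different copies commute; $Q_G(-b)=Q_G(b)^{-1}$, $P_G(-b)=P_G(b)^{-1}$. $\mathfrak F_0$ is the unital $*$-algebra they generate, $\mathfrak F$ its $C^*$-completion. Put $[\delta Q_H](b)=Q_H(y)Q_H(x)^*$ for $b$ from $x$ to $y$, $[\delta Q_G](p)=\prod_{b\in\partial p}Q_G(b)$, $[\delta^*P_G](x)=\prod_{b\text{ starting at }x}P_G(b)$, $\mathcal Q(x)=P_H(x)[\delta^*P_G](x)^*$. $\mathfrak A$ (resp. $\mathfrak A_0$) is the set of elements of $\mathfrak F$ (resp. $\mathfrak F_0$) commuting with all $\mathcal Q(x)$; $J$ is the closed two-sided ideal of $\mathfrak A$ generated by all $\mathcal Q(x)^k-1$; $\mathfrak B=\mathfrak A/J$, and $\mathfrak B_0$ is the image of $\mathfrak A_0$. $\mathfrak B_0$ is generated by $U_1(b)=P_G(b)+J$ and $U_3(b)=[\delta Q_H](b)Q_G(b)^*+J$. $\tau_x$ is the $*$-automorphism of translation by $x$. Maps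 and states compatible with $J$ are also regarded as maps and states on $\mathfrak B_0$. **Couplings.** $\mathcal F[\rho](m)=N^{-1/2}\sum_{v=0}^{N-1}\rho(v)e^{2\pi i mv/N}$. The couplings are given by functions $g,h:\{0,\dots,N-1\}\to(0,\infty)$ with $g(0)=h(0)=1$, $g(n)=g(N-n)$, $h(n)=h(N-n)$, $\mathcal F[g]>0$, $\mathcal F[h]>0$. Real functions $\beta_g,\beta_h,\gamma_g,\gamma_h$ are defined by $\mathcal F[\beta_g]=\ln g$, $\mathcal F[\beta_h]=\ln\mathcal F[h]$, $\mathcal F[\gamma_g]=\ln\mathcal F[g]$, $\mathcal F[\gamma_h]=\ln h$. The dual couplings are obtained by exchanging $g$ and $h$, i.e. $(\beta_g,\beta_h,\gamma_g,\gamma_h)\to(\gamma_h,\gamma_g,\beta_h,\beta_g)$; a prime on an automorphism or state means the same object built with the dual couplings. **Dynamics.** An automorphism is a linear multiplicative bijection, not necessarily $*$-preserving; $\gamma^*(A):=(\gamma(A^* ))^*$ and $\gamma^{*-1}:=(\gamma^* )^{-1}$. For a finite square $V\subset\mathbb Z^2$ centered at $0$ put (sums over positively oriented cells in $V$) $A_V=N^{-1/2}\sum_p\sum_n\beta_g(n)[\delta Q_G](p)^n+N^{-1/2}\sum_b\sum_n\beta_h(n)([\delta Q_H](b)Q_G(b)^* )^n$, $B_V=N^{-1/2}\sum_b\sum_n\gamma_g(n)P_G(b)^n+N^{-1/2}\sum_x\sum_n\gamma_h(n)P_H(x)^n$, $T_V=e^{A_V/2}e^{B_V}e^{A_V/2}$,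 $S_V=e^{B_V/2}e^{A_V/2}$. Then $\beta(A)=\lim_{V\uparrow\mathbb Z^2}S_VAS_V^{-1}$ ($A\in\mathfrak F_0$) defines an automorphism of $\mathfrak F_0$ and of $\mathfrak B_0$. Put $\alpha_i=\beta^{*-1}\circ\beta=\lim_V T_V\,\cdot\,T_V^{-1}$, and $\alpha_i^0=\alpha_i$, $\alpha_i^1=\beta\circ\beta^{*-1}$, $\alpha_i^2=\alpha_i'$, $\alpha_i^3=(\alpha_i^1)'$. **Vacuum.** A state $\omega$ on a unital $*$-algebra $\mathfrak C$ is a ground state with respect to an automorphism $\gamma$ if $0\le\omega(A^*\gamma(A))\le\omega(A^*A)$ for all $A\in\mathfrak C$. Let $\omega_V$ be the vector state of the (Perron–Frobenius, unique up to phase) eigenvector of $T_V$ for its largest eigenvalue on the tensor product of the copies of $\mathbb C^N$ in $V$, and $\omega_0=\lim_{V\uparrow\mathbb Z^2}\omega_V$ on $\mathfrak F_0$; the couplings are such that this limit exists. $\omega_0$ is translation invariant, vanishes on $J$, and is a ground state with respect to $\alpha_i$. **Duality.** $\Delta$ is the $*$-automorphism of $\mathfrak B_0$ with $\Delta(U_1(b))=U_3(-{*b})$, $\Delta(U_3(b))=U_1({*b})$, where $*b$ is obtained by rotating the oriented bond $b$ by $+90^\circ$ about its midpoint and then translating by $(1/2,1/2)$. *)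

(* Defs.v *)
From HB Require Import structures.
From mathcomp Require Import all_boot all_order all_algebra.
From mathcomp Require Import complex.
From mathcomp Require Import all_classical all_reals all_analysis.

Set Implicit Arguments.
Unset Strict Implicit.
Unset Printing Implicit Defensive.

Import Order.TTheory GRing.Theory Num.Theory.
Import numFieldNormedType.Exports.

Local Open Scope classical_set_scope.
Local Open Scope ring_scope.
Local Open Scope complex_scope.

(** * Star algebras and C*-algebras *)

HB.mixin Record isStarAlgebra (R : realType) A of GRing.Algebra R[i] A := {
  star : A -> A;
  starK : involutive star;
  starD : forall x y, star (x + y) = star x + star y;
  starZ : forall (a : R[i]) x, star (a *: x) = conjc a *: star x;
  starM : forall x y, star (x * y) = star y * star x
}.

#[short(type="starAlgType")]
HB.structure Definition StarAlgebra (R : realType) :=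
  { A of isStarAlgebra R A & GRing.Algebra R[i] A }.

(* The norm is kept as a separate real-valued function: Hierarchy Builder has
   no common substructure for normed modules and rings that are not number
   domains, so the library's norm cannot be joined with [algType]. *)
HB.mixin Record isCStarAlgebra (R : realType) A of StarAlgebra R A := {
  cnorm : A -> R;
  cnorm_eq0 : forall x, cnorm x = 0 -> x = 0;
  cnormD : forall x y, cnorm (x + y) <= cnorm x + cnorm y;
  cnormZ : forall (a : R[i]) x, (cnorm (a *: x))%:C = `|a| * (cnorm x)%:C;
  cnormM : forall x y, cnorm (x * y) <= cnorm x * cnorm y;
  cnorm_star : forall x, cnorm (star x * x) = cnorm x ^+ 2;
  cnorm_complete : forall u : nat -> A,
    (forall eps : R, 0 < eps -> exists n0 : nat, forall m n : nat,
       (n0 <= m)%N -> (n0 <= n)%N -> cnorm (u m - u n) < eps) ->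
    exists l, (fun n => cnorm (u n - l)) @ \oo --> (0 : R)
}.

#[short(type="cstarAlgType")]
HB.structure Definition CStarAlgebra (R : realType) :=
  { A of isCStarAlgebra R A & StarAlgebra R A }.

Section CStarTopology.
Variables (R : realType) (F : cstarAlgType R).

Definition ncvg (u : nat -> F) (l : F) : Prop :=
  (fun n => cnorm (u n - l)) @ \oo --> (0 : R).

Definition nclosure (S : set F) : set F :=
  [set X | forall eps : R, 0 < eps -> exists2 Y, S Y & cnorm (X - Y) < eps].

Definition nclosed (S : set F) : Prop := nclosure S `<=` S.

(* The exponential series converges in every C*-algebra and its limit is
   unique, so the default value of [xget] is never used. *)
Definition cexp (X : F) : F :=
  xget 0 [set E | ncvg (fun n => \sum_(k < n) (k`!%:R : R[i])^-1 *: X ^+ k) E].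

(* The closed two-sided ideal of the subalgebra [S] generated by [G]. *)
Definition closed_ideal_of (S I : set F) : Prop :=
  [/\ I `<=` S, nclosed I, I 0,
      forall X Y, I X -> I Y -> I (X + Y) &
      forall X Y, S X -> I Y -> I (X * Y) /\ I (Y * X)].

Definition closed_ideal_gen (S G : set F) : set F :=
  [set X | forall I, closed_ideal_of S I -> G `<=` I -> I X].

End CStarTopology.

Inductive star_gen (R : realType) (A : starAlgType R) (G : set A) : A -> Prop :=
| star_gen_base X : G X -> star_gen G X
| star_gen_one : star_gen G 1
| star_gen_add X Y : star_gen G X -> star_gen G Y -> star_gen G (X + Y)
| star_gen_scale (a : R[i]) X : star_gen G X -> star_gen G (a *: X)
| star_gen_mul X Y : star_gen G X -> star_gen G Y -> star_gen G (X * Y)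
| star_gen_star X : star_gen G X -> star_gen G (star X).

(** * Automorphisms, states, ground states *)

Section Automorphisms.
Variables (R : realType) (A : starAlgType R).

Record automorphism := Automorphism {
  aut_fun :> A -> A;
  aut_inv_fun : A -> A;
  aut_linear : linear aut_fun;
  aut_mul : {morph aut_fun : x y / x * y};
  autK : cancel aut_fun aut_inv_fun;
  autVK : cancel aut_inv_fun aut_fun
}.

Implicit Types f g : automorphism.

Lemma aut_inv_linear f : linear (aut_inv_fun f).
Proof.
move=> a x y; rewrite -{1}(autVK f x) -{1}(autVK f y).
by rewrite -(aut_linear f) autK.
Qed.

Lemma aut_inv_mul f : {morph aut_inv_fun f : x y / x * y}.
Proof.
move=> x y; rewrite -{1}(autVK f x) -{1}(autVK f y).
by rewrite -(aut_mul f) autK.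
Qed.

Definition aut_inv f : automorphism :=
  Automorphism (@aut_inv_linear f) (@aut_inv_mul f) (autVK f) (autK f).

Lemma aut_comp_linear f g : linear (f \o g).
Proof. by move=> a x y /=; rewrite !aut_linear. Qed.

Lemma aut_comp_mul f g : {morph f \o g : x y / x * y}.
Proof. by move=> x y /=; rewrite !aut_mul. Qed.

Definition aut_comp f g : automorphism :=
  Automorphism (@aut_comp_linear f g) (@aut_comp_mul f g)
    (can_comp (autK f) (autK g)) (can_comp (autVK g) (autVK f)).

Lemma aut_star_linear f : linear (fun X => star (f (star X))).
Proof. by move=> a x y; rewrite !(starD, starZ, aut_linear) conjcK. Qed.

Lemma aut_star_mul f : {morph (fun X => star (f (star X))) : x y / x * y}.
Proof. by move=> x y; rewrite starM aut_mul starM. Qed.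

Lemma aut_starK f :
  cancel (fun X => star (f (star X))) (fun X => star (aut_inv_fun f (star X))).
Proof. by move=> x; rewrite starK autK starK. Qed.

Lemma aut_starVK f :
  cancel (fun X => star (aut_inv_fun f (star X))) (fun X => star (f (star X))).
Proof. by move=> x; rewrite starK autVK starK. Qed.

Definition aut_star f : automorphism :=
  Automorphism (@aut_star_linear f) (@aut_star_mul f)
    (@aut_starK f) (@aut_starVK f).

Definition star_preserving f : Prop := {morph f : X / star X}.

Definition is_state (w : A -> R[i]) : Prop :=
  [/\ scalar w, forall X, 0 <= w (star X * X) & w 1 = 1].

Definition ground_state (w : A -> R[i]) (gamma : automorphism) : Prop :=
  is_state w /\
  forall X, 0 <= w (star X * gamma X) /\ w (star X * gamma X) <= w (star X * X).

End Automorphisms.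

(** * Hilbert spaces, GNS triples, spectral measures *)

(* The scalar product is linear in its first argument, as in the library. *)
Record hilbertSpace (R : realType) := HilbertSpace {
  hs_sort :> completeNormedModType R[i];
  hs_dot : {dot hs_sort for @conjc R};
  hs_normE : forall v : hs_sort, `|v| ^+ 2 = hs_dot v v
}.

Section Operators.
Variables (R : realType) (H : hilbertSpace R).

Definition bounded_op (T : H -> H) : Prop := linear T /\ continuous T.

Definition adjoint_op (T S : H -> H) : Prop :=
  forall u v, hs_dot H (T u) v = hs_dot H u (S v).

Definition unitary_op (T : H -> H) : Prop :=
  [/\ bounded_op T, forall v, `|T v| = `|v| & forall w, exists v, T v = w].

Record pvm d (X : measurableType d) := Pvm {
  pvm_proj : set X -> H -> H;
  pvm_meas : H -> {measure set X -> \bar R};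
  pvm_bounded : forall S, measurable S -> bounded_op (pvm_proj S);
  pvm_adjoint : forall S, measurable S -> adjoint_op (pvm_proj S) (pvm_proj S);
  pvm_idem : forall S v, measurable S ->
    pvm_proj S (pvm_proj S v) = pvm_proj S v;
  pvm_total : forall v, pvm_proj setT v = v;
  pvm_measE : forall v S, measurable S ->
    pvm_meas v S = (complex.Re (hs_dot H (pvm_proj S v) v))%:E
}.

(* [A] is the bounded operator $\int f dE$. *)
Definition spectral_integral d (X : measurableType d) (E : pvm X)
    (f : X -> R[i]) (A : H -> H) : Prop :=
  bounded_op A /\ forall v,
  let mu := pvm_meas E v in
  let fr := fun x => complex.Re (f x) in
  let fi := fun x => complex.Im (f x) in
  [/\ mu.-integrable setT (EFin \o fr), mu.-integrable setT (EFin \o fi) &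
      hs_dot H (A v) v =
        (\int[mu]_x fr x) +i* (\int[mu]_x fi x)].

(* The support of the joint spectral measure of (A, B1, B2). *)
Definition joint_spectrum (A B1 B2 : H -> H) : set (R * R * R)%type :=
  [set l | exists E : pvm (R * R * R)%type,
     [/\ spectral_integral E (fun x => x.1.1%:C) A,
         spectral_integral E (fun x => x.1.2%:C) B1,
         spectral_integral E (fun x => x.2%:C) B2 &
         forall O : set (R * R * R)%type, measurable O -> nbhs l O ->
           exists v, pvm_proj E O v != 0]].

Definition expi (t : R) : R[i] := cos t +i* sin t.

(* U(x) = e^{i(P1 x_1 + P2 x_2)}, where the joint spectral measure of (P1, P2)
   is carried by (-pi, pi]^2.  Requiring the (closed) spectra themselves to lie
   in (-pi, pi]^2 would exclude the case where U has full spectrum. *)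
Definition momentum (U : int * int -> H -> H) (P1 P2 : H -> H) : Prop :=
  exists E : pvm (R * R)%type,
  [/\ spectral_integral E (fun p => p.1%:C) P1,
      spectral_integral E (fun p => p.2%:C) P2,
      forall v, pvm_proj E (`]- pi, pi] `*` `]- pi, pi]) v = v &
      forall x : int * int,
        spectral_integral E (fun p => expi (p.1 * x.1%:~R + p.2 * x.2%:~R))
          (U x)].

End Operators.

Record gns_triple (R : realType) (A : starAlgType R) (w : A -> R[i]) := Gns {
  gns_space :> hilbertSpace R;
  gns_rep : A -> gns_space -> gns_space;
  gns_vac : gns_space;
  gns_bounded : forall X, bounded_op (gns_rep X);
  gns_linear : forall (a : R[i]) X Y v,
    gns_rep (a *: X + Y) v = a *: gns_rep X v + gns_rep Y v;
  gns_mul : forall X Y v, gns_rep (X * Y) v = gns_rep X (gns_rep Y v);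
  gns_one : forall v, gns_rep 1 v = v;
  gns_star : forall X, adjoint_op (gns_rep X) (gns_rep (star X));
  gns_state : forall X, w X = hs_dot gns_space (gns_rep X gns_vac) gns_vac;
  gns_cyclic : closure (range (fun X => gns_rep X gns_vac)) = setT
}.

Arguments gns_rep {R A w} g X v.
Arguments gns_vac {R A w} g.

(** * The lattice *)

Definition site := (int * int)%type.
Definition e1 : site := (1, 0).
Definition e2 : site := (0, 1).

(* (x, d): the positively oriented bond from x to x + e1 (d = false) or
   x + e2 (d = true). *)
Definition pbond := (site * bool)%type.
Definition dirv (d : bool) : site := if d then e2 else e1.

(* (b, r): the bond b, reversed if r = true. *)
Definition obond := (pbond * bool)%type.
Definition orev (b : obond) : obond := (b.1, ~~ b.2).
Definition osrc (b : obond) : site :=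
  if b.2 then b.1.1 + dirv b.1.2 else b.1.1.
Definition otgt (b : obond) : site := osrc (orev b).

(* Counterclockwise boundary of the plaquette with lower left corner x. *)
Definition plaq_bonds (x : site) : seq obond :=
  [:: ((x, false), false); ((x + e1, true), false);
      ((x + e2, false), true); ((x, true), true)].

Definition bonds_from (x : site) : seq obond :=
  [:: ((x, false), false); ((x, true), false);
      ((x - e1, false), true); ((x - e2, true), true)].

(* Rotation by +90 degrees about the midpoint followed by the translation by
   (1/2, 1/2): x -> x + e1 becomes x + e1 -> x + e1 + e2, and x -> x + e2
   becomes x + e1 + e2 -> x + e2. *)
Definition bstar (b : obond) : obond :=
  let: ((x, d), r) := b in
  if d then ((x + e2, false), ~~ r) else ((x + e1, true), r).

(* Tensor factors: one for each site and one for each positive bond. *)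
Definition cell := (site + pbond)%type.

Definition shift_cell (x : site) (c : cell) : cell :=
  match c with
  | inl y => inl (y + x)
  | inr b => inr (b.1 + x, b.2)
  end.

(* The square V = [-n, n]^2 and the cells contained in it; a plaquette is
   given by its lower left corner. *)
Definition box_range (n : nat) : seq int :=
  [seq k%:Z - n%:Z | k <- iota 0 n.*2.+1].
Definition box_sites (n : nat) : seq site :=
  [seq (i, j) | i <- box_range n, j <- box_range n].
Definition box_bonds (n : nat) : seq pbond :=
  [seq b <- [seq (x, d) | x <- box_sites n, d <- [:: false; true]]
  | b.1 + dirv b.2 \in box_sites n].
Definition box_plaqs (n : nat) : seq site :=
  [seq x <- box_sites n | x + e1 + e2 \in box_sites n].
Definition box_cells (n : nat) : seq cell :=
  [seq inl x | x <- box_sites n] ++ [seq inr b | b <- box_bonds n].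

(** * Couplings *)

Section Couplings.
Variables (R : realType) (N : nat).

Definition rootN (k : nat) : R[i] := expi (2 * pi * k%:R / N%:R).

Definition fourier (rho : 'I_N -> R) (m : 'I_N) : R[i] :=
  ((Num.sqrt N%:R)^-1)%:C * \sum_(v < N) (rho v)%:C * rootN (m * v).

Record couplings := Couplings {
  cg : 'I_N -> R; ch : 'I_N -> R;
  beta_g : 'I_N -> R; beta_h : 'I_N -> R;
  gamma_g : 'I_N -> R; gamma_h : 'I_N -> R
}.

Definition coupling_fun (f : 'I_N -> R) : Prop :=
  [/\ forall n, 0 < f n,
      forall n : 'I_N, n = 0%N :> nat -> f n = 1,
      forall m n : 'I_N, (m + n)%N = N -> f m = f n &
      forall m, 0 < fourier f m].

Definition admissible (c : couplings) : Prop :=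
  [/\ coupling_fun (cg c), coupling_fun (ch c),
      forall m, fourier (beta_g c) m = (ln (cg c m))%:C &
      [/\ forall m, fourier (beta_h c) m =
                      (ln (complex.Re (fourier (ch c) m)))%:C,
          forall m, fourier (gamma_g c) m =
                      (ln (complex.Re (fourier (cg c) m)))%:C &
          forall m, fourier (gamma_h c) m = (ln (ch c m))%:C]].

Definition dual_couplings (c : couplings) : couplings :=
  Couplings (ch c) (cg c) (gamma_h c) (gamma_g c) (beta_h c) (beta_g c).

End Couplings.

(** * The field algebra and its dynamics *)

Section Model.
Variables (R : realType) (N : nat) (F : cstarAlgType R).
Local Notation C := R[i].

Definition Qmx : 'M[C]_N := \matrix_(a, c) ((a == c)%:R * rootN R N a).
Definition Pmx : 'M[C]_N :=
  \matrix_(a, c) ((a == (c + 1) %% N :> nat)%N%:R).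

(* [e c] is the embedding of the matrix algebra of the tensor factor c. *)
Variable e : cell -> 'M[C]_N -> F.

Definition QH (x : site) : F := e (inl x) Qmx.
Definition PH (x : site) : F := e (inl x) Pmx.
(* Q_G and P_G are unitary, so star is the inverse on them. *)
Definition QG (b : obond) : F :=
  if b.2 then star (e (inr b.1) Qmx) else e (inr b.1) Qmx.
Definition PG (b : obond) : F :=
  if b.2 then star (e (inr b.1) Pmx) else e (inr b.1) Pmx.

Definition F0 : set F :=
  star_gen [set X | (exists x, X = QH x \/ X = PH x) \/
                    (exists b, X = QG b \/ X = PG b)].

(* F is the C*-completion of the tensor product of the matrix algebras
   attached to the cells. *)
Record field_algebra : Prop := FieldAlgebra {
  fa_linear : forall c, linear (e c);
  fa_mul : forall c A B, e c (A *m B) = e c A * e c B;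
  fa_one : forall c, e c 1%:M = 1;
  fa_star : forall c A, e c (map_mx (@conjc R) A^T) = star (e c A);
  fa_comm : forall c d A B, c != d -> e c A * e d B = e d B * e c A;
  fa_dense : nclosure F0 = setT
}.

Definition dQH (b : obond) : F := QH (otgt b) * star (QH (osrc b)).
Definition dQG (x : site) : F := \prod_(b <- plaq_bonds x) QG b.
Definition dsPG (x : site) : F := \prod_(b <- bonds_from x) PG b.
Definition calQ (x : site) : F := PH x * star (dsPG x).

Definition Aalg : set F := [set X | forall x, X * calQ x = calQ x * X].
Definition A0alg : set F := F0 `&` Aalg.
Definition Jideal : set F :=
  closed_ideal_gen Aalg [set X | exists x k, X = calQ x ^+ k - 1].

(* Finite volume objects for V = [-n, n]^2. *)
Section FiniteVolume.
Variable c : couplings R N.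
Variable n : nat.

Definition invsqrtN : C := ((Num.sqrt N%:R)^-1)%:C.

Definition power_sum (rho : 'I_N -> R) (X : F) : F :=
  \sum_(k < N) (rho k)%:C *: X ^+ k.

Definition AV : F :=
  invsqrtN *: (\sum_(p <- box_plaqs n) power_sum (beta_g c) (dQG p)) +
  invsqrtN *: (\sum_(b <- box_bonds n)
                 power_sum (beta_h c)
                   (dQH (b, false) * star (QG (b, false)))).

Definition BV : F :=
  invsqrtN *: (\sum_(b <- box_bonds n)
                 power_sum (gamma_g c) (PG (b, false))) +
  invsqrtN *: (\sum_(x <- box_sites n) power_sum (gamma_h c) (PH x)).

Definition half : C := 2^-1.

Definition TV : F := cexp (half *: AV) * cexp BV * cexp (half *: AV).
Definition SV : F := cexp (half *: BV) * cexp (half *: AV).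
Definition SVinv : F := cexp (- (half *: AV)) * cexp (- (half *: BV)).

(* The functions on [conf] form the tensor product of the copies of C^N in V;
   an operator is given by its kernel. *)
Definition conf := {ffun seq_sub (box_cells n) -> 'I_N}.
Definition vec := conf -> C.
Definition kernel := conf -> conf -> C.

Definition kact (K : kernel) (psi : vec) : vec :=
  fun phi => \sum_(phi' : conf) K phi phi' * psi phi'.
Definition vdot (psi chi : vec) : C := \sum_(phi : conf) conjc (psi phi) * chi phi.

(* The element of F defined by an operator on the tensor product. *)
Definition local_elt (K : kernel) : F :=
  \sum_(phi : conf) \sum_(phi' : conf)
    K phi phi' *: \prod_(s : seq_sub (box_cells n))
                    e (ssval s) (delta_mx (phi s) (phi' s)).

Definition eigenvector (K : kernel) (lam : C) (psi : vec) : Prop :=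
  (exists phi, psi phi != 0) /\ kact K psi = (fun phi => lam * psi phi).

Definition ground_vector (psi : vec) : Prop :=
  vdot psi psi = 1 /\
  exists K lam, [/\ local_elt K = TV, eigenvector K lam psi &
    forall mu chi, eigenvector K mu chi -> mu <= lam].

(* z = omega_V(X) *)
Definition finite_vacuum (X : F) (z : C) : Prop :=
  exists psi K, [/\ ground_vector psi, local_elt K = X &
                    z = vdot psi (kact K psi)].

End FiniteVolume.

(* omega = lim omega_V on F0; omega_V(X) makes sense as soon as X is localised
   in V. *)
Definition vacuum_limit (c : couplings R N) (omega : F -> C) : Prop :=
  forall X, F0 X -> forall eps : R, 0 < eps -> \forall n \near \oo,
    exists2 z, finite_vacuum c n X z & `|z - omega X| < eps%:C.

(** * The algebra B0 and the induced maps *)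

Variable B0 : starAlgType R.

(* [q] restricted to A0alg is the quotient map onto its image in Aalg/Jideal;
   only its values on A0alg matter. *)
Record quotient_B0 (q : F -> B0) : Prop := QuotientB0 {
  qt_surj : forall Y, exists2 X, A0alg X & q X = Y;
  qt_linear : forall (a : C) X Y, A0alg X -> A0alg Y ->
    q (a *: X + Y) = a *: q X + q Y;
  qt_mul : forall X Y, A0alg X -> A0alg Y -> q (X * Y) = q X * q Y;
  qt_one : q 1 = 1;
  qt_star : forall X, A0alg X -> q (star X) = star (q X);
  qt_ker : forall X, A0alg X -> (q X = 0 <-> Jideal X)
}.

Variable q : F -> B0.

Definition U1 (b : obond) : B0 := q (PG b).
Definition U3 (b : obond) : B0 := q (dQH b * star (QG b)).

Definition dynamics (c : couplings R N) (beta : automorphism B0) : Prop :=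
  forall X, A0alg X -> exists X', [/\ A0alg X',
    ncvg (fun n => SV c n * X * SVinv c n) X' & beta (q X) = q X'].

Definition translations (tauF : site -> automorphism F)
    (tau : site -> automorphism B0) : Prop :=
  forall x, [/\ star_preserving (tauF x), star_preserving (tau x),
    forall d A, tauF x (e d A) = e (shift_cell x d) A &
    forall X, A0alg X -> tau x (q X) = q (tauF x X)].

(* The vacuum as a functional omega on F0, and the state w it induces on B0. *)
Definition vacuum_on (c : couplings R N) (tauF : site -> automorphism F)
    (alpha : automorphism B0) (omega : F -> C) (w : B0 -> C) : Prop :=
  [/\ vacuum_limit c omega,
      forall x X, F0 X -> omega (tauF x X) = omega X,
      forall X, A0alg X -> w (q X) = omega X &
      ground_state w alpha].

Definition duality (Delta : automorphism B0) : Prop :=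
  [/\ star_preserving Delta,
      forall b, Delta (U1 b) = U3 (orev (bstar b)) &
      forall b, Delta (U3 b) = U1 (bstar b)].

End Model.

Section Sectors.
Variables (R : realType) (B0 : starAlgType R).

Definition beta_star_inv (beta : automorphism B0) : automorphism B0 := aut_inv (aut_star beta).

(* [beta'] is built with the dual couplings. *)
Definition alpha_i (beta beta' : automorphism B0) (a : 'I_4) :
    automorphism B0 :=
  match val a with
  | 0 => aut_comp (beta_star_inv beta) beta
  | 1 => aut_comp beta (beta_star_inv beta)
  | 2 => aut_comp (beta_star_inv beta') beta'
  | _ => aut_comp beta' (beta_star_inv beta')
  end.

Definition omega_i (w : B0 -> R[i]) (beta Delta : automorphism B0) (a : 'I_4) :
    B0 -> R[i] :=
  match val a with
  | 0 => w
  | 1 => w \o beta_star_inv beta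
  | 2 => w \o beta_star_inv beta \o Delta
  | _ => w \o Delta
  end.

End Sectors.

(* Main.v *)
(* The joint spectrum is invariant under unitary maps intertwining the transfer
   matrices and the translations: a bounded function of the momentum is a limit
   of trigonometric polynomials on (-pi, pi], so the momentum is determined by
   the translations.

   Such a unitary between the sectors 0 and 1 is T_0^(1/2) pi_0(A) Omega_0 |->
   pi_1(beta(A)) Omega_1: the ground state condition says 0 <= T_0 <= 1, so the
   square root exists, commutes with the translations, and the two vectors have
   norms omega_0(A^* alpha_i(A)).  Between the sectors 3 and 0, and 2 and 1, it is
   pi_{omega o Delta}(A) Omega |-> pi_omega(Delta(A)) Omega, once one knows that
   Delta o beta' = beta^{*-1} o Delta and that beta and Delta commute with the
   translations.

   Both facts come from the local form of beta.  The commuting family of the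
   Q's contains A_V and that of the P's contains B_V, so conjugation by S_V only
   sees the terms adjacent to a bond b:
   beta(U_3(b)) = K_b U_3(b) K_b^-1 and beta(L_b^-1 U_1(b) L_b) = U_1(b), where
   K_b is a function of the U_1's and L_b one of the U_3's.  Delta exchanges K_b
   for the dual couplings with L_{*b}, and the elements U_3(b), L_b^-1 U_1(b) L_b
   generate B_0. *)
Require Import Defs.
From HB Require Import structures.
From mathcomp Require Import all_boot all_order all_algebra.
From mathcomp Require Import complex ring lra zify.
From mathcomp Require Import all_classical all_reals all_analysis measurable_realfun.
Import Order.TTheory GRing.Theory Num.Theory.
Import numFieldNormedType.Exports.
Set Implicit Arguments.
Unset Strict Implicit.
Unset Printing Implicit Defensive.
Local Open Scope classical_set_scope.
Local Open Scope ring_scope.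
Local Open Scope complex_scope.

(** * Hilbert space operators and their spectral measures *)

(** The momentum is tied to the translations only through integrals of e^{ip.x}, and [p] jumps as a
    function on the circle, so no uniform approximation by trigonometric polynomials exists. A
    bounded sequence that converges at every point of ]-pi, pi], the endpoint pi included, suffices,
    by dominated convergence. The expansion of p / sin p in powers of sin(p/2)^2 provides it: its
    terms are nonnegative for p in [0, pi] once multiplied by sin p, so the partial sums stay
    between 0 and p, and the remainder is explicit.

    On the algebraic side [B0] carries no norm, hence no exponential. The factors of K_b and L_b are
    therefore written through spectral projections of unitaries of order N. These are polynomials,
    so they pass through the quotient map and through every automorphism. Reality of the Fourier
    transforms makes them even in the unitary, which removes all dependence on the orientation of
    bonds and plaquettes.

    That the link variables generate [B0] rests on a normal form in the field algebra: gauge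
    invariant coefficients times words in the Q_H, where averaging over gauge transformations kills
    the nontrivial words. *)

Lemma linear_props (K : pzRingType) (V V' : lmodType K) (T : V -> V') : linear T ->
  [/\ T 0 = 0, forall u v, T (u + v) = T u + T v,
      forall u v, T (u - v) = T u - T v & forall a u, T (a *: u) = a *: T u].
Proof.
move=> lT.
have TB u v : T (u - v) = T u - T v.
  by rewrite -(scaleN1r v) addrC lT scaleN1r addrC.
have T0 : T 0 = 0 by rewrite -[X in T X](subrr (0 : V)) TB subrr.
have TZ a u : T (a *: u) = a *: T u by rewrite -[a *: u]addr0 lT T0 addr0.
by split=> // u v; rewrite -{1}[u]scale1r lT scale1r.
Qed.

Section HilbertGeometry.
Variables (R : realType) (H : hilbertSpace R).
Local Notation C := R[i].
Local Notation dot := (hs_dot H).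
Implicit Types (u v w : H) (A B T X Y : H -> H).

(** The norm of a module over [R[i]] takes values in [R[i]]; this is the real number behind it, on
    which real arithmetic can be done. *)
Definition hnorm v : R := complex.Re `|v|.

Lemma hnormE v : `|v| = (hnorm v)%:C.
Proof. by rewrite /hnorm RRe_real // normr_real. Qed.

Lemma hnorm_ge0 v : 0 <= hnorm v.
Proof. by rewrite -lecR -hnormE normr_ge0. Qed.

Lemma hnormD u v : hnorm (u + v) <= hnorm u + hnorm v.
Proof. by rewrite -lecR rmorphD /= -!hnormE ler_normD. Qed.

Lemma hnormB u v : hnorm (u - v) = hnorm (v - u).
Proof. by rewrite /hnorm distrC. Qed.

Lemma hnormZ (a : R) v : 0 <= a -> hnorm (a%:C *: v) = a * hnorm v.
Proof.
move=> a0; apply: (@complexI R).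
by rewrite -hnormE normrZ ger0_norm ?ler0c // rmorphM /= -hnormE.
Qed.

Lemma hnorm_eq0 v : (forall eps, 0 < eps -> hnorm v <= eps) -> v = 0.
Proof.
move=> h; apply/eqP; rewrite -normr_eq0 hnormE.
have -> : hnorm v = 0; last by [].
apply/eqP; rewrite eq_le hnorm_ge0 andbT.
by apply/ler_addgt0Pr => e e0; rewrite add0r h.
Qed.

Lemma hdotDl u v w : dot (u + v) w = dot u w + dot v w.
Proof. exact: (@linearDl _ _ _ _ _ _ dot w u v). Qed.
Lemma hdotBl u v w : dot (u - v) w = dot u w - dot v w.
Proof. exact: (@linearBl _ _ _ _ _ _ dot w u v). Qed.
Lemma hdotZl (a : C) u w : dot (a *: u) w = a * dot u w.
Proof. exact: (@linearZl_LR _ _ _ _ _ _ dot w a u). Qed.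
Lemma hdotC u v : dot u v = conjc (dot v u).
Proof. by rewrite (hermC (dot : {hermitian H for false & (@conjc R)})) expr0 mul1r. Qed.
Lemma hdotDr u v w : dot w (u + v) = dot w u + dot w v.
Proof. by rewrite hdotC hdotDl rmorphD /= -!hdotC. Qed.
Lemma hdotBr u v w : dot w (u - v) = dot w u - dot w v.
Proof. by rewrite hdotC hdotBl rmorphB /= -!hdotC. Qed.
Lemma hdotZr (a : C) u w : dot w (a *: u) = conjc a * dot w u.
Proof. by rewrite hdotC hdotZl rmorphM /= -!hdotC. Qed.
Lemma hdotvv v : dot v v = (hnorm v ^+ 2)%:C.
Proof. by rewrite -hs_normE hnormE rmorphXn. Qed.

(** Polarisation. Expanding at [a *: u + v] and cancelling the diagonal terms leaves [h1]; its cases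
    a = 1 and a = i are two linear equations for [f u v] and [f v u]. *)
Lemma sesqui_polar (f g : H -> H -> C) :
  (forall a u v w, f (a *: u + v) w = a * f u w + f v w) ->
  (forall a u v w, f w (a *: u + v) = conjc a * f w u + f w v) ->
  (forall a u v w, g (a *: u + v) w = a * g u w + g v w) ->
  (forall a u v w, g w (a *: u + v) = conjc a * g w u + g w v) ->
  (forall v, f v v = g v v) -> forall u v, f u v = g u v.
Proof.
move=> fl fr gl gr h u v.
have h1 (a : C) : a * f u v + conjc a * f v u = a * g u v + conjc a * g v u.
  have := h (a *: u + v); rewrite fl gl !fr !gr !h => E.
  apply: (addrI (a * (conjc a * g u u))); apply: (addIr (g v v)).
  by move: E; rewrite !mulrDr !addrA.
have e1 := h1 1; have e2 := h1 'i%C.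
have ci : conjc ('i%C : C) = - 'i%C by apply/eqP; rewrite eq_complex /= oppr0 !eqxx.
rewrite conjc1 !mul1r in e1.
have e3 : - f u v + f v u = - g u v + g v u.
  have := congr1 (fun z => 'i%C * z) e2.
  by rewrite ci !mulrDr !mulNr !mulrN !mulrA -!expr2 sqr_i !mulN1r !opprK.
apply: (@mulfI _ (2 : C)); first by rewrite pnatr_eq0.
have -> : (2 : C) * f u v = (f u v + f v u) - (- f u v + f v u) by ring.
by rewrite e1 e3; ring.
Qed.

Lemma hnorm0P v : hnorm v = 0 -> v = 0.
Proof. by move=> h; apply: hnorm_eq0 => e e0; rewrite h ltW. Qed.

Lemma hnorm0 : hnorm 0 = 0.
Proof. by rewrite /hnorm normr0. Qed.

Lemma dot_polar_eq A B : linear A -> linear B ->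
  (forall v, dot (A v) v = dot (B v) v) -> forall v, A v = B v.
Proof.
move=> lA lB h v; apply/eqP; rewrite -subr_eq0; apply/eqP/hnorm0P.
apply/eqP; rewrite -(sqrf_eq0 (hnorm _)); apply/eqP/(@complexI R).
rewrite -hdotvv hdotBl.
rewrite (@sesqui_polar (fun u v => dot (A u) v) (fun u v => dot (B u) v)) ?subrr //.
- by move=> a x y w; rewrite lA hdotDl hdotZl.
- by move=> a x y w; rewrite hdotDr hdotZr.
- by move=> a x y w; rewrite lB hdotDl hdotZl.
- by move=> a x y w; rewrite hdotDr hdotZr.
Qed.

Lemma cauchy_schwarz u v : `|dot u v| <= (hnorm u * hnorm v)%:C.
Proof.
have [v0|v0] := eqVneq (hnorm v) 0.
  by rewrite (hnorm0P v0) hdotC -(scale0r v) hdotZl mul0r conjc0 normr0 scale0r hnorm0 mulr0.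
set b := hnorm v ^+ 2; have b0 : 0 < b by rewrite exprn_gt0 // lt_neqAle eq_sym v0 hnorm_ge0.
(* [s *: v] is the orthogonal projection of [u] on the line of [v]; the squared distance from [u] to
   it is nonnegative. *)
set z := dot u v; pose s : C := z * (b^-1)%:C.
have cs : conjc s = conjc z * (b^-1)%:C by rewrite /s rmorphM /= oppr0.
have bb : (b^-1)%:C * b%:C = 1 :> C by rewrite -rmorphM /= mulVf ?gt_eqF.
have nz : `|z| ^+ 2 = z * conjc z by rewrite sqr_normc.
have : 0 <= dot (u - s *: v) (u - s *: v) by rewrite hdotvv ler0c exprn_ge0 ?hnorm_ge0.
rewrite hdotBl !hdotBr !hdotZl !hdotZr !hdotvv -/b -/z [dot v u]hdotC -/z cs.
have -> : (hnorm u ^+ 2)%:C - conjc z * (b^-1)%:C * z -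
    (s * conjc z - s * (conjc z * (b^-1)%:C * b%:C)) =
   (hnorm u ^+ 2)%:C - `|z| ^+ 2 * (b^-1)%:C.
  by rewrite -[_ * _ * b%:C]mulrA bb nz; ring.
have -> : `|z| = (complex.Re `|z|)%:C by rewrite RRe_real // normr_real.
rewrite -rmorphXn -rmorphM -rmorphB /= ler0c lecR subr_ge0 ler_pdivrMr // /b -exprMn => h.
rewrite -(@ler_pXn2r _ 2) // nnegrE ?mulr_ge0 ?hnorm_ge0 //.
by case: (z) => x y; rewrite /= sqrtr_ge0.
Qed.

(** Convergence in norm with real radii; [hcvgP] identifies it with the topological one, where the
    radii live in [R[i]]. *)
Definition hcvg (x : nat -> H) l := forall eps : R, 0 < eps ->
  exists n0, forall n, (n0 <= n)%N -> hnorm (x n - l) < eps.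

Lemma hcvgP (x : nat -> H) l : hcvg x l <-> x @ \oo --> l.
Proof.
split=> [xl|xl eps e0].
  apply/cvgrPdist_lt => e e0.
  have e0' : 0 < complex.Re e by move: e0; rewrite ltcE => /andP[].
  have eE : e = (complex.Re e)%:C by rewrite RRe_real // gtr0_real.
  have [n0 hn0] := xl _ e0'.
  by exists n0 => // n /= /hn0; rewrite eE hnormE ltcR hnormB.
have /cvgrPdist_lt/(_ eps%:C) := xl; rewrite (ltcR 0) => /(_ e0)[n0 _ h].
by exists n0 => n /h /=; rewrite hnormE ltcR hnormB.
Qed.

Lemma hcomplete (x : nat -> H) :
  (forall eps : R, 0 < eps -> exists n0, forall m n, (n0 <= m)%N -> (n0 <= n)%N ->
     hnorm (x m - x n) < eps) -> exists l, hcvg x l.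
Proof.
move=> cx.
have /cauchy_cvgP/cvg_ex[l xl] : cauchy (x @ \oo).
  apply/cauchy_ballP => e e0.
  have e0' : 0 < complex.Re e by move: e0; rewrite ltcE => /andP[].
  have eE : e = (complex.Re e)%:C by rewrite RRe_real // gtr0_real.
  have [n0 hn0] := cx _ e0'.
  exists ([set x n | n in [set n | (n0 <= n)%N]], [set x n | n in [set n | (n0 <= n)%N]]).
    by split; exists n0 => // n /= hn; exists n.
  move=> [_ _] /= [[m hm <-] [n hn <-]].
  by rewrite -ball_normE /= hnormE eE ltcR hn0.
by exists l; apply/hcvgP.
Qed.

Lemma hdot_cvgl (x : nat -> H) l v : hcvg x l -> dot (x n) v @[n --> \oo] --> dot l v.
Proof.
move=> xl; apply/cvgrPdist_lt => e e0.
have e0' : 0 < complex.Re e by move: e0; rewrite ltcE => /andP[].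
have eE : e = (complex.Re e)%:C by rewrite RRe_real // gtr0_real.
have v0 : 0 < hnorm v + 1 by rewrite ltr_wpDl ?hnorm_ge0.
have [n0 hn0] := xl _ (divr_gt0 e0' v0).
exists n0 => // n /= /hn0; rewrite -hdotBl hnormB ltr_pdivlMr // => h.
rewrite eE; apply: le_lt_trans (cauchy_schwarz _ _) _; rewrite ltcR.
by apply: le_lt_trans h; rewrite ler_wpM2l ?hnorm_ge0 // lerDl.
Qed.

Lemma hdot_cvgr (x : nat -> H) l v : hcvg x l -> dot v (x n) @[n --> \oo] --> dot v l.
Proof.
move=> xl; have /cvgrPdist_lt h := hdot_cvgl (v := v) xl.
apply/cvgrPdist_lt => e /h; apply: filterS => n.
by rewrite -hdotBl -hdotBr [dot v _]hdotC normcJ.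
Qed.

Lemma hcvg_unique (x : nat -> H) l m : hcvg x l -> hcvg x m -> l = m.
Proof.
move=> xl xm; apply/eqP; rewrite -subr_eq0; apply/eqP/hnorm_eq0 => eps e0.
have e2 : 0 < eps / 2 by rewrite divr_gt0.
have [n1 h1] := xl _ e2; have [n2 h2] := xm _ e2.
have := h1 _ (leq_maxl n1 n2); have := h2 _ (leq_maxr n1 n2).
set y := x _ => a b; rewrite -(subrKA y).
have := hnormD (l - y) (y - m); rewrite (hnormB l); lra.
Qed.

End HilbertGeometry.

(** * Bounded operators and density arguments *)

Section BoundedOperators.
Variables (R : realType) (H H' : hilbertSpace R).
Implicit Types (u v : H).

Lemma isometry_dot (W : H -> H') : linear W -> (forall v, `|W v| = `|v|) ->
  forall u v, hs_dot H' (W u) (W v) = hs_dot H u v.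
Proof.
move=> lW iW.
apply: (@sesqui_polar _ _ (fun u v => hs_dot H' (W u) (W v)) (hs_dot H)).
- by move=> a x y w; rewrite lW hdotDl hdotZl.
- by move=> a x y w; rewrite lW hdotDr hdotZr.
- by move=> a x y w; rewrite hdotDl hdotZl.
- by move=> a x y w; rewrite hdotDr hdotZr.
- by move=> v; rewrite -!hs_normE iW.
Qed.

Lemma bounded_opP (T : H -> H') :
  linear T -> continuous T -> exists2 M : R, 0 < M & forall v, hnorm (T v) <= M * hnorm v.
Proof.
move=> lT cT.
have [T0 _ TB TZ] := linear_props lT.
have := cT 0; rewrite /continuous_at T0 => /cvgrPdist_lt/(_ 1 ltr01).
move=> /nbhs_ballP[e /= e0 he].
have e0' : 0 < complex.Re e by move: e0; rewrite ltcE => /andP[].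
have eE : e = (complex.Re e)%:C by rewrite RRe_real // gtr0_real.
set d := complex.Re e in e0' eE.
exists (2 / d); first by rewrite divr_gt0.
move=> v; have [v0|v0] := eqVneq (hnorm v) 0.
  by rewrite (hnorm0P v0) T0 /hnorm !normr0 mulr0.
have vp : 0 < hnorm v by rewrite lt_neqAle eq_sym v0 hnorm_ge0.
(* Scaling by [t] brings [v] to norm d / 2, strictly inside the ball on which [T] is bounded by
   1. *)
pose t := d / (2 * hnorm v); have t0 : 0 < t by rewrite divr_gt0 ?mulr_gt0.
have := he (t%:C *: v); rewrite -ball_normE /= sub0r normrN eE normrZ hnormE.
rewrite ger0_norm ?ler0c ?(ltW t0) // -rmorphM /= ltcR.
have -> : t * hnorm v = d / 2 by rewrite /t; field.
move=> /(_ _)/wrap[]; first by rewrite ltr_pdivrMr // mulr_natr mulr2n ltrDl.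
rewrite sub0r normrN TZ normrZ hnormE ger0_norm ?ler0c ?(ltW t0) // -rmorphM /= ltcR => h.
have -> : 2 / d * hnorm v = t^-1 by rewrite /t invfM invrK; field; rewrite !gt_eqF.
by rewrite -[t^-1]mul1r ler_pdivlMr // mulrC ltW.
Qed.

Lemma bounded_continuous (T : H -> H') (M : R) :
  linear T -> (forall v, hnorm (T v) <= M * hnorm v) -> continuous T.
Proof.
move=> lT hM v.
have [_ _ TB _] := linear_props lT.
apply/cvgrPdist_lt => e e0.
have e0' : 0 < complex.Re e by move: e0; rewrite ltcE => /andP[].
have eE : e = (complex.Re e)%:C by rewrite RRe_real // gtr0_real.
set d := complex.Re e in e0' eE.
(* The bound [M] may be zero or negative, so it is replaced by a positive number before dividing. *)
have M0 : 0 < `|M| + 1 by rewrite ltr_wpDl.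
have d0 : 0 < (d / (`|M| + 1))%:C :> R[i] by rewrite (ltcR 0) divr_gt0.
apply/nbhs_ballP; exists (d / (`|M| + 1))%:C => //= w.
rewrite -ball_normE /= -TB eE !hnormE !ltcR => h.
apply: le_lt_trans (hM _) _.
apply: le_lt_trans (_ : (`|M| + 1) * hnorm (v - w) < _).
  by rewrite ler_wpM2r ?hnorm_ge0 // (le_trans (ler_norm M)) // lerDl.
by rewrite mulrC -ltr_pdivlMr.
Qed.

Lemma linear_dense_eq (I : Type) (L : I -> H) (A B : H -> H') :
  (forall v eps, 0 < eps -> exists i, hnorm (L i - v) < eps) ->
  linear A -> continuous A -> linear B -> continuous B ->
  (forall i, A (L i) = B (L i)) -> forall v, A v = B v.
Proof.
move=> dL lA cA lB cB h v.
have lAB : linear (fun v => A v - B v).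
  by move=> a x y; rewrite lA lB scalerBr addrACA -opprD.
have [|M M0 hM] := bounded_opP lAB.
  by move=> x; apply: cvgB; [exact: cA|exact: cB].
have [_ _ /= DB _] := linear_props lAB.
apply/eqP; rewrite -subr_eq0; apply/eqP/hnorm_eq0 => eps e0.
have [|i hi] := dL v (eps / M); first by rewrite divr_gt0.
have := hM (v - L i); rewrite DB h subrr subr0 => /le_trans; apply.
by rewrite mulrC -ler_pdivlMr // hnormB ltW.
Qed.

End BoundedOperators.

(** * Square root of a positive contraction *)

Section SquareRoot.
Variables (R : realType) (H : hilbertSpace R).
Local Notation C := R[i].
Local Notation dot := (hs_dot H).
Implicit Types (u v w : H) (X Y Z : H -> H).

(* Operators that behave like polynomials in [X] with nonnegative coefficients
   summing up to [y]. *)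
Definition monotone_in X Y (y : R) : Prop :=
  [/\ linear Y, forall v, hnorm (Y v) <= y * hnorm v, adjoint_op Y Y &
      forall Z, linear Z -> (forall v, Z (X v) = X (Z v)) ->
        forall v, Z (Y v) = Y (Z v)].

Variable X : H -> H.
Hypotheses (linX : linear X) (adjX : adjoint_op X X).
Hypothesis contrX : forall v, hnorm (X v) <= hnorm v.

Lemma monotone_in_id : monotone_in X X 1.
Proof. by split=> // v; rewrite mul1r. Qed.

Lemma monotone_in0 : monotone_in X (fun=> 0) 0.
Proof.
split=> [a x y|v|u v|Z lZ _ v]; first by rewrite scaler0 addr0.
- by rewrite hnorm0 mul0r.
- by rewrite -(scale0r v) hdotZl hdotZr conjc0 !mul0r.
- by have [] := linear_props lZ.
Qed.

Lemma monotone_in_half Y Y' y y' : monotone_in X Y y -> monotone_in X Y' y' ->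
  monotone_in X (fun v => (2^-1)%:C *: (Y v + Y' v)) (2^-1 * (y + y')).
Proof.
move=> [lY nY aY cY] [lY' nY' aY' cY']; split.
- move=> a u v; rewrite lY lY' !scalerDr !scalerA [a * _]mulrC !addrA; congr (_ + _).
  by rewrite -!addrA; congr (_ + _); rewrite addrC.
- move=> v; rewrite hnormZ ?invr_ge0 // -mulrA ler_wpM2l ?invr_ge0 // mulrDl.
  by rewrite (le_trans (hnormD _ _)) // lerD.
- by move=> u v; rewrite hdotZl hdotZr conjc_real hdotDl hdotDr aY aY'.
- move=> Z lZ cZ v; have [_ ZD _ ZZ] := linear_props lZ.
  by rewrite ZZ ZD cY // cY'.
Qed.

(** A product of self-adjoint operators is self-adjoint when they commute. Here each factor commutes
    with everything that commutes with [X], in particular with the other factor. *)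
Lemma monotone_in_comp Y Y' y y' : 0 <= y -> monotone_in X Y y -> monotone_in X Y' y' ->
  monotone_in X (fun v => Y (Y' v)) (y * y').
Proof.
move=> y0 [lY nY aY cY] [lY' nY' aY' cY']; split.
- by move=> a u v; rewrite lY' lY.
- by move=> v; rewrite (le_trans (nY _)) // -mulrA ler_wpM2l.
- move=> u v; rewrite aY aY'; congr (dot _ _).
  by rewrite cY // => w; rewrite cY'.
- by move=> Z lZ cZ v; rewrite cY // cY'.
Qed.

(* Newton's iteration for [Y = (X + Y^2) / 2], i.e. [(1 - Y)^2 = 1 - X]. *)
Fixpoint newton n : H -> H :=
  if n is n'.+1 then fun v => (2^-1)%:C *: (X v + newton n' (newton n' v))
  else fun=> 0.
(** The same iteration with [X] replaced by the number 1; it majorises the operator iteration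
    because the coefficients are nonnegative. *)
Fixpoint newton_bound n : R :=
  if n is n'.+1 then 2^-1 * (1 + newton_bound n' * newton_bound n') else 0.

Lemma newton_bound_ge0 n : 0 <= newton_bound n.
Proof.
by elim: n => //= n IH; rewrite mulr_ge0 ?invr_ge0 // addr_ge0 // mulr_ge0.
Qed.

Lemma newton_bound_le1 n : newton_bound n <= 1.
Proof.
elim: n => /= [|n IH]; first exact: ler01.
have := newton_bound_ge0 n; nra.
Qed.

Lemma newton_boundS n : 0 <= newton_bound n.+1 - newton_bound n.
Proof.
have := newton_bound_ge0 n; have := newton_bound_le1 n; rewrite /=; nra.
Qed.

Lemma newton_bound_ndecr : {homo newton_bound : m n / (m <= n)%N >-> m <= n}.
Proof.
by apply: homo_leq => [//|??? /le_trans h /h //|n]; rewrite -subr_ge0 newton_boundS.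
Qed.

Lemma monotone_newton n : monotone_in X (newton n) (newton_bound n).
Proof.
elim: n => [|n IH]; first exact: monotone_in0.
apply: monotone_in_half; first exact: monotone_in_id.
by apply: monotone_in_comp => //; exact: newton_bound_ge0.
Qed.

(** With Y_n the iterates, Y_{n+2} - Y_{n+1} = (Y_{n+1} + Y_n)(Y_{n+1} - Y_n) / 2, since the
    iterates commute. Thus the increments again have nonnegative coefficients, and the scalar
    increments bound them. *)
Lemma monotone_newtonS n :
  monotone_in X (fun v => newton n.+1 v - newton n v) (newton_bound n.+1 - newton_bound n).
Proof.
elim: n => [|n IH].
  have := monotone_in_half monotone_in_id monotone_in0.
  rewrite /= subr0 mulr0 addr0; set f := fun v => _; set g := fun v => _.
  by have -> : f = g by apply/funext => v; rewrite /f /g /= subr0.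
have h := monotone_in_comp _ (monotone_in_half (monotone_newton n.+1) (monotone_newton n)) IH.
have {h} := h _; set g := fun v => _; set f := fun v => newton n.+2 v - _.
have [l1 _ _ c1] := monotone_newton n.+1; have [l0 _ _ c0] := monotone_newton n.
have cX v : X (newton n.+1 v) = newton n.+1 (X v) by rewrite c1.
have cc v : newton n.+1 (newton n v) = newton n (newton n.+1 v) by rewrite c0.
have [_ D1 B1 _] := linear_props l1; have [_ D0 B0 _] := linear_props l0.
have -> : g = f.
  apply/funext => v; rewrite /g /f; symmetry.
  transitivity ((2^-1)%:C *: (X v + newton n.+1 (newton n.+1 v)) -
                (2^-1)%:C *: (X v + newton n (newton n v))); first by [].
  rewrite -scalerBr; congr (_ *: _).
  by rewrite B1 B0 cc opprD addrACA subrr add0r addrA subrK.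
set y1 := newton_bound n.+1; set y0 := newton_bound n.
have -> : 2^-1 * (y1 + y0) * (y1 - y0) = newton_bound n.+2 - y1.
  transitivity (2^-1 * (1 + y1 * y1) - 2^-1 * (1 + y0 * y0)); last by [].
  by ring.
apply; rewrite mulr_ge0 ?invr_ge0 // addr_ge0 ?newton_bound_ge0 //.
Qed.

Lemma newton_diff m n v : (m <= n)%N ->
  hnorm (newton n v - newton m v) <= (newton_bound n - newton_bound m) * hnorm v.
Proof.
elim: n => [|n IH]; first by rewrite leqn0 => /eqP ->; rewrite !subrr mul0r hnorm0.
rewrite leq_eqVlt => /predU1P[->|]; first by rewrite !subrr mul0r hnorm0.
rewrite ltnS => /IH {}IH.
rewrite -(subrKA (newton n v)) (le_trans (hnormD _ _)) //.
have -> : newton_bound n.+1 - newton_bound m =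
  (newton_bound n.+1 - newton_bound n) + (newton_bound n - newton_bound m).
  by rewrite addrA subrK.
rewrite mulrDl lerD //.
by have [_ + _ _] := monotone_newtonS n; apply.
Qed.

(** The scalar bounds increase and stay below 1, so they form a Cauchy sequence, and by
    [newton_diff] their increments dominate those of the vectors. *)
Lemma newton_cvg v : exists l, hcvg (newton^~ v) l.
Proof.
apply: hcomplete => eps e0.
have cb : cvgn newton_bound.
  apply: nondecreasing_is_cvgn newton_bound_ndecr _.
  by exists 1 => _ [n _ <-]; exact: newton_bound_le1.
have v0 : 0 < hnorm v + 1 by rewrite ltr_wpDl ?hnorm_ge0.
have /cvg_cauchy/cauchy_ballP/(_ (eps / (hnorm v + 1))) := cb.
rewrite divr_gt0 // => /(_ isT)[[A B] /= [[n1 _ h1] [n2 _ h2]] h].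
exists (maxn n1 n2) => m n; wlog mn : m n / (m <= n)%N => [hw hm hn|].
  have [|/ltnW] := leqP m n; first by move=> mn; exact: hw.
  by move=> mn; rewrite hnormB; exact: hw.
rewrite !geq_max => /andP[m1 m2] /andP[n1' n2'].
rewrite hnormB; apply: le_lt_trans (newton_diff _ mn) _.
have := h (newton_bound m, newton_bound n); rewrite /ball /=.
move=> /(_ _)/wrap[]; first by split; [exact: h1|exact: h2].
rewrite /ball_ distrC ger0_norm ?subr_ge0 ?newton_bound_ndecr // ltr_pdivlMr // => h'.
apply: le_lt_trans h'; rewrite ler_wpM2l ?subr_ge0 ?newton_bound_ndecr //.
by rewrite lerDl.
Qed.

(** The root is [1 - Y], where [Y] is the strong limit of Newton's iteration. Linearity, symmetry
    and the norm bound pass to the limit, and so does commutation with a bounded operator. *)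
Lemma sqrt_one_sub : exists S : H -> H,
  [/\ bounded_op S, adjoint_op S S, forall v, S (S v) = v - X v &
      forall Z, bounded_op Z -> (forall v, Z (X v) = X (Z v)) ->
        forall v, Z (S v) = S (Z v)].
Proof.
have [Y hY] := choice newton_cvg.
have bY v : hnorm (Y v) <= hnorm v.
  apply/ler_addgt0Pr => e e0; have [n0 /(_ _ (leqnn _)) h] := hY v _ e0.
  have := hnormD (Y v - newton n0 v) (newton n0 v); rewrite subrK hnormB.
  have [_ /(_ v) + _ _] := monotone_newton n0.
  have := newton_bound_le1 n0; have := hnorm_ge0 v; nra.
have lY : linear Y.
  move=> a u v; apply: hcvg_unique (hY _) _; apply/hcvgP.
  have -> : newton^~ (a *: u + v) = fun n => a *: newton n u + newton n v.
    by apply/funext => n; have [-> _ _ _] := monotone_newton n.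
  by apply: cvgD; [apply: cvgZr|]; apply/hcvgP/hY.
have aY : adjoint_op Y Y.
  move=> u v; apply: (cvg_unique _ (hdot_cvgl (hY u))) => //.
  have -> : (fun n => dot (newton n u) v) = fun n => dot u (newton n v).
    by apply/funext => n; have [_ _ -> _] := monotone_newton n.
  exact: hdot_cvgr.
have cY Z : bounded_op Z -> (forall v, Z (X v) = X (Z v)) -> forall v, Z (Y v) = Y (Z v).
  move=> [lZ cZ] cX v; apply: (@hcvg_unique _ _ (fun n => newton n (Z v))); last exact: hY.
  move=> eps e0.
  have [M M0 hM] := bounded_opP lZ cZ; have [_ _ ZB _] := linear_props lZ.
  have [n0 h] := hY v (eps / M) (divr_gt0 e0 M0).
  exists n0 => n /h; have [_ _ _ c] := monotone_newton n.
  rewrite -c // -ZB ltr_pdivlMr // mulrC; exact: le_lt_trans.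
have fixY v : (2^-1)%:C *: (X v + Y (Y v)) = Y v.
  apply: (@hcvg_unique _ _ (fun n => newton n.+1 v)); last first.
    by move=> e /(hY v)[n0 h]; exists n0 => n /leqW /h.
  apply/hcvgP; rewrite [X in X @ _]/=; apply: cvgZr; apply: cvgD; first exact: cvg_cst.
  (* Y_n Y_n v - Y Y v splits into Y_n (Y_n v - Y v), controlled because Y_n is a contraction, and
     Y_n (Y v) - Y (Y v). *)
  apply/hcvgP => e e0.
  have e2 : 0 < e / 2 by rewrite divr_gt0.
  have [n1 h1] := hY v _ e2; have [n2 h2] := hY (Y v) _ e2.
  exists (maxn n1 n2) => n; rewrite geq_max => /andP[/h1 {}h1 /h2 {}h2].
  have [l b _ _] := monotone_newton n; have [_ _ B _] := linear_props l.
  rewrite -(subrKA (newton n (Y v))) -B (le_lt_trans (hnormD _ _)) //.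
  have := b (newton n v - Y v); have := newton_bound_le1 n.
  have := newton_bound_ge0 n; have := hnorm_ge0 (newton n v - Y v); nra.
have [Y0 YD YB YZ] := linear_props lY.
exists (fun v => v - Y v); split.
- have l1 : linear (fun v => v - Y v).
    by move=> a u v; rewrite lY scalerBr addrACA -opprD.
  split=> //; apply: (bounded_continuous (M := 2)) l1 _ => v.
  have := hnormD v (- Y v); have := bY v.
  have -> : hnorm (- Y v) = hnorm (Y v) by rewrite /hnorm normrN.
  lra.
- by move=> u v; rewrite hdotBl hdotBr aY.
- move=> v; rewrite YB.
  have -> : X v = (2 : C) *: Y v - Y (Y v).
    rewrite -{1}(fixY v) scalerA.
    have -> : (2 : C) * (2^-1)%:C = 1.
      by rewrite -[2 : C]/(1 + 1) -(rmorph1 (real_complex R)) -rmorphD -rmorphM divff.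
    by rewrite scale1r addrK.
  by rewrite scaler_nat mulr2n !opprD !opprK !addrA.
- move=> Z [lZ cZ] cX v; have [_ _ ZB _] := linear_props lZ.
  by rewrite ZB cY.
Qed.

End SquareRoot.

(** The ground state condition controls only a quadratic form, whereas Newton's iteration needs a
    norm bound. The bridge is X^2 <= X <= 1. *)
Lemma form_contraction (R : realType) (H : hilbertSpace R) (X : H -> H) :
  linear X -> adjoint_op X X ->
  (forall v, 0 <= hs_dot H (X v) v <= hs_dot H v v) ->
  forall v, hnorm (X v) <= hnorm v.
Proof.
move=> lX aX hX v.
have pos w : 0 <= hs_dot H (w - X w) w.
  by rewrite hdotBl subr_ge0; have /andP[] := hX w.
have [_ _ XB _] := linear_props lX.
(* [X - X^2 = X (1 - X) X + (1 - X) X (1 - X)] *)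
have h : hs_dot H (X v) (X v) <= hs_dot H (X v) v.
  rewrite -subr_ge0.
  have -> : hs_dot H (X v) v - hs_dot H (X v) (X v) =
    hs_dot H (X v - X (X v)) (X v) + hs_dot H (X (v - X v)) (v - X v).
    rewrite XB -hdotDr [X v + (v - X v)]addrC subrK [in RHS]hdotBl; congr (_ - _).
    by rewrite [RHS]aX.
  by rewrite addr_ge0 //; have /andP[] := hX (v - X v).
have /andP[_ h2] := hX v.
have := le_trans h h2; rewrite !hdotvv lecR ler_pXn2r ?nnegrE ?hnorm_ge0 //.
Qed.

(** * Extension of isometries from dense families *)

Section UnitaryExtension.
Variables (R : realType) (I : lmodType R[i]).

Definition dense_map (H : hilbertSpace R) (L : I -> H) :=
  forall v (eps : R), 0 < eps -> exists i, hnorm (L i - v) < eps.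

Section Relation.
Variables (H1 H2 : hilbertSpace R) (L1 : I -> H1) (L2 : I -> H2).
Hypotheses (linL1 : linear L1) (linL2 : linear L2).
Hypothesis isoL : forall i, hnorm (L1 i) = hnorm (L2 i).

(** The closure of the graph of [L1 i |-> L2 i]. It is symmetric in the two sides, so the inverse of
    the extension comes from the same construction. *)
Definition ext_rel v w := forall eps : R, 0 < eps ->
  exists i, hnorm (L1 i - v) < eps /\ hnorm (L2 i - w) < eps.

Let isoLB i j : hnorm (L1 i - L1 j) = hnorm (L2 i - L2 j).
Proof.
have [_ _ B1 _] := linear_props linL1; have [_ _ B2 _] := linear_props linL2.
by rewrite -B1 -B2.
Qed.

Lemma ext_rel_ex v : dense_map L1 -> exists w, ext_rel v w.
Proof.
move=> dL1.
have /choice[x hx] : forall n : nat, exists i, hnorm (L1 i - v) < n.+1%:R^-1.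
  by move=> n; apply: dL1.
have inv_small (e : R) : 0 < e -> exists n0, forall n, (n0 <= n)%N -> n.+1%:R^-1 < e.
  move=> e0; exists (Num.truncn e^-1) => n hn.
  rewrite invf_plt ?posrE //; apply: lt_le_trans (truncnS_gt _) _.
  by rewrite ler_nat ltnS.
have [w hw] : exists w, hcvg (fun n => L2 (x n)) w.
  apply: hcomplete => e e0; have [|n0 h0] := inv_small (e / 2); first by rewrite divr_gt0.
  exists n0 => m n hm hn; rewrite -isoLB -(subrKA v).
  have := hnormD (L1 (x m) - v) (v - L1 (x n)); rewrite [hnorm (v - _)]hnormB.
  have := lt_trans (hx m) (h0 m hm); have := lt_trans (hx n) (h0 n hn); lra.
exists w => e e0; have [n1 h1] := hw e e0; have [n2 h2] := inv_small e e0.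
exists (x (maxn n1 n2)); split; last by apply: h1; exact: leq_maxl.
by apply: lt_trans (hx _) _; apply: h2; exact: leq_maxr.
Qed.

Lemma ext_rel_dist v w v' w' : ext_rel v w -> ext_rel v' w' -> hnorm (w - w') <= hnorm (v - v').
Proof.
move=> r r'; apply/ler_addgt0Pr => e e0.
have e4 : 0 < e / 4 by rewrite divr_gt0.
have [i [i1 i2]] := r _ e4; have [j [j1 j2]] := r' _ e4.
have := hnormD (w - L2 i) (L2 i - w'); rewrite subrKA (hnormB w (L2 i)).
have := hnormD (L2 i - L2 j) (L2 j - w'); rewrite subrKA -isoLB.
have := hnormD (L1 i - v) (v - L1 j); rewrite subrKA.
have := hnormD (v - v') (v' - L1 j); rewrite subrKA (hnormB v').
lra.
Qed.

Lemma ext_rel_linear a v w v' w' : ext_rel v w -> ext_rel v' w' ->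
  ext_rel (a *: v + v') (a *: w + w').
Proof.
move=> r r' e e0; pose k := complex.Re `|a|.
have aE : `|a| = k%:C by rewrite RRe_real ?normr_real.
have k0 : 0 <= k by rewrite -lecR -aE normr_ge0.
have nZ (H : hilbertSpace R) (u : H) : hnorm (a *: u) = k * hnorm u.
  by apply: (@complexI R); rewrite -hnormE normrZ aE rmorphM /= -hnormE.
have k1 : 0 < k + 1 by rewrite ltr_wpDl.
have [i [i1 i2]] := r (e / 2 / (k + 1)) (divr_gt0 (divr_gt0 e0 (ltr0Sn _ _)) k1).
have [j [j1 j2]] := r' (e / 2) (divr_gt0 e0 (ltr0Sn _ _)).
have key (H : hilbertSpace R) (x x' y y' : H) : hnorm (x - y) < e / 2 / (k + 1) ->
    hnorm (x' - y') < e / 2 -> hnorm (a *: x + x' - (a *: y + y')) < e.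
  rewrite ltr_pdivlMr // opprD addrACA -scalerBr => h h'.
  have := hnormD (a *: (x - y)) (x' - y'); rewrite nZ.
  have := hnorm_ge0 (x - y); nra.
by exists (a *: i + j); rewrite linL1 linL2; split; exact: key.
Qed.

End Relation.

Lemma ext_rel_sym (H1 H2 : hilbertSpace R) (L1 : I -> H1) (L2 : I -> H2) v w :
  ext_rel L1 L2 v w -> ext_rel L2 L1 w v.
Proof. by move=> h e /h[i [? ?]]; exists i. Qed.

(** [L1] need not be injective: equality of the norms makes both maps have the same kernel and the
    closed graph single valued in each direction. Density makes it total on both sides. *)
Lemma unitary_extension (H1 H2 : hilbertSpace R) (L1 : I -> H1) (L2 : I -> H2) :
  linear L1 -> linear L2 -> dense_map L1 -> dense_map L2 ->
  (forall i, hnorm (L1 i) = hnorm (L2 i)) ->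
  exists (W : H1 -> H2) (V : H2 -> H1),
    [/\ linear W, forall v, `|W v| = `|v|, cancel W V, cancel V W &
        forall i, W (L1 i) = L2 i].
Proof.
move=> l1 l2 d1 d2 iso.
have iso' i : hnorm (L2 i) = hnorm (L1 i) by [].
have /choice[W hW] : forall v, exists w, ext_rel L1 L2 v w.
  by move=> v; exact: ext_rel_ex.
have /choice[V hV] : forall w, exists v, ext_rel L1 L2 v w.
  by move=> w; have [v /ext_rel_sym h] := ext_rel_ex l2 l1 iso' w d2; exists v.
have uni v w w' : ext_rel L1 L2 v w -> ext_rel L1 L2 v w' -> w = w'.
  move=> r r'; apply/eqP; rewrite -subr_eq0; apply/eqP/hnorm_eq0 => e e0.
  by rewrite (le_trans (ext_rel_dist l1 l2 iso r r')) // subrr hnorm0 ltW.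
have uni' v v' w : ext_rel L1 L2 v w -> ext_rel L1 L2 v' w -> v = v'.
  move=> /ext_rel_sym r /ext_rel_sym r'.
  apply/eqP; rewrite -subr_eq0; apply/eqP/hnorm_eq0 => e e0.
  by rewrite (le_trans (ext_rel_dist l2 l1 iso' r r')) // subrr hnorm0 ltW.
have [z1 _ _ _] := linear_props l1; have [z2 _ _ _] := linear_props l2.
have r0 : ext_rel L1 L2 0 0.
  by move=> e e0; exists 0; rewrite z1 z2 !subrr !hnorm0.
exists W, V; split.
- move=> a u v; apply: (uni (a *: u + v)); first exact: hW.
  by apply: ext_rel_linear.
- move=> v; rewrite !hnormE; congr (_ %:C); apply/eqP; rewrite eq_le.
  have := ext_rel_dist l1 l2 iso (hW v) r0.
  have := ext_rel_dist l2 l1 iso' (ext_rel_sym (hW v)) (ext_rel_sym r0).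
  by rewrite !subr0 => -> ->.
- by move=> v; apply: (uni' _ _ (W v)); [exact: hV|exact: hW].
- by move=> w; apply: (uni (V w)); [exact: hW|exact: hV].
- move=> i; apply: (uni (L1 i)); first exact: hW.
  move=> e e0.
  by exists i; rewrite !subrr !hnorm0.
Qed.

End UnitaryExtension.

(** * Transport of spectral measures along a unitary *)

Section Transport.
Variables (R : realType) (H1 H2 : hilbertSpace R) (W : H1 -> H2) (V : H2 -> H1).
Hypotheses (linW : linear W) (isoW : forall v, `|W v| = `|v|).
Hypotheses (WK : cancel W V) (VK : cancel V W).

Let linV : linear V.
Proof. by move=> a u v; rewrite -{1}(VK u) -{1}(VK v) -linW WK. Qed.

Let contW : continuous W.
Proof.
apply: (bounded_continuous (M := 1)) linW _ => v.
by rewrite mul1r /hnorm isoW.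
Qed.

Let contV : continuous V.
Proof.
apply: (bounded_continuous (M := 1)) linV _ => v.
by rewrite mul1r -{2}(VK v) /hnorm isoW.
Qed.

Let dotV u v : hs_dot H1 (V u) (V v) = hs_dot H2 u v.
Proof. by rewrite -(isometry_dot linW isoW) !VK. Qed.

Lemma bounded_op_transport (A : H1 -> H1) : bounded_op A -> bounded_op (fun v => W (A (V v))).
Proof.
move=> [lA cA]; split=> [a u v|v]; first by rewrite linV lA linW.
apply: continuous_comp; last exact: contW.
by apply: continuous_comp; [exact: contV|exact: cA].
Qed.

Section Pvm.
Variables (d : measure_display) (X : measurableType d) (E : pvm H1 X).

Definition transport_proj (S : set X) v := W (pvm_proj E S (V v)).
Definition transport_meas v : {measure set X -> \bar R} := pvm_meas E (V v).

Lemma transport_bounded S : measurable S -> bounded_op (transport_proj S).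
Proof. by move=> mS; apply: bounded_op_transport; exact: pvm_bounded. Qed.

Lemma transport_adjoint S : measurable S -> adjoint_op (transport_proj S) (transport_proj S).
Proof.
move=> mS u v; rewrite /transport_proj.
by rewrite -[in LHS]dotV WK pvm_adjoint // -[in RHS]dotV WK.
Qed.

Lemma transport_idem S v : measurable S ->
  transport_proj S (transport_proj S v) = transport_proj S v.
Proof. by move=> mS; rewrite /transport_proj WK pvm_idem. Qed.

Lemma transport_total v : transport_proj setT v = v.
Proof. by rewrite /transport_proj pvm_total VK. Qed.

Lemma transport_measE v S : measurable S ->
  transport_meas v S = (complex.Re (hs_dot H2 (transport_proj S v) v))%:E.
Proof. by move=> mS; rewrite /transport_meas pvm_measE // /transport_proj -dotV WK. Qed.

Definition transport_pvm : pvm H2 X :=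
  Pvm transport_bounded transport_adjoint transport_idem transport_total transport_measE.

Lemma spectral_integral_transport f (A : H1 -> H1) (B : H2 -> H2) :
  (forall v, W (A v) = B (W v)) ->
  spectral_integral E f A -> spectral_integral transport_pvm f B.
Proof.
move=> AB [bA hA].
have BE : B = fun v => W (A (V v)) by apply/funext => v; rewrite AB VK.
split; first by rewrite BE; exact: bounded_op_transport.
move=> v /=; have [i1 i2 e] := hA (V v); split=> //.
by rewrite -e -dotV BE WK.
Qed.

End Pvm.

Lemma joint_spectrum_transport (A B C : H1 -> H1) (A' B' C' : H2 -> H2) :
  (forall v, W (A v) = A' (W v)) -> (forall v, W (B v) = B' (W v)) ->
  (forall v, W (C v) = C' (W v)) -> joint_spectrum A B C `<=` joint_spectrum A' B' C'.
Proof.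
move=> hA hB hC l [E [sA sB sC hO]]; exists (transport_pvm E); split.
- exact: spectral_integral_transport sA.
- exact: spectral_integral_transport sB.
- exact: spectral_integral_transport sC.
- move=> O mO nO; have [v hv] := hO O mO nO; exists (W v).
  rewrite /= /transport_proj WK; apply: contra hv => /eqP h0.
  by rewrite -normr_eq0 -isoW h0 normr0.
Qed.

End Transport.

(** * Recovering the momentum from the translations *)

Section Sawtooth.
Variable R : realType.
Implicit Types (p : R) (n k : nat).

(** These are (2n)!! / (2n+1)!!, the coefficients of arcsin x / sqrt(1 - x^2). At x = sin(p/2) this
    function is (p/2) / (sin(p/2) cos(p/2)) times x, which gives the series of p / sin p. *)
Fixpoint saw_coef n : R :=
  if n is k.+1 then saw_coef k * ((2 * k + 2)%:R / (2 * k + 3)%:R) else 1.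

Definition saw_var p : R := (1 - cos p) / 2.

(* The partial sums of the expansion of [p / sin p] in powers of
   [sin (p / 2) ^+ 2], multiplied by [sin p]. *)
Definition saw n p : R := \sum_(k < n) saw_coef k * sin p * saw_var p ^+ k.

Lemma saw_coef_ge0 n : 0 <= saw_coef n.
Proof. by elim: n => //= n IH; rewrite mulr_ge0 // divr_ge0. Qed.

Lemma saw_coef_le1 n : saw_coef n <= 1.
Proof.
elim: n => //= n IH; rewrite mulr_ile1 ?saw_coef_ge0 ?divr_ge0 //.
by rewrite ler_pdivrMr ?ltr0n ?addn3 // mul1r ler_nat addn2 leqW.
Qed.

Lemma saw_var_ge0 p : 0 <= saw_var p.
Proof. by rewrite /saw_var divr_ge0 // subr_ge0 cos_le1. Qed.

Lemma saw_var_le1 p : saw_var p <= 1.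
Proof. rewrite /saw_var; have := cos_geN1 p; lra. Qed.

(** With u = [saw_var p], the derivative of sin p u^k is (2k+1) u^k - (2k+2) u^(k+1). The recursion
    of [saw_coef] is chosen so that consecutive terms cancel, and only the first and the last
    remain. *)
Lemma is_derive_saw n p :
  is_derive p 1 (saw n) (1 - (2 * n + 1)%:R * saw_coef n * saw_var p ^+ n).
Proof.
elim: n => [|n IH].
  have -> : saw 0 = cst 0 by apply/funext => x; rewrite /saw big_ord0.
  rewrite (_ : 1 - _ = 0); first exact: is_derive_cst.
  by rewrite muln0 add0n expr0 /saw_coef !mulr1 subrr.
have -> : saw n.+1 = saw n + (fun x => saw_coef n * (sin x * saw_var x ^+ n)).
  apply/funext => x; transitivity (saw n x + saw_coef n * (sin x * saw_var x ^+ n)) => //.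
  by rewrite /saw big_ord_recr /= mulrA.
have dv : is_derive p 1 saw_var (sin p / 2).
  have := is_deriveZ (2^-1 : R) (is_deriveB (is_derive_cst (1 : R) p 1) (is_derive_cos p)).
  rewrite sub0r opprK /GRing.scale /= mulrC.
  congr (is_derive _ _ _ _); apply/funext => x; rewrite /saw_var mulrC; reflexivity.
have dX : is_derive p 1 (fun x => saw_var x ^+ n) ((n%:R * saw_var p ^+ n.-1) * (sin p / 2)).
  by have := is_deriveX n dv; rewrite exprfctE.
have dM : is_derive p 1 (fun x => sin x * saw_var x ^+ n)
   (sin p * (n%:R * saw_var p ^+ n.-1 * (sin p / 2)) + saw_var p ^+ n * cos p).
  by have := is_deriveM (is_derive_sin p) dX.
have dZ : is_derive p 1 (fun x => saw_coef n * (sin x * saw_var x ^+ n))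
   (saw_coef n * (sin p * (n%:R * saw_var p ^+ n.-1 * (sin p / 2)) + saw_var p ^+ n * cos p)).
  by have := is_deriveZ (saw_coef n) dM.
apply: is_derive_eq.
have s2 : sin p * sin p = 4 * saw_var p * (1 - saw_var p).
  by have := cos2Dsin2 p; rewrite /saw_var; set c := cos p; set s := sin p => E;
     have -> : s * s = 1 - c ^+ 2; [by rewrite -E; ring | by field].
have c1 : cos p = 1 - 2 * saw_var p by rewrite /saw_var; field.
have -> : sin p * (n%:R * saw_var p ^+ n.-1 * (sin p / 2)) =
          2 * n%:R * saw_var p ^+ n * (1 - saw_var p).
  transitivity (n%:R * saw_var p ^+ n.-1 * (sin p * sin p) / 2); first by ring.
  rewrite s2; case: n {IH dX dM dZ} => [|n]; first by rewrite !mul0r mulr0 !mul0r.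
  by rewrite /= exprS; field.
rewrite c1 /= exprS; set u := saw_var p; set d := saw_coef n.
have -> : (2 * n.+1 + 1)%:R * (d * ((2 * n + 2)%:R / (2 * n + 3)%:R)) = d * (2 * n + 2)%:R.
  have -> : (2 * n.+1 + 1 = 2 * n + 3)%N by lia.
  by rewrite mulrCA; congr (_ * _); rewrite mulrC divfK // pnatr_eq0 addn3.
have -> : (2 * n + 1)%:R = 2 * n%:R + 1 :> R by rewrite natrD natrM.
have -> : (2 * n + 2)%:R = 2 * n%:R + 2 :> R by rewrite natrD natrM.
by ring.
Qed.

(** Mean value theorem on [0, p]: the derivative of the remainder is nonnegative and, as [saw_var]
    increases on [0, pi], at most its bound at [p]. *)
Lemma saw_rem n p : 0 <= p -> p < pi ->
  0 <= p - saw n p /\ p - saw n p <= pi * ((2 * n + 1)%:R * saw_var p ^+ n).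
Proof.
move=> p0 ppi.
have dr (x : R) : is_derive x (1 : R) (fun x => x - saw n x) ((2 * n + 1)%:R * saw_coef n * saw_var x ^+ n).
  have := is_deriveB (is_derive_id x 1) (is_derive_saw n x).
  by rewrite subKr.
have [|c] := MVT_segment p0 (fun x _ => dr x).
  apply: derivable_within_continuous => x _; by have [] := dr x.
rewrite in_itv /= => /andP[c0 cp].
have -> : saw n 0 = 0.
  by rewrite /saw big1 // => k _; rewrite sin0 mulr0 mul0r.
rewrite !subr0 => ->.
have h0 : 0 <= (2 * n + 1)%:R * saw_coef n * saw_var c ^+ n.
  by rewrite !mulr_ge0 ?saw_coef_ge0 // exprn_ge0 // saw_var_ge0.
split; first by rewrite mulr_ge0.
rewrite mulrC ler_pM //; first exact: ltW.
rewrite -mulrA ler_wpM2l //.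
rewrite -[leRHS]mul1r ler_pM ?saw_coef_ge0 ?saw_coef_le1 ?exprn_ge0 ?saw_var_ge0 //.
rewrite lerXn2r ?nnegrE ?saw_var_ge0 // /saw_var ler_wpM2r ?invr_ge0 // lerB //.
move: cp; rewrite le_eqVlt => /predU1P[->//|cp]; rewrite ltW // ltr_cos // in_itv /=.
  by rewrite c0 (le_trans (ltW cp)) // ltW.
by rewrite p0 ltW.
Qed.

Lemma sawN n p : saw n (- p) = - saw n p.
Proof.
rewrite /saw -sumrN; apply: eq_bigr => k _.
by rewrite /saw_var sinN cosN mulrN mulNr.
Qed.

Lemma saw_ge0 n p : 0 <= p -> p <= pi -> 0 <= saw n p.
Proof.
move=> p0 pp; apply: sumr_ge0 => k _.
by rewrite !mulr_ge0 ?saw_coef_ge0 ?sin_ge0_pi ?p0 // exprn_ge0 // saw_var_ge0.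
Qed.

(** Half of the decay absorbs the linear factor: with s = sqrt q, n s^n is at most the geometric sum
    1 / (1 - s), and another s^n is left over. *)
Lemma cvg_natXn (q : R) : 0 <= q -> q < 1 -> (fun n => (2 * n + 1)%:R * q ^+ n) @ \oo --> (0 : R).
Proof.
move=> q0 q1; pose s := Num.sqrt q.
have s0 : 0 <= s by rewrite sqrtr_ge0.
have s1 : s < 1 by rewrite -sqrtr1 ltr_sqrt.
have qE : q = s ^+ 2 by rewrite sqr_sqrtr.
have bd n : n%:R * s ^+ n <= (1 - s)^-1.
  have h1 : n%:R * s ^+ n <= \sum_(k < n) s ^+ k.
    rewrite -[n in n%:R]card_ord -sumr_const mulr_suml ler_sum // => k _.
    by rewrite mul1r; apply: ler_wiXn2l => //; [exact: ltW|exact: ltnW].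
  apply: le_trans h1 _; rewrite -[(1 - s)^-1]mul1r ler_pdivlMr ?subr_gt0 //.
  have -> : (\sum_(k < n) s ^+ k) * (1 - s) = 1 - s ^+ n.
    by rewrite -[1 - s ^+ n]opprB subrX1; ring.
  by rewrite gerBl exprn_ge0.
have cs : (fun n => s ^+ n) @ \oo --> (0 : R) by apply: cvg_expr; rewrite ger0_norm.
pose K := 2 * (1 - s)^-1 + 1.
apply: (@squeeze_cvgr _ _ _ _ (fun=> 0) (fun n => K * s ^+ n)); last 2 first.
- exact: cvg_cst.
- by rewrite -[X in _ --> X](mulr0 K); apply: cvgZr.
near=> n; apply/andP; split; first by rewrite mulr_ge0 // exprn_ge0.
rewrite qE -exprM mulnC exprM expr2 mulrA ler_wpM2r ?exprn_ge0 //.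
have h1 : s ^+ n <= 1 by rewrite exprn_ile1 // ltW.
have h2 := bd n.
have -> : (n * 2 + 1)%:R * s ^+ n = 2 * (n%:R * s ^+ n) + s ^+ n.
  by rewrite natrD natrM; ring.
rewrite /K; lra.
Unshelve. all: by end_near.
Qed.

Lemma saw_var_lt1 p : - pi < p -> p < pi -> saw_var p < 1.
Proof.
move=> h1 h2; rewrite /saw_var ltr_pdivrMr //.
suff : -1 < cos p by lra.
rewrite -cospi -[cos p]cos_norm ltr_cos // ?in_itv /= ?lexx ?pi_ge0 ?normr_ge0 //=.
  by rewrite ltr_norml h1.
by rewrite ler_norml !ltW.
Qed.

Lemma cvg_saw p : - pi < p -> p < pi -> (saw ^~ p) @ \oo --> p.
Proof.
wlog p0 : p / 0 <= p => [hw h1 h2|h1 h2].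
  have [|/ltW p0] := leP 0 p; first by move=> /hw; apply.
  have -> : saw^~ p = fun n => - saw n (- p).
    by apply/funext => n; rewrite sawN opprK.
  rewrite -[X in _ --> X]opprK; apply: cvgN; apply: hw; rewrite ?oppr_ge0 //; lra.
have : (fun n => p - (p - saw n p)) @ \oo --> p - 0.
  apply: cvgB; first exact: cvg_cst.
  apply: (@squeeze_cvgr _ _ _ _ (fun=> 0) (fun n => pi * ((2 * n + 1)%:R * saw_var p ^+ n))).
  - by near=> n; have [-> ->] := saw_rem n p0 h2.
  - exact: cvg_cst.
  - rewrite -[X in _ --> X](mulr0 pi); apply: cvgZr; apply: cvg_natXn.
      exact: saw_var_ge0.
    exact: saw_var_lt1.
have -> : (fun n => p - (p - saw n p)) = saw^~ p by apply/funext => n; ring.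
by rewrite subr0.
Unshelve. all: by end_near.
Qed.

Lemma saw_bound n p : - pi < p -> p <= pi -> `|saw n p| <= pi.
Proof.
wlog p0 : p / 0 <= p => [hw h1 h2|h1 h2].
  have [|p0] := leP 0 p; first by move=> /hw; apply.
  by rewrite -normrN -sawN; apply: hw; lra.
rewrite ger0_norm ?saw_ge0 //; move: h2; rewrite le_eqVlt => /predU1P[->|h2].
  by rewrite /saw big1 ?pi_ge0 // => k _; rewrite sinpi mulr0 mul0r.
have [] := saw_rem n p0 h2; lra.
Qed.

(** At p = pi every [saw n] vanishes, although pi is an allowed momentum. The added term equals pi
    there and tends to 0 in the open interval, so the limit is [p] at the endpoint too. *)
Definition fullsaw n p : R := saw n p + pi * saw_var p ^+ n.

Lemma cvg_fullsaw p : - pi < p -> p <= pi -> (fullsaw ^~ p) @ \oo --> p.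
Proof.
move=> h1; rewrite le_eqVlt => /predU1P[->|h2].
  apply: (@cvg_trans _ (cst (pi : R) @ \oo)); last exact: cvg_cst.
  have -> : fullsaw^~ pi = cst (pi : R) => //.
  apply/funext => n; rewrite /fullsaw /saw /saw_var big1 => [|k _].
    by rewrite cospi opprK divff // expr1n mulr1 add0r.
  by rewrite sinpi mulr0 mul0r.
rewrite -[X in _ --> X]addr0; apply: cvgD; first exact: cvg_saw.
rewrite -[X in _ --> X](mulr0 pi); apply: cvgZr; apply: cvg_expr.
by rewrite ger0_norm ?saw_var_ge0 // saw_var_lt1.
Qed.

Lemma fullsaw_bound n p : - pi < p -> p <= pi -> `|fullsaw n p| <= 2 * pi.
Proof.
move=> h1 h2; rewrite (le_trans (ler_normD _ _)) // (_ : 2 * pi = pi + pi); last by ring.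
rewrite lerD ?saw_bound //.
rewrite normrM !ger0_norm ?pi_ge0 ?exprn_ge0 ?saw_var_ge0 //.
rewrite -[leRHS]mulr1 ler_wpM2l ?pi_ge0 // exprn_ile1 ?saw_var_ge0 ?saw_var_le1 //.
Qed.

End Sawtooth.

(** * Measures with equal trigonometric moments *)

Section TrigonometricMoments.
Variables (R : realType) (d : measure_display) (X : measurableType d).
Variables (mu nu : {measure set X -> \bar R}) (f : X -> R).
Hypotheses (mf : measurable_fun setT f).
Hypotheses (fin_mu : (mu setT < +oo)%E) (fin_nu : (nu setT < +oo)%E).
Hypothesis cosE : forall n : int,
  \int[mu]_x cos (n%:~R * f x) = \int[nu]_x cos (n%:~R * f x).
Hypothesis sinE : forall n : int,
  \int[mu]_x sin (n%:~R * f x) = \int[nu]_x sin (n%:~R * f x).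

Definition same_integral (g : X -> R) : Prop :=
  [/\ measurable_fun setT g, exists M, forall x, `|g x| <= M &
      \int[mu]_x g x = \int[nu]_x g x].

Lemma bounded_integrable (m : {measure set X -> \bar R}) (g : X -> R) (M : R) :
  (m setT < +oo)%E -> measurable_fun setT g -> (forall x, `|g x| <= M) ->
  m.-integrable setT (EFin \o g).
Proof.
move=> fm mg hM; apply: measurable_bounded_integrable => //.
by exists M; split; [exact: num_real|move=> r Mr x _; exact: le_trans (hM x) (ltW Mr)].
Qed.

Lemma same_integralD g h : same_integral g -> same_integral h ->
  same_integral (fun x => g x + h x).
Proof.
move=> [mg [M hM] eg] [mh [M' hM'] eh]; split; first exact: measurable_funD.
- by exists (M + M') => x; rewrite (le_trans (ler_normD _ _)) // lerD.
- rewrite !RintegralD //; first by rewrite eg eh.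
  + exact: bounded_integrable hM.
  + exact: bounded_integrable hM'.
  + exact: bounded_integrable hM.
  + exact: bounded_integrable hM'.
Qed.

Lemma same_integralZ a g : same_integral g -> same_integral (fun x => a * g x).
Proof.
move=> [mg [M hM] eg]; split.
- exact: measurable_funM.
- by exists (`|a| * M) => x; rewrite normrM ler_wpM2l.
- rewrite !RintegralZl //; first by rewrite eg.
  + exact: bounded_integrable hM.
  + exact: bounded_integrable hM.
Qed.

Lemma same_integral_cos n : same_integral (fun x => cos (n%:~R * f x)).
Proof.
split=> //; last by exists 1 => x; rewrite ler_norml cos_geN1 cos_le1.
have mn : measurable_fun setT (fun x => n%:~R * f x) by exact: measurable_funM.
exact: (measurableT_comp (continuous_measurable_fun (@continuous_cos R)) mn).
Qed.

Lemma same_integral_sin n : same_integral (fun x => sin (n%:~R * f x)).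
Proof.
split=> //; last by exists 1 => x; rewrite ler_norml sin_geN1 sin_le1.
have mn : measurable_fun setT (fun x => n%:~R * f x) by exact: measurable_funM.
exact: (measurableT_comp (continuous_measurable_fun (@continuous_sin R)) mn).
Qed.

(** Multiplication by [saw_var], that is (1 - cos) / 2, shifts frequencies by one: cos(n p) becomes
    cos(n p)/2 - (cos((n+1) p) + cos((n-1) p))/4, and likewise for sin. Hence the induction must be
    uniform in [n]. *)
Lemma same_integral_trig k (n : int) :
  same_integral (fun x => cos (n%:~R * f x) * saw_var (f x) ^+ k) /\
  same_integral (fun x => sin (n%:~R * f x) * saw_var (f x) ^+ k).
Proof.
elim: k n => [|k IH] n.
  split.
    rewrite (_ : (fun x => _) = fun x => cos (n%:~R * f x)); first exact: same_integral_cos.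
    by apply/funext => x; rewrite expr0 mulr1.
  rewrite (_ : (fun x => _) = fun x => sin (n%:~R * f x)); first exact: same_integral_sin.
  by apply/funext => x; rewrite expr0 mulr1.
have [c0 s0] := IH n; have [c1 s1] := IH (n + 1); have [c2 s2] := IH (n - 1).
split.
  rewrite (_ : (fun x => _) = fun x => 2^-1 * (cos (n%:~R * f x) * saw_var (f x) ^+ k) +
     - 4^-1 * (cos ((n + 1)%:~R * f x) * saw_var (f x) ^+ k + cos ((n - 1)%:~R * f x) * saw_var (f x) ^+ k)).
    by apply: same_integralD; apply: same_integralZ => //; apply: same_integralD.
  apply/funext => x; rewrite rmorphD rmorphB /= mulrDl mulrBl mul1r cosD cosB exprS.
  by rewrite {1}/saw_var; field.
rewrite (_ : (fun x => _) = fun x => 2^-1 * (sin (n%:~R * f x) * saw_var (f x) ^+ k) +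
     - 4^-1 * (sin ((n + 1)%:~R * f x) * saw_var (f x) ^+ k + sin ((n - 1)%:~R * f x) * saw_var (f x) ^+ k)).
  by apply: same_integralD; apply: same_integralZ => //; apply: same_integralD.
apply/funext => x; rewrite rmorphD rmorphB /= mulrDl mulrBl mul1r sinD sinB exprS.
by rewrite {1}/saw_var; field.
Qed.

Lemma same_integral_fullsaw n : same_integral (fun x => fullsaw n (f x)).
Proof.
apply: same_integralD.
  elim: n => [|n IH].
    rewrite (_ : (fun x => _) = fun x => 0 * cos (0%:~R * f x)).
      exact/same_integralZ/same_integral_cos.
    by apply/funext => x; rewrite /saw big_ord0 mul0r.
  rewrite (_ : (fun x => _) = fun x => saw n (f x) + saw_coef R n * (sin (1%:~R * f x) * saw_var (f x) ^+ n)).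
    by apply: same_integralD => //; apply: same_integralZ; have [] := same_integral_trig n 1.
  by apply/funext => x; rewrite /saw big_ord_recr /= mul1r mulrA.
rewrite (_ : (fun x => _) = fun x => pi * (cos (0%:~R * f x) * saw_var (f x) ^+ n)).
  by apply: same_integralZ; have [] := same_integral_trig n 0.
by apply/funext => x; rewrite mul0r cos0 mul1r.
Qed.

(** Dominated convergence with the constant 2 pi. Both the bound and the convergence hold where [f]
    lies in ]-pi, pi], hence almost everywhere. *)
Lemma fullsaw_integral_cvg (m : {measure set X -> \bar R}) :
  (m setT < +oo)%E -> m (~` (f @^-1` `]- pi, pi])) = 0%E ->
  \int[m]_x fullsaw n (f x) @[n --> \oo] --> \int[m]_x f x.
Proof.
move=> fm m0.
have mS : measurable (~` (f @^-1` `]- pi, pi])).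
  by apply: measurableC; rewrite -[_ @^-1` _]setTI; exact: mf.
have ae P : (forall x, - pi < f x <= pi -> P x) -> {ae m, forall x, P x}.
  move=> h; exists (~` (f @^-1` `]- pi, pi])); split => // x /= nP; apply: contra_not nP.
  by rewrite in_itv /= => /h.
have [] := @dominated_convergence _ _ _ m setT measurableT
  (fun n x => (fullsaw n (f x))%:E) (fun x => (f x)%:E) (cst (2 * pi)%:E).
- by move=> n; apply/measurable_EFinP; have [] := same_integral_fullsaw n.
- exact/measurable_EFinP.
- apply: ae => x /andP[h1 h2] _; apply: cvg_EFin; first by near=> n.
  exact: cvg_fullsaw.
- by apply: (bounded_integrable (g := cst (2 * pi)) (M := 2 * pi)) => // x; rewrite ger0_norm ?mulr_ge0 ?pi_ge0.
- by apply: ae => x /andP[h1 h2] n _; rewrite /= lee_fin fullsaw_bound.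
move=> i1 _ c1; apply: fine_cvg; rewrite /Rintegral fineK //; last exact: integrable_fin_num.
Unshelve. all: by end_near.
Qed.

Lemma trigonometric_moments :
  mu (~` (f @^-1` `]- pi, pi])) = 0%E -> nu (~` (f @^-1` `]- pi, pi])) = 0%E ->
  \int[mu]_x f x = \int[nu]_x f x.
Proof.
move=> m0 n0; have c1 := fullsaw_integral_cvg fin_mu m0.
have c2 := fullsaw_integral_cvg fin_nu n0.
apply: (cvg_unique _ c1) => //.
rewrite (_ : (fun n => _) = fun n => \int[nu]_x fullsaw n (f x)) //.
by apply/funext => n; have [] := same_integral_fullsaw n.
Qed.

End TrigonometricMoments.

(** * Momentum operators under an intertwining unitary *)

Section MomentumTransport.
Variables (R : realType) (H1 H2 : hilbertSpace R) (W : H1 -> H2) (V : H2 -> H1).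
Hypotheses (linW : linear W) (isoW : forall v, `|W v| = `|v|).
Hypotheses (WK : cancel W V) (VK : cancel V W).

Lemma pvm_meas_fin (H : hilbertSpace R) d (X : measurableType d) (E : pvm H X) v :
  (pvm_meas E v setT < +oo)%E.
Proof. by rewrite pvm_measE // ltry. Qed.

(** All of the finite mass sits on [D]: the masses of [S] and [D] add up to at most the total, which
    is the mass of [D]. *)
Lemma pvm_meas_carried (H : hilbertSpace R) d (X : measurableType d) (E : pvm H X) D S v :
  measurable D -> measurable S -> pvm_proj E D v = v -> S `&` D = set0 ->
  pvm_meas E v S = 0%E.
Proof.
move=> mD mS hD SD; apply/eqP; rewrite eq_le measure_ge0 andbT.
have : (pvm_meas E v (S `|` D) <= pvm_meas E v D)%E.
  have -> : pvm_meas E v D = pvm_meas E v setT by rewrite !pvm_measE // pvm_total hD.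
  by apply: le_measure; rewrite ?inE //; exact: measurableU.
rewrite measureU //.
move=> h0; have {h0} : (pvm_meas E v S + pvm_meas E v D <= pvm_meas E v D)%E by exact: h0.
by rewrite !pvm_measE // -EFinD !lee_fin gerDr.
Qed.

Lemma spectral_integral_trig (H : hilbertSpace R) (E : pvm H (R * R)%type) (U : site -> H -> H) v :
  (forall x : site, spectral_integral E
     (fun p => expi (p.1 * x.1%:~R + p.2 * x.2%:~R)) (U x)) ->
  forall x : site,
  \int[pvm_meas E v]_p cos (p.1 * x.1%:~R + p.2 * x.2%:~R) = complex.Re (hs_dot H (U x v) v) /\
  \int[pvm_meas E v]_p sin (p.1 * x.1%:~R + p.2 * x.2%:~R) = complex.Im (hs_dot H (U x v) v).
Proof. by move=> h x; have [_ /(_ v)[_ _ ->]] := h x. Qed.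

Lemma spectral_integral_real (H : hilbertSpace R) d (X : measurableType d) (E : pvm H X)
    (f : X -> R) A v : spectral_integral E (fun x => (f x)%:C) A ->
  hs_dot H (A v) v = (\int[pvm_meas E v]_x f x)%:C.
Proof.
move=> [_ /(_ v)[_ _ ->]] /=.
by rewrite [X in _ +i* X](_ : _ = 0) // /Rintegral integral0.
Qed.

(** By polarisation it is enough to compare quadratic forms. At [v] and [W v] these are integrals of
    a coordinate against two measures whose trigonometric moments agree, since [W] intertwines the
    translations. *)
Lemma momentum_transport (U : site -> H1 -> H1) (U' : site -> H2 -> H2) P1 P2 P1' P2' :
  momentum U P1 P2 -> momentum U' P1' P2' ->
  (forall x v, W (U x v) = U' x (W v)) ->
  (forall v, W (P1 v) = P1' (W v)) /\ (forall v, W (P2 v) = P2' (W v)).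
Proof.
move=> [E [s1 s2 hD hU]] [E' [s1' s2' hD' hU']] UU'.
have linV : linear V by move=> a u v; rewrite -{1}(VK u) -{1}(VK v) -linW WK.
pose I : set R := `]- pi, pi]%classic.
have mI : measurable I by exact: measurable_itv.
have mD : measurable (I `*` I) by exact: measurableX.
(* [f] is one of the two coordinates and [c n] the translation by n along that axis, whose phase is
   n times [f]. *)
have key (f : R * R -> R) (c : int -> site) (A : H1 -> H1) (A' : H2 -> H2) :
    measurable_fun setT f -> I `*` I `<=` f @^-1` I ->
    (forall n p, p.1 * (c n).1%:~R + p.2 * (c n).2%:~R = n%:~R * f p) ->
    spectral_integral E (fun p => (f p)%:C) A ->
    spectral_integral E' (fun p => (f p)%:C) A' -> forall v, W (A v) = A' (W v).
  move=> mf sf hc sA sA' v.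
  have lA : linear A by case: sA => -[].
  have lA' : linear A' by case: sA' => -[].
  have lB : linear (fun v => V (A' (W v))) by move=> a x y; rewrite linW lA' linV.
  rewrite (_ : A v = V (A' (W v))) ?VK //; apply: dot_polar_eq lA lB _ v => v.
  rewrite -[RHS](isometry_dot linW isoW) VK.
  rewrite (spectral_integral_real _ sA) (spectral_integral_real _ sA').
  have dU n : hs_dot H1 (U (c n) v) v = hs_dot H2 (U' (c n) (W v)) (W v).
    by rewrite -UU' (isometry_dot linW isoW).
  have mS : measurable (~` (f @^-1` I)).
    by apply: measurableC; rewrite -[_ @^-1` _]setTI; exact: mf.
  have S0 : ~` (f @^-1` I) `&` (I `*` I) = set0.
    by apply/seteqP; split => // p [h /sf].
  congr (_ %:C); apply: trigonometric_moments => //.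
  - exact: pvm_meas_fin.
  - exact: pvm_meas_fin.
  - move=> n; have [+ _] := spectral_integral_trig v hU (c n).
    have [+ _] := spectral_integral_trig (W v) hU' (c n).
    by rewrite (funext (fun p => congr1 cos (hc n p))) dU => -> ->.
  - move=> n; have [_ +] := spectral_integral_trig v hU (c n).
    have [_ +] := spectral_integral_trig (W v) hU' (c n).
    by rewrite (funext (fun p => congr1 sin (hc n p))) dU => -> ->.
  - exact: pvm_meas_carried mD mS (hD v) S0.
  - exact: pvm_meas_carried mD mS (hD' (W v)) S0.
split.
- apply: (key fst (fun n => (n, 0))) s1 s1' => //.
  + by move=> p [].
  + by move=> n p /=; rewrite mulr0 addr0 mulrC.
- apply: (key snd (fun n => (0, n))) s2 s2' => //.
  + by move=> p [].
  + by move=> n p /=; rewrite mulr0 add0r mulrC.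
Qed.

End MomentumTransport.

(** * Superselection sectors related by an intertwiner *)

Section DenseIntertwiner.
Variables (R : realType) (I : lmodType R[i]) (H1 H2 : hilbertSpace R).
Variables (L1 : I -> H1) (L2 : I -> H2) (s : I -> I) (t : site -> I -> I).
Variables (T1 : H1 -> H1) (T2 : H2 -> H2).
Variables (U1 : site -> H1 -> H1) (U2 : site -> H2 -> H2).

(** Common form of all comparisons of sectors: both spaces are spanned by vectors with the same
    labels and norms, and on the labels the transfer matrices act by the same [s] and the
    translations by the same [t]. *)
Lemma dense_joint_spectrum (P1 Q1 : H1 -> H1) (P2 Q2 : H2 -> H2) :
  linear L1 -> linear L2 -> dense_map L1 -> dense_map L2 ->
  (forall i, hnorm (L1 i) = hnorm (L2 i)) ->
  bounded_op T1 -> bounded_op T2 ->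
  (forall x, bounded_op (U1 x)) -> (forall x, bounded_op (U2 x)) ->
  (forall i, T1 (L1 i) = L1 (s i)) -> (forall i, T2 (L2 i) = L2 (s i)) ->
  (forall x i, U1 x (L1 i) = L1 (t x i)) -> (forall x i, U2 x (L2 i) = L2 (t x i)) ->
  momentum U1 P1 Q1 -> momentum U2 P2 Q2 ->
  joint_spectrum T1 P1 Q1 = joint_spectrum T2 P2 Q2.
Proof.
move=> l1 l2 d1 d2 iso [lT1 cT1] [lT2 cT2] bU1 bU2 TL1 TL2 UL1 UL2 m1 m2.
have [W [V [lW iW WK VK WL]]] := unitary_extension l1 l2 d1 d2 iso.
have lV : linear V by move=> a u v; rewrite -{1}(VK u) -{1}(VK v) -lW WK.
have iV v : `|V v| = `|v| by rewrite -iW VK.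
have cW : continuous W.
  by apply: (bounded_continuous (M := 1)) lW _ => v; rewrite mul1r /hnorm iW.
have comp (A : H1 -> H1) (B : H2 -> H2) : bounded_op A -> bounded_op B ->
    (forall i, W (A (L1 i)) = B (W (L1 i))) -> forall v, W (A v) = B (W v).
  move=> [lA cA] [lB cB] h; apply: (linear_dense_eq d1) => //.
  - by move=> a u v; rewrite lA lW.
  - by move=> v; apply: continuous_comp; [exact: cA|exact: cW].
  - by move=> a u v; rewrite lW lB.
  - by move=> v; apply: continuous_comp; [exact: cW|exact: cB].
have WT v : W (T1 v) = T2 (W v).
  by apply: comp v => // i; rewrite TL1 !WL TL2.
have WU x v : W (U1 x v) = U2 x (W v).
  by apply: comp v => // i; rewrite UL1 !WL UL2.
have [WP WQ] := momentum_transport lW iW WK VK m1 m2 WU.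
have inv (A : H1 -> H1) (B : H2 -> H2) : (forall v, W (A v) = B (W v)) ->
    forall v, V (B v) = A (V v).
  by move=> h v; rewrite -{1}(VK v) -h WK.
apply/seteqP; split; first exact: (joint_spectrum_transport lW iW WK VK WT WP WQ).
by apply: (joint_spectrum_transport lV iV VK WK); exact: inv.
Qed.

End DenseIntertwiner.

Section GnsVectors.
Variables (R : realType) (A : starAlgType R) (w : A -> R[i]) (G : gns_triple w).

Lemma gns_dot X Y :
  hs_dot G (gns_rep G X (gns_vac G)) (gns_rep G Y (gns_vac G)) = w (star Y * X).
Proof.
by rewrite (@gns_state _ _ _ G) gns_mul [RHS](@gns_star _ _ _ G) starK.
Qed.

Lemma gns_map_linear : linear (fun X => gns_rep G X (gns_vac G)).
Proof. by move=> a X Y; rewrite gns_linear. Qed.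

Lemma gns_map_dense : dense_map (fun X => gns_rep G X (gns_vac G)).
Proof.
move=> v e e0.
have : closure (range (fun X => gns_rep G X (gns_vac G))) v by rewrite gns_cyclic.
move=> /(_ (ball v e%:C)) [].
  by apply/nbhs_ballP; exists e%:C => //=; rewrite (ltcR 0).
move=> _ [[X _ <-]]; rewrite -ball_normE /= hnormE ltcR hnormB => h.
by exists X.
Qed.

End GnsVectors.

Lemma hnorm_eq (R : realType) (H1 H2 : hilbertSpace R) (u : H1) (v : H2) :
  hs_dot H1 u u = hs_dot H2 v v -> hnorm u = hnorm v.
Proof.
rewrite !hdotvv => /(@complexI R) /eqP.
by rewrite eqrXn2 ?hnorm_ge0 // => /eqP.
Qed.

Lemma dense_map_comp_surj (R : realType) (I J : lmodType R[i]) (H : hilbertSpace R)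
  (L : I -> H) (f : J -> I) (g : I -> J) :
  cancel g f -> dense_map L -> dense_map (fun j => L (f j)).
Proof. by move=> gK dL v e /(dL v)[i hi]; exists (g i); rewrite gK. Qed.

Lemma approx_ge0 (R : realType) (z : R[i]) :
  (forall e : R, 0 < e -> exists2 y : R[i], 0 <= y & `|z - y| <= e%:C) -> 0 <= z.
Proof.
move=> h.
have im e : 0 < e -> `|complex.Im z| <= e.
  move=> /h[y y0 hy]; rewrite -lecR; apply: le_trans hy.
  (* In [R[i]] the relation [0 <= z] includes Im z = 0. Multiplication by i turns the estimate of
     the real part into one of the imaginary part. *)
  have := normc_ge_Re ((z - y) * 'i%C); rewrite normrM.
  have -> : `|'i%C| = 1 :> R[i] by rewrite normc_def /= expr0n /= add0r expr1n sqrtr1.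
  have y0' := ger0_Im y0.
  rewrite mulr1; congr (_ <= _); rewrite ReiNIm normrN.
  by rewrite raddfB /= y0' subr0.
rewrite lecE /=; apply/andP; split.
  by rewrite -normr_eq0 eq_le normr_ge0 andbT; apply/ler_addgt0Pr => e /im; rewrite add0r.
apply/ler_addgt0Pr => e /h[y y0 hy].
have /le_trans/(_ hy) := normc_ge_Re (z - y); rewrite lecR raddfB /=.
have : 0 <= complex.Re y by move: y0; rewrite lecE => /andP[].
by rewrite ler_norml => h1 /andP[h2 h3]; lra.
Qed.

Lemma dense_form_ge0 (R : realType) (I : lmodType R[i]) (H : hilbertSpace R)
    (L : I -> H) (B : H -> H) :
  dense_map L -> bounded_op B -> (forall i, 0 <= hs_dot H (B (L i)) (L i)) ->
  forall v, 0 <= hs_dot H (B v) v.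
Proof.
move=> dL [lB cB] hB v.
have [_ _ BB _] := linear_props lB; have [M M0 hM] := bounded_opP lB cB.
apply: approx_ge0 => e e0; pose K := M * (2 * hnorm v + 1).
have n0 := hnorm_ge0 v.
have K0 : 0 < K by rewrite mulr_gt0 // ltr_wpDl // mulr_ge0.
have eK : 0 < e + K by rewrite addr_gt0.
(* A distance d below e / (e + K) satisfies both d <= 1 and d K <= e; for d <= 1 the error M d |v| +
   M (|v| + d) d is at most d K. *)
have [|i hi] := dL v (e / (e + K)); first by rewrite divr_gt0.
exists (hs_dot H (B (L i)) (L i)) => //.
rewrite -(subrKA (hs_dot H (B (L i)) v)) -hdotBl -hdotBr -BB.
apply: le_trans (ler_normD _ _) _.
apply: le_trans (lerD (cauchy_schwarz _ _) (cauchy_schwarz _ _)) _.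
rewrite -rmorphD /= lecR.
set d := hnorm (v - L i); have dE : hnorm (L i - v) = d by rewrite hnormB.
rewrite dE ltr_pdivlMr // in hi.
have d0 : 0 <= d := hnorm_ge0 _.
have b1 : hnorm (B (v - L i)) <= M * d := hM _.
have b2 : hnorm (B (L i)) <= M * (hnorm v + d).
  apply: le_trans (hM _) _; apply: ler_wpM2l; first exact: ltW.
  by have := hnormD (L i - v) v; rewrite subrK dE addrC.
have d1 : d <= 1 by have := mulr_ge0 d0 (ltW K0); nra.
have h1 : hnorm (B (v - L i)) * hnorm v <= M * d * hnorm v by rewrite ler_wpM2r.
have h2 : hnorm (B (L i)) * d <= M * (hnorm v + d) * d by rewrite ler_wpM2r.
apply: le_trans (lerD h1 h2) _.
have : d * K <= e by have := mulr_ge0 d0 (ltW e0); nra.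
have : M * d * d <= M * d by rewrite -[leRHS]mulr1 ler_wpM2l // mulr_ge0 // ltW.
rewrite /K; nra.
Qed.

(** A nonnegative element of [R[i]] is real, so the forms of [B] and of its adjoint agree on the
    diagonal, and polarisation does the rest. *)
Lemma form_ge0_adjoint (R : realType) (H : hilbertSpace R) (B : H -> H) :
  linear B -> (forall v, 0 <= hs_dot H (B v) v) -> adjoint_op B B.
Proof.
move=> lB hB.
apply: (@sesqui_polar _ _ (fun u v => hs_dot H (B u) v) (fun u v => hs_dot H u (B v))).
- by move=> a x y w; rewrite lB hdotDl hdotZl.
- by move=> a x y w; rewrite hdotDr hdotZr.
- by move=> a x y w; rewrite hdotDl hdotZl.
- by move=> a x y w; rewrite lB hdotDr hdotZr.
- move=> v; rewrite [RHS]hdotC; have := ger0_Im (hB v).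
  by case: (hs_dot H (B v) v) => x y /= ->; rewrite oppr0.
Qed.

(** Positivity of T and of 1 - T extends from the dense vectors, and the root of T comes from
    [sqrt_one_sub] with X = 1 - T. Its range is dense because T maps the labelled vectors onto
    themselves ([s] is onto). *)
Lemma sqrt_dense (R : realType) (I : lmodType R[i]) (H : hilbertSpace R)
    (L : I -> H) (T : H -> H) (s s' : I -> I) :
  dense_map L -> bounded_op T -> cancel s' s ->
  (forall i, T (L i) = L (s i)) ->
  (forall i, 0 <= hs_dot H (T (L i)) (L i) <= hs_dot H (L i) (L i)) ->
  exists S : H -> H,
  [/\ bounded_op S, adjoint_op S S, forall v, S (S v) = T v,
      dense_map (fun i => S (L i)) &
      forall Z, bounded_op Z -> (forall v, Z (T v) = T (Z v)) ->
        forall v, Z (S v) = S (Z v)].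
Proof.
move=> dL [lT cT] sK TL hT.
have [T0 TD TB TZ] := linear_props lT.
pose X v := v - T v.
have lX : linear X by move=> a u v; rewrite /X lT scalerBr addrACA -opprD.
have bX : bounded_op X.
  by split=> // v; apply: cvgB; [exact: cvg_id|exact: cT].
have Tpos v : 0 <= hs_dot H (T v) v.
  by apply: (dense_form_ge0 dL) => // i; have /andP[] := hT i.
have Xpos v : 0 <= hs_dot H (X v) v.
  apply: (dense_form_ge0 dL) => // i.
  by rewrite hdotBl subr_ge0; have /andP[] := hT i.
have contrX v : hnorm (X v) <= hnorm v.
  apply: (form_contraction lX); first exact: form_ge0_adjoint lX Xpos.
  move=> {}v; rewrite Xpos /= -subr_ge0 -hdotBl subKr; exact: Tpos.
have [S [[lS cS] aS SS comS]] := sqrt_one_sub lX (form_ge0_adjoint lX Xpos) contrX.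
have SST v : S (S v) = T v by rewrite SS subKr.
have [_ _ SB _] := linear_props lS; have [M M0 hM] := bounded_opP lS cS.
exists S; split=> //; last first.
  move=> Z [lZ cZ] cm; apply: comS => // v.
  by have [_ _ ZB _] := linear_props lZ; rewrite ZB cm.
move=> v e e0; have e2 : 0 < e / 2 by rewrite divr_gt0.
have [j hj] := dL v _ e2.
(* [L j] is T (L (s' j)) = S (S (L (s' j))), so it is enough to approximate the inner vector S (L
   (s' j)) and apply the bounded S. *)
have [i hi] := dL (S (L (s' j))) _ (divr_gt0 e2 M0).
exists i; rewrite -(subrKA (L j)).
have -> : S (L i) - L j = S (L i - S (L (s' j))) by rewrite SB SST TL sK.
have := hnormD (S (L i - S (L (s' j)))) (L j - v).
have := hM (L i - S (L (s' j))); move: hi; rewrite ltr_pdivlMr //; lra.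
Qed.

(** * Comparison of the four sectors *)

Section Sectors.
Variables (R : realType) (B0 : starAlgType R) (beta beta' Delta : automorphism B0).
Variable tau : site -> automorphism B0.
Hypothesis tau_star : forall x, star_preserving (tau x).
Hypothesis Delta_star : star_preserving Delta.
Hypothesis beta_tau : forall x X, beta (tau x X) = tau x (beta X).
Hypothesis Delta_tau : forall x X, Delta (tau x X) = tau x (Delta X).
Hypothesis Delta_beta : forall X, Delta (beta' X) = beta_star_inv beta (Delta X).

Lemma beta_star_invE (b : automorphism B0) X : star (b (star (beta_star_inv b X))) = X.
Proof. exact: (autVK (aut_star b) X). Qed.

Lemma beta_star_invK (b : automorphism B0) X : beta_star_inv b (star (b (star X))) = X.
Proof. exact: (autK (aut_star b) X). Qed.

Lemma beta_star_inv_tau x X : beta_star_inv beta (tau x X) = tau x (beta_star_inv beta X).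
Proof.
rewrite -{1}(beta_star_invE beta X) tau_star -beta_tau tau_star.
by rewrite beta_star_invK.
Qed.

(** This is the adjoint and inverse of [Delta_beta]: since [Delta] respects [star], passing to
    starred automorphisms and then inverting exchanges the two relations. *)
Lemma Delta_beta_star_inv X : Delta (beta_star_inv beta' X) = beta (Delta X).
Proof.
rewrite -{2}(beta_star_invE beta' X) Delta_star Delta_beta Delta_star.
by rewrite -[RHS]starK beta_star_invE starK.
Qed.

Lemma duality_joint_spectrum (w1 w2 : B0 -> R[i]) (G1 : gns_triple w1) (G2 : gns_triple w2)
    (a1 a2 : B0 -> B0) (T1 P1 Q1 : G1 -> G1) (T2 P2 Q2 : G2 -> G2)
    (U1 : site -> G1 -> G1) (U2 : site -> G2 -> G2) :
  (forall X, w1 X = w2 (Delta X)) -> (forall X, Delta (a1 X) = a2 (Delta X)) ->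
  bounded_op T1 -> bounded_op T2 ->
  (forall x, bounded_op (U1 x)) -> (forall x, bounded_op (U2 x)) ->
  (forall X, T1 (gns_rep G1 X (gns_vac G1)) = gns_rep G1 (a1 X) (gns_vac G1)) ->
  (forall X, T2 (gns_rep G2 X (gns_vac G2)) = gns_rep G2 (a2 X) (gns_vac G2)) ->
  (forall x X, U1 x (gns_rep G1 X (gns_vac G1)) = gns_rep G1 (tau x X) (gns_vac G1)) ->
  (forall x X, U2 x (gns_rep G2 X (gns_vac G2)) = gns_rep G2 (tau x X) (gns_vac G2)) ->
  momentum U1 P1 Q1 -> momentum U2 P2 Q2 ->
  joint_spectrum T1 P1 Q1 = joint_spectrum T2 P2 Q2.
Proof.
move=> w12 a12 bT1 bT2 bU1 bU2 TE1 TE2 UE1 UE2 m1 m2.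
apply: (@dense_joint_spectrum _ _ _ _ (fun X => gns_rep G1 X (gns_vac G1))
  (fun X => gns_rep G2 (Delta X) (gns_vac G2)) a1 (fun x => tau x)) m1 m2 => //.
- exact: gns_map_linear.
- by move=> a X Y; rewrite (aut_linear Delta) gns_linear.
- exact: gns_map_dense.
- exact: (dense_map_comp_surj (autVK Delta) (gns_map_dense (G := G2))).
- by move=> X; apply: hnorm_eq; rewrite !gns_dot w12 (aut_mul Delta) Delta_star.
- by move=> X; rewrite TE2 a12.
- by move=> x X; rewrite UE2 Delta_tau.
Qed.

Lemma sqrt_joint_spectrum (w0 w1 : B0 -> R[i]) (G0 : gns_triple w0) (G1 : gns_triple w1)
    (T0 P0 Q0 : G0 -> G0) (T1 P1 Q1 : G1 -> G1)
    (U0 : site -> G0 -> G0) (U1 : site -> G1 -> G1) :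
  ground_state w0 (aut_comp (beta_star_inv beta) beta) ->
  (forall X, w1 X = w0 (beta_star_inv beta X)) ->
  bounded_op T0 -> bounded_op T1 ->
  (forall x, bounded_op (U0 x)) -> (forall x, bounded_op (U1 x)) ->
  (forall X, T0 (gns_rep G0 X (gns_vac G0)) =
     gns_rep G0 (beta_star_inv beta (beta X)) (gns_vac G0)) ->
  (forall X, T1 (gns_rep G1 X (gns_vac G1)) =
     gns_rep G1 (beta (beta_star_inv beta X)) (gns_vac G1)) ->
  (forall x X, U0 x (gns_rep G0 X (gns_vac G0)) = gns_rep G0 (tau x X) (gns_vac G0)) ->
  (forall x X, U1 x (gns_rep G1 X (gns_vac G1)) = gns_rep G1 (tau x X) (gns_vac G1)) ->
  momentum U0 P0 Q0 -> momentum U1 P1 Q1 ->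
  joint_spectrum T0 P0 Q0 = joint_spectrum T1 P1 Q1.
Proof.
move=> [_ ground] w01 bT0 bT1 bU0 bU1 TE0 TE1 UE0 UE1 m0 m1.
pose L0 X := gns_rep G0 X (gns_vac G0); pose L1 X := gns_rep G1 X (gns_vac G1).
pose al := aut_comp (beta_star_inv beta) beta.
have alE X : al X = beta_star_inv beta (beta X) by [].
have [S [bS aS SST dS comS]] : exists S : G0 -> G0,
  [/\ bounded_op S, adjoint_op S S, forall v, S (S v) = T0 v,
      dense_map (fun i => S (L0 i)) &
      forall Z, bounded_op Z -> (forall v, Z (T0 v) = T0 (Z v)) ->
        forall v, Z (S v) = S (Z v)].
  apply: (sqrt_dense (s := al) (s' := aut_inv_fun al)) => //.
  - exact: gns_map_dense.
  - exact: (autVK al).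
  - by move=> X; rewrite /L0 TE0 !gns_dot; have [-> ->] := ground X.
(* Commutation of the root with the translations follows from that of [T0], which is checked on the
   dense GNS vectors. *)
have comU x v : U0 x (T0 v) = T0 (U0 x v).
  have [[lU cU] [lT cT]] := (bU0 x, bT0).
  apply: (linear_dense_eq (A := fun v => U0 x (T0 v)) (B := fun v => T0 (U0 x v))
    (gns_map_dense (G := G0))).
  - by move=> a u v'; rewrite lT lU.
  - by move=> v'; apply: continuous_comp; [exact: cT|exact: cU].
  - by move=> a u v'; rewrite lU lT.
  - by move=> v'; apply: continuous_comp; [exact: cU|exact: cT].
  - by move=> X; rewrite TE0 !UE0 TE0 beta_tau beta_star_inv_tau.
apply: (@dense_joint_spectrum _ _ _ _ (fun X => S (L0 X)) (fun X => L1 (beta X))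
  al (fun x => tau x)) m0 m1 => //.
- by move=> a X Y; case: bS => lS _; rewrite /L0 gns_linear lS.
- by move=> a X Y; rewrite (aut_linear beta) /L1 gns_linear.
- exact: (dense_map_comp_surj (autVK beta) (gns_map_dense (G := G1))).
- move=> X; apply: hnorm_eq.
  (* Both squared norms are w0 (X^* alpha(X)): on the right, [beta_star_inv] sends the adjoint of
     [beta X] back to the adjoint of [X]. *)
  rewrite -aS SST TE0 !gns_dot w01 (aut_mul (beta_star_inv beta)).
  by have := beta_star_invK beta (star X); rewrite starK => ->.
- by move=> X; rewrite -SST /L0 alE -TE0 -SST.
- by move=> X; rewrite /L1 TE1.
- by move=> x X; rewrite comS // /L0 UE0.
- by move=> x X; rewrite /L1 UE1 beta_tau.
Qed.

End Sectors.

(** * Exponentials of diagonalisable elements *)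

Section CStarExponential.
Variables (R : realType) (F : cstarAlgType R).
Local Notation C := R[i].
Implicit Types (X Y Z E : F).

Lemma cnorm0 : cnorm (0 : F) = 0.
Proof.
apply: (@complexI R); rewrite -(scale0r (0 : F)) cnormZ normr0 mul0r.
by [].
Qed.

Lemma cnormN X : cnorm (- X) = cnorm X.
Proof. by apply: (@complexI R); rewrite -scaleN1r cnormZ normrN1 mul1r. Qed.

Lemma cnorm_ge0 X : 0 <= cnorm X.
Proof. by have := cnormD X (- X); rewrite subrr cnorm0 cnormN; lra. Qed.

Lemma cnormB X Y : cnorm (X - Y) = cnorm (Y - X).
Proof. by rewrite -cnormN opprB. Qed.

Lemma ncvgP (u : nat -> F) l : ncvg u l <->
  forall e : R, 0 < e -> \forall n \near \oo, cnorm (u n - l) < e.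
Proof.
split=> [/cvgr0Pnorm_lt h e /h|h]; first by apply: filterS => n; rewrite ger0_norm ?cnorm_ge0.
by apply/cvgr0Pnorm_lt => e /h; apply: filterS => n; rewrite ger0_norm ?cnorm_ge0.
Qed.

Lemma ncvg_unique (u : nat -> F) l m : ncvg u l -> ncvg u m -> l = m.
Proof.
move=> /ncvgP hl /ncvgP hm; apply/eqP; rewrite -subr_eq0; apply/eqP/cnorm_eq0.
apply/eqP; rewrite eq_le cnorm_ge0 andbT; apply/ler_addgt0Pr => e e0.
have e2 : 0 < e / 2 by rewrite divr_gt0.
have [n [h1 h2]] := filter_ex (filterI (hl _ e2) (hm _ e2)).
rewrite add0r -(subrKA (u n)); have := cnormD (l - u n) (u n - m).
by rewrite (cnormB l); lra.
Qed.

Lemma ncvg_near_eq (u v : nat -> F) l : (\forall n \near \oo, u n = v n) -> ncvg u l -> ncvg v l.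
Proof.
move=> uv /ncvgP h; apply/ncvgP => e /h; apply: filterS2 uv => n.
by move=> ->.
Qed.

Lemma ncvg_cst X : ncvg (fun=> X) X.
Proof. by apply/ncvgP => e e0; near=> n; rewrite subrr cnorm0.
Unshelve. all: by end_near. Qed.

Lemma ncvgD (u v : nat -> F) l m : ncvg u l -> ncvg v m -> ncvg (fun n => u n + v n) (l + m).
Proof.
move=> /ncvgP hl /ncvgP hm; apply/ncvgP => e e0.
have e2 : 0 < e / 2 by rewrite divr_gt0.
apply: filterS2 (hl _ e2) (hm _ e2) => n h1 h2.
by rewrite opprD addrACA; have := cnormD (u n - l) (v n - m); lra.
Qed.

Lemma ncvg_sum (I : finType) (u : I -> nat -> F) (l : I -> F) :
  (forall i, ncvg (u i) (l i)) -> ncvg (fun n => \sum_i u i n) (\sum_i l i).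
Proof.
move=> h.
elim: (index_enum I) => [|i s IH].
  rewrite big_nil [f in ncvg f](_ : _ = fun=> 0); first exact: ncvg_cst.
  by apply/funext => n; rewrite big_nil.
rewrite big_cons [f in ncvg f](_ : _ = fun n => u i n + \sum_(i <- s) u i n).
  exact: ncvgD.
by apply/funext => n; rewrite big_cons.
Qed.

Lemma ncvgZ (a : nat -> R) (b : R) X : a @ \oo --> b -> ncvg (fun n => (a n)%:C *: X) (b%:C *: X).
Proof.
move=> /cvgrPdist_lt h; apply/ncvgP => e e0.
have x0 : 0 < cnorm X + 1 by rewrite ltr_wpDl ?cnorm_ge0.
apply: filterS (h _ (divr_gt0 e0 x0)) => n.
rewrite ltr_pdivlMr // distrC => hn; rewrite -scalerBl -rmorphB.
have -> : cnorm ((a n - b)%:C *: X) = `|a n - b| * cnorm X.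
  apply: (@complexI R); rewrite cnormZ rmorphM /=.
  by rewrite normc_def /= expr0n /= addr0 sqrtr_sqr.
by apply: le_lt_trans hn; rewrite ler_wpM2l // lerDl.
Qed.

Lemma ncvg_commute (u : nat -> F) l Z : (forall n, Z * u n = u n * Z) -> ncvg u l -> Z * l = l * Z.
Proof.
move=> cZ /ncvgP h; apply/eqP; rewrite -subr_eq0; apply/eqP/cnorm_eq0.
apply/eqP; rewrite eq_le cnorm_ge0 andbT; apply/ler_addgt0Pr => e e0; rewrite add0r.
have z0 : 0 < 2 * (cnorm Z + 1) by rewrite mulr_gt0 // ltr_wpDl ?cnorm_ge0.
have /filter_ex[n hn] := h _ (divr_gt0 e0 z0); rewrite ltr_pdivlMr // in hn.
have -> : Z * l - l * Z = Z * (l - u n) + (u n - l) * Z.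
  by rewrite mulrBr mulrBl cZ addrA subrK.
apply: le_trans (cnormD _ _) _.
apply: le_trans (lerD (cnormM _ _) (cnormM _ _)) _.
by rewrite (cnormB l); have := cnorm_ge0 (u n - l); have := cnorm_ge0 Z; nra.
Qed.

Lemma cexp_eq X E : ncvg (fun n => \sum_(k < n) (k`!%:R : C)^-1 *: X ^+ k) E -> cexp X = E.
Proof.
move=> h; apply: (ncvg_unique _ h); rewrite /cexp.
by case: xgetP => [E' -> //|/(_ E)].
Qed.

Section Diagonalisable.
(* A commutative family, closed under products, in which the spectral
   projections live. *)
Variable S : set F.
Hypotheses (S1 : S 1) (SM : forall X Y, S X -> S Y -> S (X * Y)).
Hypothesis SC : forall X Y, S X -> S Y -> X * Y = Y * X.

(** [X] has a finite spectral decomposition with real eigenvalues, and [E] applies the real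
    exponential to each of them; the exponential series can then be summed eigenvalue by
    eigenvalue. *)
Definition diag_exp X E := exists (I : finType) (p : I -> F) (x : I -> R),
  [/\ forall i, S (p i), forall i j, p i * p j = if i == j then p i else 0,
      \sum_i p i = 1, X = \sum_i (x i)%:C *: p i &
      E = \sum_i (expR (x i))%:C *: p i].

Lemma idempotent_sumM (I : finType) (p : I -> F) (x y : I -> C) :
  (forall i j, p i * p j = if i == j then p i else 0) ->
  (\sum_i x i *: p i) * (\sum_i y i *: p i) = \sum_i (x i * y i) *: p i.
Proof.
move=> pp; rewrite mulr_suml; apply: eq_bigr => i _; rewrite mulr_sumr.
rewrite (bigD1 i) //= big1 ?addr0 => [|j ji].
  by rewrite -scalerAl -scalerAr pp eqxx scalerA.
by rewrite -scalerAl -scalerAr pp eq_sym (negPf ji) !scaler0.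
Qed.

Lemma diag_exp_cvg X E : diag_exp X E ->
  ncvg (fun n => \sum_(k < n) (k`!%:R : C)^-1 *: X ^+ k) E.
Proof.
move=> [I [p [x [_ pp p1 -> ->]]]].
have Xk k : (\sum_i (x i)%:C *: p i) ^+ k = \sum_i (x i ^+ k)%:C *: p i.
  elim: k => [|k IH].
    by rewrite expr0 -p1; apply: eq_bigr => i _; rewrite expr0 scale1r.
  by rewrite exprS IH idempotent_sumM //; apply: eq_bigr => i _; rewrite exprS rmorphM.
rewrite [f in ncvg f](_ : _ = fun n => \sum_i (series (exp_coeff (x i)) n)%:C *: p i).
  apply: ncvg_sum => i; apply: ncvgZ.
  by have := is_cvg_series_exp_coeff (x i).
apply/funext => n; rewrite /series /=.
under eq_bigr => k _ do rewrite Xk scaler_sumr.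
rewrite exchange_big /=; apply: eq_bigr => i _.
rewrite big_mkord rmorph_sum scaler_suml; apply: eq_bigr => k _.
by rewrite scalerA /exp_coeff /= rmorphM fmorphV /= rmorph_nat mulrC.
Qed.

Lemma diag_cexp X E : diag_exp X E -> cexp X = E.
Proof. by move=> /diag_exp_cvg/cexp_eq. Qed.

Lemma diag_exp0 : diag_exp 0 1.
Proof.
exists unit, (fun=> 1), (fun=> 0); split=> //.
- by move=> [] []; rewrite mulr1.
- by rewrite (big_pred1 tt) //; case.
- by rewrite big1 // => i _; rewrite scale0r.
- by rewrite (big_pred1 tt) ?expR0 ?scale1r //; case.
Qed.

(** The products of the two families of projections diagonalise both elements at once. They are
    orthogonal because the family [S] is commutative. *)
Lemma diag_expD X Y E E' : diag_exp X E -> diag_exp Y E' -> diag_exp (X + Y) (E * E').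
Proof.
move=> [I [p [x [Sp pp p1 -> ->]]]] [J [q [y [Sq qq q1 -> ->]]]].
exists (I * J)%type, (fun k => p k.1 * q k.2), (fun k => x k.1 + y k.2); split.
- by move=> k; apply: SM.
- move=> [i j] [i' j'] /=; rewrite mulrA -(mulrA (p i)) (SC (Sq _) (Sp _)).
  rewrite !mulrA pp -mulrA qq xpair_eqE.
  by case: eqP; case: eqP; rewrite /= ?mulr0 ?mul0r.
- rewrite -(pair_bigA _ (fun i j => p i * q j)) /=.
  by under eq_bigr => i _ do rewrite -mulr_sumr q1 mulr1.
- rewrite -(pair_bigA _ (fun i j => (x i + y j)%:C *: (p i * q j))) /=.
  under [in RHS]eq_bigr => i _ do under eq_bigr => j _ do rewrite rmorphD scalerDl.
  under [in RHS]eq_bigr => i _ do rewrite big_split.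
  rewrite big_split /=; congr (_ + _).
    apply: eq_bigr => i _; rewrite -scaler_sumr -mulr_sumr q1 mulr1 //.
  rewrite exchange_big; apply: eq_bigr => j _.
  by rewrite -scaler_sumr -mulr_suml p1 mul1r.
- rewrite -(pair_bigA _ (fun i j => (expR (x i + y j))%:C *: (p i * q j))) /=.
  rewrite mulr_suml; apply: eq_bigr => i _; rewrite mulr_sumr; apply: eq_bigr => j _.
  by rewrite expRD rmorphM -scalerAl -scalerAr scalerA.
Qed.

Lemma diag_expN X E : diag_exp X E ->
  exists2 E', diag_exp (- X) E' & E * E' = 1 /\ E' * E = 1.
Proof.
move=> [I [p [x [Sp pp p1 -> ->]]]].
exists (\sum_i (expR (- x i))%:C *: p i).
  exists I, p, (fun i => - x i); split=> //.
  by rewrite -sumrN; apply: eq_bigr => i _; rewrite rmorphN scaleNr.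
rewrite !idempotent_sumM // -p1; split; apply: eq_bigr => i _.
  by rewrite -rmorphM -expRD subrr expR0 scale1r.
by rewrite -rmorphM -expRD addNr expR0 scale1r.
Qed.

Definition diagonalisable X := exists E, diag_exp X E.

Lemma diagonalisable_sum (J : Type) (s : seq J) (f : J -> F) :
  (forall j, diagonalisable (f j)) -> diagonalisable (\sum_(j <- s) f j).
Proof.
move=> h; elim: s => [|j s [E IH]]; first by rewrite big_nil; exists 1; exact: diag_exp0.
by rewrite big_cons; have [E' h'] := h j; exists (E' * E); exact: diag_expD.
Qed.

Lemma diagonalisableD X Y : diagonalisable X -> diagonalisable Y -> diagonalisable (X + Y).
Proof. by move=> [E h] [E' h']; exists (E * E'); exact: diag_expD. Qed.

Lemma cexpD X Y : diagonalisable X -> diagonalisable Y -> cexp (X + Y) = cexp X * cexp Y.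
Proof.
by move=> [E h] [E' h']; rewrite (diag_cexp h) (diag_cexp h') (diag_cexp (diag_expD h h')).
Qed.

Lemma cexpN X : diagonalisable X -> cexp X * cexp (- X) = 1 /\ cexp (- X) * cexp X = 1.
Proof.
by move=> [E h]; have [E' h' ee] := diag_expN h; rewrite (diag_cexp h) (diag_cexp h').
Qed.

Lemma cexp_comm X Z : diagonalisable X -> Z * X = X * Z -> Z * cexp X = cexp X * Z.
Proof.
move=> [E h] ZX; rewrite (diag_cexp h).
apply: ncvg_commute (diag_exp_cvg h) => n.
rewrite mulr_sumr mulr_suml; apply: eq_bigr => k _.
rewrite -scalerAr -scalerAl; congr (_ *: _).
by apply: commrX.
Qed.

End Diagonalisable.

End CStarExponential.

Lemma commr_scale (K : nzRingType) (A : algType K) (a : K) (x y : A) :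
  GRing.comm x y -> GRing.comm x (a *: y).
Proof. by rewrite /GRing.comm -scalerAl -scalerAr => ->. Qed.

Section StarAlgebraTheory.
Variables (R : realType) (A : starAlgType R).
Implicit Types (x y : A).

Lemma star0 : star (0 : A) = 0.
Proof. by rewrite -(scale0r (0 : A)) starZ conjc0 !scale0r. Qed.

Lemma star1 : star (1 : A) = 1.
Proof. by rewrite -[LHS]mulr1 -[X in _ * X](starK (1 : A)) -starM mulr1 starK. Qed.

Lemma starX x k : star (x ^+ k) = star x ^+ k.
Proof. by elim: k => [|k IH]; [rewrite !expr0 star1|rewrite exprS starM IH exprSr]. Qed.

Lemma star_sum (I : Type) (s : seq I) (P : pred I) (f : I -> A) :
  star (\sum_(i <- s | P i) f i) = \sum_(i <- s | P i) star (f i).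
Proof. exact: (big_morph (@star R A) (@starD R A) star0). Qed.

End StarAlgebraTheory.

(** * Roots of unity *)

Section RootsOfUnity.
Variables (R : realType) (N : nat).
Hypothesis N2 : (2 <= N)%N.
Local Notation C := R[i].

Definition zeta : C := Defs.rootN R N 1.

Lemma expiD (a b : R) : expi (a + b) = expi a * expi b.
Proof. by apply/eqP; rewrite eq_complex /= cosD sinD [sin a * _ + _]addrC !eqxx. Qed.

Lemma rootNE k : Defs.rootN R N k = zeta ^+ k.
Proof.
elim: k => [|k IH].
  by rewrite expr0 /Defs.rootN mulr0 mul0r /expi cos0 sin0.
rewrite exprS -IH /zeta /Defs.rootN -expiD; congr expi.
by rewrite -addn1 natrD; field; rewrite pnatr_eq0 -lt0n ltnW.
Qed.

Let NR0 : N%:R != 0 :> R. Proof. by rewrite pnatr_eq0 -lt0n ltnW. Qed.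

Lemma zeta_conj : conjc zeta = zeta^-1.
Proof.
have h : zeta * conjc zeta = 1.
  rewrite /zeta /Defs.rootN /expi /=; apply/eqP; rewrite eq_complex /=; apply/andP; split; apply/eqP.
    by rewrite mulrN opprK -!expr2 cos2Dsin2.
  by ring.
have z0 : zeta != 0 by apply/eqP => z0; move: h; rewrite z0 mul0r => /eqP; rewrite eq_sym oner_eq0.
by rewrite -[LHS]mul1r -(mulVf z0) -mulrA h mulr1.
Qed.

Lemma zeta_neq0 : zeta != 0.
Proof.
apply/eqP => z0; have /eqP : (cos (2 * pi * 1%:R / N%:R : R)) ^+ 2 +
    (sin (2 * pi * 1%:R / N%:R : R)) ^+ 2 = 1 by rewrite cos2Dsin2.
have [-> ->] : cos (2 * pi * 1%:R / N%:R : R) = 0 /\ sin (2 * pi * 1%:R / N%:R : R) = 0.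
  by move: z0; rewrite /zeta /Defs.rootN /expi => -[].
by rewrite expr0n /= addr0 eq_sym oner_eq0.
Qed.

Lemma zetaN : zeta ^+ N = 1.
Proof.
rewrite -rootNE /Defs.rootN mulfK // /expi.
have -> : 2 * pi = pi + pi :> R by ring.
by rewrite cosD sinD cospi sinpi !(mulr0, mul0r) addr0 subr0 mulrNN mulr1.
Qed.

(** If the order k were smaller than N, then cos(2t) = 1 for t = pi k / N in ]0, pi[, contradicting
    sin t > 0. *)
Lemma zeta_primitive : N.-primitive_root zeta.
Proof.
have N0 : (0 < N)%N by exact: ltnW.
have [k kp kN] := prim_order_exists N0 zetaN; have k0 := prim_order_gt0 kp.
have : k = N; last by move=> <-.
apply/eqP; rewrite eqn_leq dvdn_leq //= leqNgt; apply/negP => kltN.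
have zk := prim_expr_order kp; rewrite -rootNE /Defs.rootN /expi in zk.
move: zk => /eqP; rewrite eq_complex /= => /andP[/eqP ck _].
pose t : R := pi * k%:R / N%:R.
have tE : 2 * pi * k%:R / N%:R = t + t by rewrite /t; ring.
have s0 : 0 < sin t.
  apply: sin_gt0_pi; rewrite /t divr_gt0 ?mulr_gt0 ?pi_gt0 ?ltr0n //=.
  by rewrite ltr_pdivrMr ?ltr0n // ltr_pM2l ?pi_gt0 // ltr_nat.
move: ck; rewrite tE cosD -!expr2; have := cos2Dsin2 t.
move=> h1 h2; have : sin t ^+ 2 = 0 by lra.
by move/eqP; rewrite sqrf_eq0 gt_eqF.
Qed.

End RootsOfUnity.

(** * Functional calculus for elements of order N *)

Section SpectralProjections.
Variables (R : realType) (N : nat).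
Hypothesis N2 : (2 <= N)%N.
Local Notation C := R[i].
Local Notation zt := (zeta R N).

Let N0 : N%:R != 0 :> C. Proof. by rewrite pnatr_eq0 -lt0n ltnW. Qed.

Lemma unity_neq0 (z : C) : z ^+ N = 1 -> z != 0.
Proof.
by apply: contra_eq_neq => ->; rewrite expr0n eqn0Ngt (ltnW N2) eq_sym oner_eq0.
Qed.

(** The spectral projection of [u] for the eigenvalue [z]: when z^N = 1 and u^N = 1, the average of
    the powers of z^-1 u over the cyclic group of order N. *)
Definition sproj (A : algType C) (z : C) (u : A) : A :=
  (N%:R)^-1 *: \sum_(k < N) (z^-1 ^+ k) *: u ^+ k.

Lemma geometric_root (z : C) : z ^+ N = 1 -> z != 1 -> \sum_(k < N) z ^+ k = 0.
Proof.
move=> zN z1; have := subrX1 z N; rewrite zN subrr => /esym/eqP.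
by rewrite mulf_eq0 subr_eq0 (negPf z1) => /eqP.
Qed.

Lemma cyclic_shift (A : nmodType) (f : nat -> A) : f N = f 0%N ->
  \sum_(k < N) f k.+1 = \sum_(k < N) f k.
Proof.
move=> fN; case: N N2 fN => // n _ fN.
by rewrite big_ord_recr [RHS]big_ord_recl /= fN addrC.
Qed.

Lemma average_cst (V : lmodType C) (x : V) : (N%:R)^-1 *: (\sum_(k < N) x) = x.
Proof. by rewrite sumr_const card_ord -(scaler_nat N x) scalerA mulVf // scale1r. Qed.

Section Unitary.
Variable (A : algType C) (u : A).
Hypothesis uN : u ^+ N = 1.

Lemma sproj_mul (z : C) : z ^+ N = 1 -> sproj z u * u = z *: sproj z u.
Proof.
move=> zN; have z0 := unity_neq0 zN.
rewrite /sproj -scalerAl scalerA mulrC -scalerA; congr (_ *: _).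
rewrite -[in RHS](@cyclic_shift _ (fun k => z^-1 ^+ k *: u ^+ k)); last first.
  by rewrite exprVn zN uN !expr0 invr1.
rewrite mulr_suml scaler_sumr; apply: eq_bigr => k _.
by rewrite -scalerAl -exprSr scalerA [z^-1 ^+ _.+1]exprS mulrA divff // mul1r.
Qed.

Lemma sproj_mulX (z : C) k : z ^+ N = 1 -> sproj z u * u ^+ k = z ^+ k *: sproj z u.
Proof.
move=> zN; elim: k => [|k IH]; first by rewrite !expr0 mulr1 scale1r.
by rewrite exprSr mulrA IH -scalerAl sproj_mul // scalerA -exprSr.
Qed.

Lemma sprojM (z z' : C) : z ^+ N = 1 -> z' ^+ N = 1 ->
  sproj z u * sproj z' u = if z == z' then sproj z u else 0.
Proof.
move=> zN zN'; have z0 := unity_neq0 zN'.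
rewrite {2}/sproj -scalerAr mulr_sumr.
under eq_bigr => k _ do rewrite -scalerAr sproj_mulX // scalerA -exprMn.
rewrite -scaler_suml; case: eqP => [<-|zz].
  rewrite mulVf ?unity_neq0 //.
  under eq_bigr => k _ do rewrite expr1n.
  by rewrite sumr_const card_ord scalerA mulVf // scale1r.
rewrite geometric_root ?scale0r ?scaler0 //; first by rewrite exprMn exprVn zN zN' invr1 mulr1.
by apply/eqP => h; apply: zz; rewrite -[LHS](mulVKf z0) h mulr1.
Qed.

Lemma sproj_sum : \sum_(j < N) sproj (zt ^+ j) u = 1.
Proof.
rewrite /sproj -scaler_sumr exchange_big /=.
have n0 : (0 < N)%N by exact: ltnW.
rewrite (bigD1 (Ordinal n0)) //= [X in _ + X]big1 ?addr0 => [|k k0].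
  under eq_bigr => j _ do rewrite !expr0 scale1r.
  exact: average_cst.
rewrite -scaler_suml.
under eq_bigr => j _ do rewrite exprVn -exprM mulnC exprM -exprVn.
rewrite geometric_root ?scale0r //.
  by rewrite exprVn -exprM mulnC exprM zetaN // expr1n invr1.
rewrite invr_eq1 -(prim_order_dvd (zeta_primitive R N2)).
by apply/negP => /dvdn_leq; rewrite lt0n leqNgt ltn_ord => /(_ k0).
Qed.

Lemma power_spectral k : u ^+ k = \sum_(j < N) (zt ^+ (j * k)) *: sproj (zt ^+ j) u.
Proof.
rewrite -[LHS]mul1r -sproj_sum mulr_suml; apply: eq_bigr => j _.
by rewrite sproj_mulX ?exprM // -exprM mulnC exprM zetaN // expr1n.
Qed.

End Unitary.

(** Write p and p' for the projections of [u] at z and of [v] at z^-1. Each one absorbs the other, p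
    p' = p and p' p = p', and they commute, so they are equal. *)
Lemma sproj_inv (A : algType C) (u v : A) (z : C) : u ^+ N = 1 -> v ^+ N = 1 -> u * v = 1 -> v * u = 1 ->
  z ^+ N = 1 -> sproj z^-1 v = sproj z u.
Proof.
move=> uN vN uv vu zN.
have z0 := unity_neq0 zN.
have key (a b : A) (y : C) : y ^+ N = 1 -> y != 0 -> a ^+ N = 1 -> a * b = 1 ->
    sproj y a * sproj y^-1 b = sproj y a.
  move=> yN y0 aN ab.
  have pb k : sproj y a * b ^+ k = (y^-1 ^+ k) *: sproj y a.
    have p1 : sproj y a * b = y^-1 *: sproj y a.
      rewrite -[sproj y a in LHS](scale1r) -(mulVf y0) -scalerA -(sproj_mul aN yN).
      by rewrite -scalerAl -mulrA ab mulr1.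
    elim: k => [|k IH]; first by rewrite !expr0 mulr1 scale1r.
    by rewrite exprSr mulrA IH -scalerAl p1 scalerA -exprSr.
  rewrite {2}/sproj -scalerAr mulr_sumr.
  under eq_bigr => k _ do rewrite -scalerAr pb scalerA invrK -exprMn mulfV // expr1n scale1r.
  exact: average_cst.
rewrite -(key u v z) //.
have zV : z^-1 ^+ N = 1 by rewrite exprVn zN invr1.
rewrite -[LHS](key v u z^-1) ?invr_eq0 // invrK.
have comm : GRing.comm u v by rewrite /GRing.comm uv vu.
have c : GRing.comm (sproj z u) (sproj z^-1 v).
  rewrite /sproj; apply: commr_scale; apply/commr_sym/commr_scale.
  apply: commr_sum => k _; apply: commr_scale; apply/commr_sym.
  apply: commr_sum => j _; apply: commr_scale.
  by apply: commrX; apply/commr_sym; apply: commrX.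
by rewrite c.
Qed.

Section Calculus.
Variable rho : 'I_N -> R.
Hypothesis rho_real : forall j, complex.Im (fourier rho j) = 0.

(** The eigenvalue of [invsqrtN *: power_sum rho u] on the eigenspace of [u] for the j-th root of
    unity, see [power_sum_spectral]. *)
Definition lam (j : 'I_N) : R := complex.Re (fourier rho j).

(* The exponential of half of [invsqrtN *: power_sum rho u], see [psi_diag]; its
   inverse is [psiV]. *)
Definition psi (A : algType C) (u : A) : A :=
  \sum_(j < N) (expR (lam j / 2))%:C *: sproj (zt ^+ j) u.

Definition psiV (A : algType C) (u : A) : A :=
  \sum_(j < N) (expR (- (lam j / 2)))%:C *: sproj (zt ^+ j) u.

Lemma lamE j : fourier rho j = (lam j)%:C.
Proof. by rewrite /lam; have := rho_real j; case: (fourier rho j) => a b /= ->. Qed.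

Lemma fourier_conj (i j : 'I_N) : zt ^+ i = (zt ^+ j)^-1 -> fourier rho i = conjc (fourier rho j).
Proof.
move=> zij; rewrite /fourier rmorphM /= oppr0; congr (_ * _).
rewrite rmorph_sum; apply: eq_bigr => v _; rewrite rmorphM; congr (_ * _).
  by rewrite /= oppr0.
have zc : (@conjc R : {rmorphism C -> C}) zt = zt^-1 by exact: zeta_conj.
by rewrite !rootNE // !exprM zij rmorphXn rmorphXn zc !exprVn.
Qed.

Lemma power_sum_spectral (F : cstarAlgType R) (u : F) : u ^+ N = 1 ->
  invsqrtN R N *: power_sum rho u = \sum_(j < N) (lam j)%:C *: sproj (zt ^+ j) u.
Proof.
move=> uN; rewrite /power_sum.
under eq_bigr => k _ do rewrite (power_spectral uN) scaler_sumr.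
rewrite exchange_big scaler_sumr; apply: eq_bigr => j _ /=.
rewrite -lamE /fourier /invsqrtN -scalerA; congr (_ *: _).
rewrite scaler_suml; apply: eq_bigr => k _.
by rewrite scalerA rootNE.
Qed.

Lemma psi_psiV (A : algType C) (u : A) : u ^+ N = 1 -> psi u * psiV u = 1 /\ psiV u * psi u = 1.
Proof.
move=> uN; have zN j : (zt ^+ j) ^+ N = 1 by rewrite -exprM mulnC exprM zetaN // expr1n.
have key (f g : 'I_N -> C) : (forall j, f j * g j = 1) ->
    (\sum_(j < N) f j *: sproj (zt ^+ j) u) * (\sum_(j < N) g j *: sproj (zt ^+ j) u) = 1.
  move=> fg; rewrite -(sproj_sum u) mulr_suml; apply: eq_bigr => i _; rewrite mulr_sumr.
  rewrite (bigD1 i) //= big1 ?addr0 => [|j ji]; rewrite -scalerAl -scalerAr scalerA sprojM //.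
    by rewrite eqxx fg scale1r.
  case: eqP => [h|_]; last by rewrite scaler0.
  have := eq_prim_root_expr (zeta_primitive R N2) i j; rewrite h eqxx => /esym.
  by rewrite !modn_small // => /eqP /val_inj ij; rewrite ij eqxx in ji.
by split; apply: key => j; rewrite -rmorphM -expRD ?subrr ?addNr expR0.
Qed.

Section Morphism.
Variables (A A' : algType C) (S : set A) (f : A -> A').
Hypotheses (S1 : S 1) (SM : forall X Y, S X -> S Y -> S (X * Y)).
Hypothesis SP : forall (a : C) X Y, S X -> S Y -> S (a *: X + Y).
Hypothesis fP : forall (a : C) X Y, S X -> S Y -> f (a *: X + Y) = a *: f X + f Y.
Hypotheses (fM : forall X Y, S X -> S Y -> f (X * Y) = f X * f Y) (f1 : f 1 = 1).

Let S0 : S 0.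
Proof. by have := SP (-1) S1 S1; rewrite scaleN1r addNr. Qed.

Let f0 : f 0 = 0.
Proof. by have := fP (-1) S1 S1; rewrite !scaleN1r !addNr. Qed.

Let morph_lincomb (g : 'I_N -> C) (v : 'I_N -> A) : (forall j, S (v j)) ->
  S (\sum_(j < N) g j *: v j) /\ f (\sum_(j < N) g j *: v j) = \sum_(j < N) g j *: f (v j).
Proof.
move=> Sv; elim/big_rec2: _ => // j x y _ [Sy fy].
by split; [exact: SP|rewrite fP // fy].
Qed.

Let morph_pow u k : S u -> S (u ^+ k) /\ f (u ^+ k) = f u ^+ k.
Proof.
move=> Su; elim: k => [|k [IH1 IH2]]; first by rewrite !expr0.
by rewrite !exprS -IH2 fM //; split=> //; exact: SM.
Qed.

Let morph_sproj z u : S u -> S (sproj z u) /\ f (sproj z u) = sproj z (f u).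
Proof.
move=> Su; have [h1 h2] := @morph_lincomb (fun k => z^-1 ^+ k) (fun k => u ^+ k)
  (fun k => (morph_pow k Su).1).
split; first by rewrite /sproj -[_ *: _]addr0; exact: SP.
rewrite /sproj -[X in f X]addr0 fP // f0 addr0 h2; congr (_ *: _).
by apply: eq_bigr => k _; rewrite (morph_pow k Su).2.
Qed.

(** [psi u] is a polynomial in [u], so algebra morphisms commute with it. The domain [S] is needed
    because the quotient map is a morphism only on [A0alg]; closure of subalgebras under [psi] is
    the case of the identity. *)
Lemma morph_psi u : S u -> [/\ S (psi u), f (psi u) = psi (f u), S (psiV u) & f (psiV u) = psiV (f u)].
Proof.
move=> Su.
have h g := @morph_lincomb g (fun j : 'I_N => sproj (zt ^+ j) u) (fun j => (morph_sproj _ Su).1).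
have [h1 h2] := h (fun j => (expR (lam j / 2))%:C).
have [h3 h4] := h (fun j => (expR (- (lam j / 2)))%:C).
split=> //.
  by rewrite [LHS]h2; apply: eq_bigr => j _; rewrite (morph_sproj _ Su).2.
by rewrite [LHS]h4; apply: eq_bigr => j _; rewrite (morph_sproj _ Su).2.
Qed.

End Morphism.

(** Inversion exchanges the eigenspaces of z and z^-1, and [lam] takes the same value at both
    because the Fourier transform of the real function [rho] is real. *)
Lemma psi_inv (A : algType C) (u v : A) : u ^+ N = 1 -> v ^+ N = 1 -> u * v = 1 -> v * u = 1 ->
  psi v = psi u.
Proof.
move=> uN vN uv vu.
have n0 : (0 < N)%N by exact: ltnW.
(* The reduction modulo N matters at j = 0, where N - j is out of range. *)
pose opp (j : 'I_N) : 'I_N := Ordinal (ltn_pmod (N - j) n0).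
have zopp j : zt ^+ opp j = (zt ^+ j)^-1.
  rewrite /= prim_expr_mod ?zeta_primitive //.
  have z0 : zt ^+ j != 0 by rewrite expf_neq0 // zeta_neq0.
  by apply: (mulIf z0); rewrite -exprD subnK ?zetaN ?mulVf // ltnW.
have oppK : involutive opp.
  move=> j; apply/val_inj/eqP.
  have := eq_prim_root_expr (zeta_primitive R N2) (opp (opp j)) j.
  by rewrite !zopp invrK eqxx => /esym; rewrite !modn_small.
rewrite /psi (reindex_inj (inv_inj oppK)) /=; apply: eq_bigr => j _.
have -> : lam (opp j) = lam j.
  by rewrite /lam (fourier_conj (zopp j)); case: (fourier rho j).
by rewrite zopp (sproj_inv uN vN) // -exprM mulnC exprM zetaN // expr1n.
Qed.

Lemma psi_star (A : starAlgType R) (u : A) : u ^+ N = 1 -> u * star u = 1 -> star u * u = 1 ->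
  star (psi u) = psi u.
Proof.
move=> uN uv vu.
have vN : star u ^+ N = 1 by rewrite -starX uN star1.
rewrite /psi star_sum; apply: eq_bigr => j _; rewrite starZ conjc_real; congr (_ *: _).
rewrite -[RHS](sproj_inv uN vN uv vu); last by rewrite -exprM mulnC exprM zetaN // expr1n.
rewrite /sproj starZ star_sum; congr (_ *: _).
  by rewrite -[conjc _]/((@conjc R : {rmorphism C -> C}) _) fmorphV rmorph_nat.
apply: eq_bigr => k _; rewrite starZ starX; congr (_ *: _).
have zc : (@conjc R : {rmorphism C -> C}) zt = zt^-1 by exact: zeta_conj.
by rewrite -[conjc _]/((@conjc R : {rmorphism C -> C}) _) rmorphXn fmorphV rmorphXn zc exprVn invrK.
Qed.

Lemma psi_diag (F : cstarAlgType R) (S : set F) (u : F) :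
  S 1 -> (forall X Y, S X -> S Y -> S (X * Y)) -> (forall X Y, S X -> S Y -> S (X + Y)) ->
  (forall a X, S X -> S (a *: X)) -> S u -> u ^+ N = 1 ->
  diag_exp S (Defs.half R *: (invsqrtN R N *: power_sum rho u)) (psi u).
Proof.
move=> S1 SM SD SZ Su uN; exists 'I_N, (fun j : 'I_N => sproj (zt ^+ j) u), (fun j : 'I_N => lam j / 2).
have zN j : (zt ^+ j) ^+ N = 1 by rewrite -exprM mulnC exprM zetaN // expr1n.
have SX k : S (u ^+ k) by elim: k => [|k IH]; [rewrite expr0|rewrite exprS; exact: SM].
split=> //.
- move=> j; apply: (SZ); elim/big_rec: _ => [|k X _ SXx]; last by apply: SD => //; exact: SZ.
  by rewrite -(scale0r (1 : F)); exact: SZ.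
- move=> i j; rewrite sprojM //; congr (if _ then _ else _).
  rewrite -(inj_eq val_inj); apply/idP/idP => [/eqP h|/eqP ->//].
  have := eq_prim_root_expr (zeta_primitive R N2) i j; rewrite h eqxx => /esym.
  by rewrite !modn_small.
- exact: sproj_sum.
- rewrite power_sum_spectral // scaler_sumr; apply: eq_bigr => j _.
  by rewrite scalerA /Defs.half mulrC rmorphM fmorphV /= rmorph_nat.
Qed.

End Calculus.

End SpectralProjections.

(** * The field algebra and its gauge invariant part *)

Section Twist.
Variables (R : realType) (A : starAlgType R).
Local Notation C := R[i].
Implicit Types (X Y Z : A) (z : C).

Definition twist z X Y : Prop := X * Y = z *: (Y * X).

Lemma twistMr z z' X Y Y' : twist z X Y -> twist z' X Y' -> twist (z * z') X (Y * Y').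
Proof.
move=> h h'; rewrite /twist mulrA h -scalerAl -[Y * X * Y']mulrA h' -scalerAr scalerA.
by rewrite (mulrA Y).
Qed.

Lemma twistMl z z' X X' Y : twist z X Y -> twist z' X' Y -> twist (z * z') (X * X') Y.
Proof.
rewrite /twist => h h'.
by rewrite -mulrA h' -scalerAr (mulrA X) h -scalerAl scalerA -(mulrA Y) (mulrC z).
Qed.

Lemma twist_sym z X Y : z != 0 -> twist z X Y -> twist z^-1 Y X.
Proof. by rewrite /twist => z0 ->; rewrite scalerA mulVf // scale1r. Qed.

Lemma twist_starl z X Y : z != 0 -> X * star X = 1 -> star X * X = 1 ->
  twist z X Y -> twist z^-1 (star X) Y.
Proof.
rewrite /twist => z0 u1 u2 h.
have : star X * (X * Y) * star X = z *: (star X * Y).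
  by rewrite h -scalerAr -scalerAl -!mulrA u1 mulr1.
rewrite !mulrA u2 mul1r => ->.
by rewrite scalerA mulVf // scale1r.
Qed.

Lemma twist_starr z X Y : z != 0 -> Y * star Y = 1 -> star Y * Y = 1 ->
  twist z X Y -> twist z^-1 X (star Y).
Proof.
move=> z0 u1 u2 /(twist_sym z0) h.
have := twist_starl (invr_neq0 z0) u1 u2 h.
by rewrite invrK => /(twist_sym z0).
Qed.

Lemma twist1 X Y : twist 1 X Y <-> X * Y = Y * X.
Proof. by rewrite /twist scale1r. Qed.

Lemma twistX z X Y k : twist z X Y -> twist (z ^+ k) (X ^+ k) Y.
Proof.
move=> h; elim: k => [|k IH]; first by rewrite !expr0; apply/twist1; rewrite mulr1 mul1r.
by rewrite !exprS; apply: twistMl.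
Qed.

Lemma comm_star X Y : Y * star Y = 1 -> star Y * Y = 1 -> X * Y = Y * X -> X * star Y = star Y * X.
Proof.
move=> u1 u2 /twist1 h; apply/twist1.
by have := twist_starr (oner_neq0 _) u1 u2 h; rewrite invr1.
Qed.

End Twist.

(** Closure under [star] is left out: the generators considered below are unitaries of finite order,
    and their adjoints are powers of them. *)
Inductive alg_gen (K : nzRingType) (A : algType K) (G : set A) : A -> Prop :=
| alg_gen_base X : G X -> alg_gen G X
| alg_gen_one : alg_gen G 1
| alg_gen_add X Y : alg_gen G X -> alg_gen G Y -> alg_gen G (X + Y)
| alg_gen_scale (a : K) X : alg_gen G X -> alg_gen G (a *: X)
| alg_gen_mul X Y : alg_gen G X -> alg_gen G Y -> alg_gen G (X * Y).

Section Field.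
Variables (R : realType) (N : nat).
Hypothesis N2 : (2 <= N)%N.
Local Notation C := R[i].
Local Notation zt := (zeta R N).
Variables (F : cstarAlgType R) (e : cell -> 'M[C]_N -> F).
Hypothesis hF : field_algebra e.

Let n0 : (0 < N)%N := ltnW N2.

Lemma ztk_neq0 k : zt ^+ k != 0 :> C.
Proof. by rewrite expf_neq0 // zeta_neq0. Qed.

Lemma eQ_pow c k : e c (Qmx R N) ^+ k = e c (\matrix_(i, j) ((i == j)%:R * zt ^+ (i * k))).
Proof.
elim: k => [|k IH].
  rewrite expr0 -(fa_one hF c); congr (e c _); apply/matrixP => i j.
  by rewrite !mxE muln0 expr0 mulr1.
rewrite exprS IH -(fa_mul hF); congr (e c _); apply/matrixP => i j; rewrite !mxE.
rewrite (bigD1 i) //= big1 ?addr0 => [|l li]; rewrite !mxE.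
  by rewrite eqxx mul1r rootNE // mulrCA -exprD mulnS.
by rewrite eq_sym (negPf li) !mul0r.
Qed.

Lemma eP_pow c k : e c (Pmx R N) ^+ k = e c (\matrix_(i, j) ((i == (j + k) %% N :> nat)%N%:R)).
Proof.
elim: k => [|k IH].
  rewrite expr0 -(fa_one hF c); congr (e c _); apply/matrixP => i j.
  by rewrite !mxE addn0 modn_small.
rewrite exprS IH -(fa_mul hF); congr (e c _); apply/matrixP => i j; rewrite !mxE.
pose l : 'I_N := Ordinal (ltn_pmod (j + k) n0).
rewrite (bigD1 l) //= big1 ?addr0 => [|l' l'l]; rewrite !mxE.
  by rewrite eqxx mulr1 modnDml -addnA addn1.
rewrite [X in _ * X](_ : _ = 0) ?mulr0 //.
by case: eqP => // h; case/eqP: l'l; apply/val_inj.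
Qed.

Lemma eQN c : e c (Qmx R N) ^+ N = 1.
Proof.
rewrite eQ_pow -(fa_one hF c); congr (e c _); apply/matrixP => i j; rewrite !mxE.
by rewrite mulnC exprM zetaN // expr1n mulr1.
Qed.

Lemma ePN c : e c (Pmx R N) ^+ N = 1.
Proof.
rewrite eP_pow -(fa_one hF c); congr (e c _); apply/matrixP => i j; rewrite !mxE.
by rewrite modnDr modn_small.
Qed.

Lemma eQ_starl c : star (e c (Qmx R N)) * e c (Qmx R N) = 1.
Proof.
rewrite -(fa_star hF) -(fa_mul hF) -(fa_one hF c); congr (e c _).
apply/matrixP => i j; rewrite !mxE.
rewrite (bigD1 i) //= big1 ?addr0 => [|l li]; rewrite !mxE.
  rewrite eqxx mul1r; have [_|_] := eqVneq i j; last by rewrite mul0r mulr0.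
  have zc : (@conjc R : {rmorphism C -> C}) zt = zt^-1 by exact: zeta_conj.
  rewrite mul1r rootNE // -[conjc _]/((@conjc R : {rmorphism C -> C}) _) rmorphXn zc exprVn mulVf //.
  exact: ztk_neq0.
by rewrite (negPf li) mul0r conjc0 mul0r.
Qed.

Lemma eP_starl c : star (e c (Pmx R N)) * e c (Pmx R N) = 1.
Proof.
rewrite -(fa_star hF) -(fa_mul hF) -(fa_one hF c); congr (e c _).
apply/matrixP => i j; rewrite !mxE.
pose l : 'I_N := Ordinal (ltn_pmod (j + 1) n0).
rewrite (bigD1 l) //= big1 ?addr0 => [|l' l'l]; rewrite !mxE.
  rewrite eqxx mulr1 conjc_nat; congr (_%:R); congr nat_of_bool.
  apply/eqP/eqP => [/eqP|->//]; rewrite eqn_modDr !modn_small // => /eqP h.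
  exact/val_inj.
rewrite [X in _ * X](_ : _ = 0) ?mulr0 //.
by case: eqP => // h; case/eqP: l'l; apply/val_inj.
Qed.

Lemma unitary_right (A : starAlgType R) (X : A) : X ^+ N = 1 -> star X * X = 1 ->
  [/\ X * star X = 1, star X = X ^+ N.-1 & star X ^+ N = 1].
Proof.
move=> XN XX.
have E : star X = X ^+ N.-1.
  by rewrite -[LHS]mulr1 -XN -{1}(prednK n0) exprS mulrA XX mul1r.
split=> //; first by rewrite E -exprS prednK.
by rewrite -starX XN star1.
Qed.

Lemma weyl c : twist zt^-1 (e c (Pmx R N)) (e c (Qmx R N)).
Proof.
rewrite /twist; apply: (scalerI (zeta_neq0 R N)).
rewrite scalerA mulfV ?zeta_neq0 // scale1r -!(fa_mul hF).
have eZ : forall a B, e c (a *: B) = a *: e c B.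
  by have [] := linear_props (fa_linear hF c).
rewrite -eZ; congr (e c _); apply/matrixP => i j; rewrite !mxE.
rewrite (bigD1 j) //= [X in _ * (_ + X)]big1 ?addr0 => [|l lj]; last first.
  by rewrite !mxE (negPf lj) mul0r mulr0.
rewrite (bigD1 i) //= [X in _ + X]big1 ?addr0 => [|l li]; last first.
  by rewrite !mxE eq_sym (negPf li) !mul0r.
rewrite !mxE !eqxx !mul1r !rootNE //.
case: eqP => [->|_]; last by rewrite mul0r !mulr0.
by rewrite mul1r mulr1 prim_expr_mod ?zeta_primitive // addn1 exprS.
Qed.

Lemma QH_unitary x : [/\ QH e x ^+ N = 1, star (QH e x) * QH e x = 1,
  QH e x * star (QH e x) = 1 & star (QH e x) = QH e x ^+ N.-1].
Proof.
by have [h1 h2 _] := unitary_right (eQN (inl x)) (eQ_starl (inl x)); split; rewrite ?eQN ?eQ_starl.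
Qed.

Lemma PH_unitary x : [/\ PH e x ^+ N = 1, star (PH e x) * PH e x = 1,
  PH e x * star (PH e x) = 1 & star (PH e x) = PH e x ^+ N.-1].
Proof.
by have [h1 h2 _] := unitary_right (ePN (inl x)) (eP_starl (inl x)); split; rewrite ?ePN ?eP_starl.
Qed.

Lemma QG_unitary b : [/\ QG e b ^+ N = 1, star (QG e b) * QG e b = 1,
  QG e b * star (QG e b) = 1 & star (QG e b) = QG e (orev b)].
Proof.
case: b => [b r]; have [h1 h2 h3] := unitary_right (eQN (inr b)) (eQ_starl (inr b)).
by rewrite /QG /orev /=; case: r => /=; rewrite ?starK; split; rewrite ?eQN ?eQ_starl.
Qed.

Lemma PG_unitary b : [/\ PG e b ^+ N = 1, star (PG e b) * PG e b = 1,
  PG e b * star (PG e b) = 1 & star (PG e b) = PG e (orev b)].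
Proof.
case: b => [b r]; have [h1 h2 h3] := unitary_right (ePN (inr b)) (eP_starl (inr b)).
by rewrite /PG /orev /=; case: r => /=; rewrite ?starK; split; rewrite ?ePN ?eP_starl.
Qed.

Lemma QQ_comm c d : e c (Qmx R N) * e d (Qmx R N) = e d (Qmx R N) * e c (Qmx R N).
Proof. by have [->//|cd] := eqVneq c d; rewrite (fa_comm hF). Qed.

Lemma PP_comm c d : e c (Pmx R N) * e d (Pmx R N) = e d (Pmx R N) * e c (Pmx R N).
Proof. by have [->//|cd] := eqVneq c d; rewrite (fa_comm hF). Qed.

Definition phase (b : bool) : C := if b then zt^-1 else 1.

Lemma phase_neq0 b : phase b != 0.
Proof. by case: b; rewrite /phase ?oner_neq0 ?invr_eq0 ?zeta_neq0. Qed.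

Lemma PQ_twist c d : twist (phase (c == d)) (e c (Pmx R N)) (e d (Qmx R N)).
Proof.
have [->|cd] := eqVneq c d; first exact: weyl.
by apply/twist1; rewrite (fa_comm hF).
Qed.

(** A ready-made algebra around [G] that is commutative as soon as [G] is ([bicomC]). Membership is
    immediate for sums, products and powers, so commutation of composite elements never has to be
    computed. *)
Definition bicommutant (G : set F) : set F :=
  [set X | forall Z, (forall Y, G Y -> Z * Y = Y * Z) -> Z * X = X * Z].

Section Bicommutant.
Variable G : set F.

Lemma bicom1 : bicommutant G 1.
Proof. by move=> Z _; rewrite mulr1 mul1r. Qed.

Lemma bicomM X Y : bicommutant G X -> bicommutant G Y -> bicommutant G (X * Y).
Proof. by move=> hX hY Z hZ; rewrite mulrA hX // -mulrA hY // mulrA. Qed.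

Lemma bicomD X Y : bicommutant G X -> bicommutant G Y -> bicommutant G (X + Y).
Proof. by move=> hX hY Z hZ; rewrite mulrDl mulrDr hX // hY. Qed.

Lemma bicomZ (a : C) X : bicommutant G X -> bicommutant G (a *: X).
Proof. by move=> hX Z hZ; rewrite -scalerAl -scalerAr hX. Qed.

Lemma bicom_base X : G X -> bicommutant G X.
Proof. by move=> GX Z; apply. Qed.

Lemma bicomX X k : bicommutant G X -> bicommutant G (X ^+ k).
Proof.
by move=> hX; elim: k => [|k IH]; [rewrite expr0; exact: bicom1|rewrite exprS; exact: bicomM].
Qed.

Lemma bicom_prod (I : Type) (s : seq I) (f : I -> F) : (forall i, bicommutant G (f i)) ->
  bicommutant G (\prod_(i <- s) f i).
Proof.
move=> h; elim: s => [|i s IH]; first by rewrite big_nil; exact: bicom1.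
by rewrite big_cons; exact: bicomM.
Qed.

Lemma bicomC : (forall X Y, G X -> G Y -> X * Y = Y * X) ->
  forall X Y, bicommutant G X -> bicommutant G Y -> X * Y = Y * X.
Proof. by move=> GC X Y hX hY; apply: hY => Z GZ; symmetry; apply: hX => Y' GY; exact: GC. Qed.

End Bicommutant.

Definition Qfam : set F := range (fun c => e c (Qmx R N)).
Definition Pfam : set F := range (fun c => e c (Pmx R N)).

Lemma QfamC X Y : bicommutant Qfam X -> bicommutant Qfam Y -> X * Y = Y * X.
Proof. by apply: bicomC => _ _ [c _ <-] [d _ <-]; exact: QQ_comm. Qed.

Lemma PfamC X Y : bicommutant Pfam X -> bicommutant Pfam Y -> X * Y = Y * X.
Proof. by apply: bicomC => _ _ [c _ <-] [d _ <-]; exact: PP_comm. Qed.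

Lemma Qfam_QH x : bicommutant Qfam (QH e x).
Proof. by apply: bicom_base; exists (inl x). Qed.

Lemma Qfam_QHs x : bicommutant Qfam (star (QH e x)).
Proof. by have [_ _ _ ->] := QH_unitary x; apply: bicomX; exact: Qfam_QH. Qed.

Lemma Qfam_QG b : bicommutant Qfam (QG e b).
Proof.
case: b => [b []]; last by apply: bicom_base; exists (inr b).
have [h1 h2 _] := unitary_right (eQN (inr b)) (eQ_starl (inr b)).
by rewrite /QG /= h2; apply: bicomX; apply: bicom_base; exists (inr b).
Qed.

Lemma Qfam_QGs b : bicommutant Qfam (star (QG e b)).
Proof. by have [_ _ _ ->] := QG_unitary b; exact: Qfam_QG. Qed.

Definition Dlink (b : obond) : F := dQH e b * star (QG e b).

Lemma Qfam_D b : bicommutant Qfam (Dlink b).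
Proof.
apply: bicomM; last exact: Qfam_QGs.
by apply: bicomM; [exact: Qfam_QH|exact: Qfam_QHs].
Qed.

Lemma Qfam_dQG x : bicommutant Qfam (dQG e x).
Proof. by apply: bicom_prod => b; exact: Qfam_QG. Qed.

Lemma Pfam_PH x : bicommutant Pfam (PH e x).
Proof. by apply: bicom_base; exists (inl x). Qed.

Lemma Pfam_PG b : bicommutant Pfam (PG e b).
Proof.
case: b => [b []]; last by apply: bicom_base; exists (inr b).
have [h1 h2 _] := unitary_right (ePN (inr b)) (eP_starl (inr b)).
by rewrite /PG /= h2; apply: bicomX; apply: bicom_base; exists (inr b).
Qed.

Lemma star_prod (I : Type) (s : seq I) (f : I -> F) :
  star (\prod_(i <- s) f i) = \prod_(i <- rev s) star (f i).
Proof.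
elim: s => [|i s IH]; first by rewrite !big_nil star1.
by rewrite big_cons starM IH rev_cons -cats1 big_cat big_seq1.
Qed.

Lemma Pfam_calQ x : bicommutant Pfam (calQ e x).
Proof.
apply: bicomM; first exact: Pfam_PH.
rewrite /dsPG star_prod; apply: bicom_prod => b.
by have [_ _ _ ->] := PG_unitary b; exact: Pfam_PG.
Qed.

Lemma unitaryM (X Y : F) : X * star X = 1 -> star X * X = 1 -> Y * star Y = 1 -> star Y * Y = 1 ->
  X * Y * star (X * Y) = 1 /\ star (X * Y) * (X * Y) = 1.
Proof.
move=> a b c d; rewrite starM; split.
  by rewrite -mulrA (mulrA Y) c mul1r a.
by rewrite -mulrA (mulrA (star X)) b mul1r d.
Qed.

Lemma unitary_prod (I : Type) (s : seq I) (f : I -> F) :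
  (forall i, f i * star (f i) = 1 /\ star (f i) * f i = 1) ->
  \prod_(i <- s) f i * star (\prod_(i <- s) f i) = 1 /\
  star (\prod_(i <- s) f i) * \prod_(i <- s) f i = 1.
Proof.
move=> h; elim: s => [|i s [IH1 IH2]]; first by rewrite !big_nil star1 mulr1.
by rewrite !big_cons; have [a b] := h i; apply: unitaryM.
Qed.

Lemma dsPG_unitary x : dsPG e x * star (dsPG e x) = 1 /\ star (dsPG e x) * dsPG e x = 1.
Proof. by apply: unitary_prod => b; have [_ ? ? _] := PG_unitary b. Qed.

Lemma dQG_unitary x : dQG e x * star (dQG e x) = 1 /\ star (dQG e x) * dQG e x = 1.
Proof. by apply: unitary_prod => b; have [_ ? ? _] := QG_unitary b. Qed.

Lemma calQ_unitary x : calQ e x * star (calQ e x) = 1 /\ star (calQ e x) * calQ e x = 1.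
Proof.
have [_ a b _] := PH_unitary x; have [c d] := dsPG_unitary x.
by apply: unitaryM; rewrite ?starK.
Qed.

Lemma dQH_unitary b : dQH e b * star (dQH e b) = 1 /\ star (dQH e b) * dQH e b = 1.
Proof.
have [_ a b' _] := QH_unitary (osrc b); have [_ c d _] := QH_unitary (otgt b).
by apply: unitaryM; rewrite ?starK.
Qed.

Lemma D_unitary b : Dlink b * star (Dlink b) = 1 /\ star (Dlink b) * Dlink b = 1.
Proof.
have [a b'] := dQH_unitary b; have [_ c d _] := QG_unitary b.
by apply: unitaryM; rewrite ?starK.
Qed.

Lemma D_star b : star (Dlink b) = Dlink (orev b).
Proof.
rewrite /Dlink /dQH !starM !starK; have [_ _ _ <-] := QG_unitary b; rewrite starK.
have -> : osrc (orev b) = otgt b by [].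
have -> : otgt (orev b) = osrc b by rewrite /otgt /orev /osrc /=; case: b => [b []].
apply: QfamC; first exact: Qfam_QG.
by apply: bicomM; [exact: Qfam_QH|exact: Qfam_QHs].
Qed.

Section Gauge.

Lemma PG_Q_twist b pb : twist (if b.2 then (phase (b.1 == pb))^-1 else phase (b.1 == pb))
  (PG e b) (e (inr pb) (Qmx R N)).
Proof.
have h : twist (phase (b.1 == pb)) (e (inr b.1) (Pmx R N)) (e (inr pb) (Qmx R N)).
  by exact: PQ_twist (inr b.1) (inr pb).
rewrite /PG; case: b.2 => //.
have [u1 _ _] := unitary_right (ePN (inr b.1)) (eP_starl (inr b.1)).
by apply: twist_starl => //; [exact: phase_neq0|exact: eP_starl].
Qed.

Lemma PG_QH_comm b x : twist 1 (PG e b) (QH e x).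
Proof.
have h : twist 1 (e (inr b.1) (Pmx R N)) (QH e x) by exact: PQ_twist (inr b.1) (inl x).
rewrite /PG; case: b.2 => //.
have [u1 _ _] := unitary_right (ePN (inr b.1)) (eP_starl (inr b.1)).
rewrite -[X in twist X]invr1; apply: twist_starl => //.
exact: eP_starl.
Qed.

(** The phase from commuting the product of the P_G over the bonds starting at [z] with Q_G(pb). The
    two bonds that point to [z] enter reversed, hence the inverses. *)
Definition bond_phase (z : site) (pb : pbond) : C :=
  phase ((z, false) == pb) * phase ((z, true) == pb) *
  (phase ((z - e1, false) == pb))^-1 * (phase ((z - e2, true) == pb))^-1.

Lemma bond_phase_neq0 z pb : bond_phase z pb != 0.
Proof. by rewrite /bond_phase !mulf_neq0 ?invr_eq0 ?phase_neq0. Qed.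

Lemma calQ_QG z pb : twist (bond_phase z pb)^-1 (calQ e z) (e (inr pb) (Qmx R N)).
Proof.
rewrite -[X in twist X](mul1r (bond_phase z pb)^-1); apply: twistMl.
  exact: PQ_twist (inl z) (inr pb).
have [u1 u2] := dsPG_unitary z.
apply: twist_starl => //; first exact: bond_phase_neq0.
rewrite /dsPG /bonds_from !big_cons big_nil mulr1 !mulrA /bond_phase.
by do 3?[apply: twistMl]; apply: PG_Q_twist.
Qed.

Lemma calQ_QH (z x : site) : twist (phase (z == x)) (calQ e z) (QH e x).
Proof.
rewrite -[X in twist X]mulr1; apply: twistMl.
  exact: PQ_twist (inl z) (inl x).
have [u1 u2] := dsPG_unitary z; rewrite -[X in twist X]invr1; apply: twist_starl => //.
rewrite /dsPG; elim: (bonds_from z) => [|b s IH].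
  by rewrite big_nil; apply/twist1; rewrite mulr1 mul1r.
rewrite big_cons -[X in twist X]mulr1; apply: twistMl => //.
exact: PG_QH_comm.
Qed.

(** Gauge invariance of the link variable: the phases from Q_H at the two ends of the bond cancel
    the one from Q_G, whichever of the ends, if any, is [z]. *)
Lemma calQ_D z b : calQ e z * Dlink b = Dlink b * calQ e z.
Proof.
suff pos pb : calQ e z * Dlink (pb, false) = Dlink (pb, false) * calQ e z.
  case: b => [pb []] //; rewrite -[(pb, true)]/(orev (pb, false)) -D_star.
  by have [u1 u2] := D_unitary (pb, false); apply: comm_star.
apply/twist1; rewrite /Dlink /dQH.
have -> : 1 = phase (z == otgt (pb, false)) * (phase (z == osrc (pb, false)))^-1 *
   ((bond_phase z pb)^-1)^-1.
  rewrite invrK /bond_phase; case: pb => [x d]; rewrite /otgt /osrc /= !xpair_eqE.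
  have p1 : phase false = 1 by [].
  case: d; rewrite /dirv ?andbF ?andbT !p1 ?invr1 ?mul1r ?mulr1 subr_eq.
    by field; rewrite !phase_neq0.
  by field; rewrite !phase_neq0.
have [_ a1 a2 _] := QH_unitary (osrc (pb, false)).
have [_ b1 b2 _] := QG_unitary (pb, false).
apply: twistMr; first apply: twistMr; first exact: calQ_QH.
  by apply: twist_starr => //; [exact: phase_neq0|exact: calQ_QH].
by apply: twist_starr => //; [exact: invr_neq0 (bond_phase_neq0 _ _)|exact: calQ_QG].
Qed.

Lemma calQ_P z X : bicommutant Pfam X -> calQ e z * X = X * calQ e z.
Proof. by move=> hX; apply: PfamC => //; exact: Pfam_calQ. Qed.

Lemma F0_1 : F0 e 1. Proof. exact: star_gen_one. Qed.
Lemma F0_M X Y : F0 e X -> F0 e Y -> F0 e (X * Y). Proof. exact: star_gen_mul. Qed.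
Lemma F0_star X : F0 e X -> F0 e (star X). Proof. exact: star_gen_star. Qed.
Lemma F0_QH x : F0 e (QH e x). Proof. by apply: star_gen_base; left; exists x; left. Qed.
Lemma F0_PH x : F0 e (PH e x). Proof. by apply: star_gen_base; left; exists x; right. Qed.
Lemma F0_QG b : F0 e (QG e b). Proof. by apply: star_gen_base; right; exists b; left. Qed.
Lemma F0_PG b : F0 e (PG e b). Proof. by apply: star_gen_base; right; exists b; right. Qed.
Lemma A0_1 : A0alg e 1.
Proof. by split=> [|x]; [exact: F0_1|rewrite mulr1 mul1r]. Qed.

Lemma A0_M X Y : A0alg e X -> A0alg e Y -> A0alg e (X * Y).
Proof.
move=> [FX cX] [FY cY]; split; first exact: F0_M.
by move=> x; rewrite -mulrA cY mulrA cX mulrA.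
Qed.

Lemma A0_lin (a : C) X Y : A0alg e X -> A0alg e Y -> A0alg e (a *: X + Y).
Proof.
move=> [FX cX] [FY cY]; split; first by apply: star_gen_add => //; apply: star_gen_scale.
by move=> x; rewrite mulrDl mulrDr cY -scalerAl -scalerAr cX.
Qed.

Lemma A0_D X Y : A0alg e X -> A0alg e Y -> A0alg e (X + Y).
Proof. by move=> hX hY; rewrite -[X]scale1r; apply: A0_lin. Qed.

Lemma A0_0 : A0alg e 0.
Proof. by have := A0_lin (-1) A0_1 A0_1; rewrite scaleN1r addNr. Qed.

Lemma A0_Z (a : C) X : A0alg e X -> A0alg e (a *: X).
Proof. by move=> hX; rewrite -[_ *: _]addr0; apply: A0_lin => //; exact: A0_0. Qed.

Lemma A0_X X k : A0alg e X -> A0alg e (X ^+ k).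
Proof.
by move=> hX; elim: k => [|k IH]; [rewrite expr0; exact: A0_1|rewrite exprS; exact: A0_M].
Qed.

Lemma A0_star X : A0alg e X -> A0alg e (star X).
Proof.
move=> [FX cX]; split; first exact: F0_star.
move=> x; have [u1 u2] := calQ_unitary x.
by have := congr1 (@star R F) (comm_star u1 u2 (cX x)); rewrite !starM !starK => ->.
Qed.

Lemma A0_prod (I : Type) (s : seq I) (f : I -> F) :
  (forall i, A0alg e (f i)) -> A0alg e (\prod_(i <- s) f i).
Proof.
move=> h; elim: s => [|i s IH]; first by rewrite big_nil; exact: A0_1.
by rewrite big_cons; exact: A0_M.
Qed.

Lemma A0_PG b : A0alg e (PG e b).
Proof. by split=> [|x]; [exact: F0_PG|rewrite calQ_P //; exact: Pfam_PG]. Qed.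

Lemma A0_PH x : A0alg e (PH e x).
Proof. by split=> [|y]; [exact: F0_PH|rewrite calQ_P //; exact: Pfam_PH]. Qed.

Lemma A0_Dlink b : A0alg e (Dlink b).
Proof.
split=> [|x]; last by rewrite calQ_D.
by do 2?[apply: F0_M]; do ?[apply: F0_star]; try exact: F0_QH; exact: F0_QG.
Qed.

Lemma A0_dsPG x : A0alg e (dsPG e x).
Proof. by apply: A0_prod; exact: A0_PG. Qed.

Lemma A0_calQ x : A0alg e (calQ e x).
Proof. by apply: A0_M; [exact: A0_PH|apply: A0_star; exact: A0_dsPG]. Qed.

End Gauge.

End Field.

(** * Generators of the gauge invariant algebra and of its quotient *)

Section Generation.
Variables (R : realType) (N : nat).
Hypothesis N2 : (2 <= N)%N.
Local Notation C := R[i].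
Local Notation zt := (zeta R N).
Variables (F : cstarAlgType R) (e : cell -> 'M[C]_N -> F).
Hypothesis hF : field_algebra e.

Let n0 : (0 < N)%N := ltnW N2.

Lemma alg_gen_0 (K : nzRingType) (A : algType K) (G : set A) : alg_gen G 0.
Proof. by rewrite -(scale0r (1 : A)); apply: alg_gen_scale; exact: alg_gen_one. Qed.

Lemma alg_gen_X (K : nzRingType) (A : algType K) (G : set A) X k :
  alg_gen G X -> alg_gen G (X ^+ k).
Proof.
move=> h; elim: k => [|k IH]; first by rewrite expr0; exact: alg_gen_one.
by rewrite exprS; exact: alg_gen_mul.
Qed.

Definition gauge_gen : set F :=
  [set X | (exists b, X = PG e b) \/ (exists x, X = PH e x) \/ (exists b, X = Dlink e b)].

Lemma gauge_gen_A0 X : alg_gen gauge_gen X -> A0alg e X.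
Proof.
elim=> [{}X [[b ->]|[[x ->]|[b ->]]]||{}X Y _ hX _ hY|a {}X _ hX|{}X Y _ hX _ hY].
- exact: A0_PG.
- exact: A0_PH.
- exact: A0_Dlink.
- exact: A0_1.
- exact: A0_D.
- exact: A0_Z.
- exact: A0_M.
Qed.

Definition mono (s : seq site) : F := \prod_(x <- s) QH e x.

Lemma mono_cat s t : mono (s ++ t) = mono s * mono t.
Proof. by rewrite /mono big_cat. Qed.

Lemma mono_nseq k x : mono (nseq k x) = QH e x ^+ k.
Proof.
elim: k => [|k IH]; first by rewrite /mono big_nil.
by rewrite exprS -IH /mono /= big_cons.
Qed.

Lemma mono_gauge s g : alg_gen gauge_gen g ->
  exists2 g', alg_gen gauge_gen g' & mono s * g = g' * mono s.
Proof.
elim: s g => [|x s IH] g hg; first by exists g => //; rewrite /mono big_nil mulr1 mul1r.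
have [g1 h1 E1] := IH _ hg.
have [g2 h2 E2] : exists2 g2, alg_gen gauge_gen g2 & QH e x * g1 = g2 * QH e x.
  elim: h1 => {g hg E1 g1} [X hX||X Y _ [a ha Ea] _ [b hb Eb]|z X _ [a ha Ea]|X Y _ [a ha Ea] _ [b hb Eb]].
  - case: (hX) => [[b Xb]|[[y Xy]|[b Xb]]].
    + exists X; first exact: alg_gen_base.
      by have /twist1 := PG_QH_comm N2 hF b x; rewrite -Xb => ->.
    + exists ((phase R N (y == x))^-1 *: X); first by apply: alg_gen_scale; exact: alg_gen_base.
      have h : twist (phase R N (y == x)) X (QH e x) by rewrite Xy; exact: PQ_twist (inl y) (inl x).
      by rewrite -scalerAl h scalerA mulVf ?phase_neq0 // scale1r.
    + exists X; first exact: alg_gen_base.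
      by apply: (QfamC hF); [exact: Qfam_QH|rewrite Xb; exact: Qfam_D].
  - by exists 1; [exact: alg_gen_one|rewrite mulr1 mul1r].
  - by exists (a + b); [exact: alg_gen_add|rewrite mulrDr mulrDl Ea Eb].
  - by exists (z *: a); [exact: alg_gen_scale|rewrite -scalerAr -scalerAl Ea].
  - by exists (a * b); [exact: alg_gen_mul|rewrite mulrA Ea -[a * _ * Y]mulrA Eb mulrA].
exists g2 => //; rewrite /mono !big_cons -/(mono s).
by rewrite -mulrA E1 mulrA E2 mulrA.
Qed.

(** Normal form of an element of the field algebra: gauge invariant coefficients on the left, words
    in the Q_H on the right. [mono_gauge] brings products back into this form. *)
Definition mono_sum X := exists2 L : seq (F * seq site),
  forall t, t \in L -> alg_gen gauge_gen t.1 & X = \sum_(t <- L) t.1 * mono t.2.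

Lemma mono_sum_base g s : alg_gen gauge_gen g -> mono_sum (g * mono s).
Proof.
move=> hg; exists [:: (g, s)]; last by rewrite big_seq1.
by move=> t; rewrite inE => /eqP ->.
Qed.

Lemma mono_sum_D X Y : mono_sum X -> mono_sum Y -> mono_sum (X + Y).
Proof.
move=> [L hL ->] [M hM ->]; exists (L ++ M); last by rewrite big_cat.
by move=> t; rewrite mem_cat => /orP[/hL|/hM].
Qed.

Lemma mono_sum_sum (L : seq (F * seq site)) (f : F * seq site -> F) :
  (forall t, t \in L -> mono_sum (f t)) -> mono_sum (\sum_(t <- L) f t).
Proof.
move=> h; rewrite big_seq; apply: big_ind => //; last exact: mono_sum_D.
by exists [::]; rewrite ?big_nil.
Qed.

Lemma mono_sum_M X Y : mono_sum X -> mono_sum Y -> mono_sum (X * Y).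
Proof.
move=> [L hL ->] [M hM ->]; rewrite mulr_suml; apply: mono_sum_sum => t tL.
rewrite mulr_sumr; apply: mono_sum_sum => u uM.
have [g hg E] := mono_gauge t.2 (hM _ uM).
rewrite -mulrA (mulrA (mono _)) E -(mulrA g) -mono_cat mulrA.
by apply: mono_sum_base; apply: alg_gen_mul => //; exact: hL.
Qed.

Lemma mono_sum_gauge g : alg_gen gauge_gen g -> mono_sum g.
Proof. by move=> hg; have := mono_sum_base [::] hg; rewrite /mono big_nil mulr1. Qed.

Lemma mono_sum_Z (a : C) X : mono_sum X -> mono_sum (a *: X).
Proof.
move=> hX; rewrite -[X]mul1r scalerAl; apply: mono_sum_M => //.
by apply: mono_sum_gauge; apply: alg_gen_scale; exact: alg_gen_one.
Qed.

Lemma mono_sum_mono s : mono_sum (mono s).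
Proof. by rewrite -[mono s]mul1r; apply: mono_sum_base; exact: alg_gen_one. Qed.

Lemma gauge_gen_PG b : alg_gen gauge_gen (PG e b).
Proof. by apply: alg_gen_base; left; exists b. Qed.
Lemma gauge_gen_PH x : alg_gen gauge_gen (PH e x).
Proof. by apply: alg_gen_base; right; left; exists x. Qed.
Lemma gauge_gen_D b : alg_gen gauge_gen (Dlink e b).
Proof. by apply: alg_gen_base; right; right; exists b. Qed.

(** Q_G is eliminated in favour of the invariant link variable and Q_H, so that the words in the Q_H
    carry everything that is not invariant. *)
Lemma QG_star_D b : star (QG e b) = Dlink e b * (QH e (osrc b) * QH e (otgt b) ^+ N.-1).
Proof.
have [_ _ _ <-] := QH_unitary N2 hF (otgt b).
have -> : QH e (osrc b) * star (QH e (otgt b)) = star (dQH e b) by rewrite /dQH starM starK.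
have [_ u2] := dQH_unitary N2 hF b.
rewrite (QfamC hF (Qfam_D N2 hF b) (_ : bicommutant (Qfam e) _)); last first.
  by rewrite /dQH starM starK; apply: bicomM; [exact: Qfam_QH|exact: Qfam_QHs].
by rewrite /Dlink (mulrA (star _)) u2 mul1r.
Qed.

(** [X] and its adjoint are treated together, so that the case of [star] in the induction only swaps
    the two halves. *)
Lemma F0_mono_sum X : F0 e X -> mono_sum X /\ mono_sum (star X).
Proof.
have QGs b : mono_sum (star (QG e b)).
  rewrite QG_star_D; apply: mono_sum_M; first by apply: mono_sum_gauge; exact: gauge_gen_D.
  rewrite -mono_nseq; apply: mono_sum_M; last exact: mono_sum_mono.
  by rewrite -[QH e _]expr1 -mono_nseq; exact: mono_sum_mono.
elim=> [{}X [[x [->|->]]|[b [->|->]]]||{}X Y _ [hX hX'] _ [hY hY']|a {}X _ [hX hX']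
  |{}X Y _ [hX hX'] _ [hY hY']|{}X _ [hX hX']].
- have [_ _ _ ->] := QH_unitary N2 hF x; rewrite -mono_nseq -{1}[QH e x]expr1 -mono_nseq.
  by split; exact: mono_sum_mono.
- have [_ _ _ ->] := PH_unitary N2 hF x.
  by split; apply: mono_sum_gauge; [|apply: alg_gen_X]; exact: gauge_gen_PH.
- split=> //; have [_ _ _ E] := QG_unitary N2 hF (orev b).
  by rewrite /orev /= negbK in E; have := QGs (orev b); rewrite E; case: (b) => [].
- have [_ _ _ ->] := PG_unitary N2 hF b.
  by split; apply: mono_sum_gauge; exact: gauge_gen_PG.
- by rewrite star1; split; apply: mono_sum_gauge; exact: alg_gen_one.
- by rewrite starD; split; exact: mono_sum_D.
- by rewrite starZ; split; exact: mono_sum_Z.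
- by rewrite starM; split; exact: mono_sum_M.
- by rewrite starK.
Qed.

(* Averaging over the powers of [calQ x] projects onto the words in which
   [QH x] occurs a multiple of N times. *)
Definition average x X : F :=
  (N%:R)^-1 *: \sum_(k < N) calQ e x ^+ k * X * star (calQ e x) ^+ k.

Lemma calQ_pow_star x k : calQ e x ^+ k * star (calQ e x) ^+ k = 1.
Proof.
have [u _] := calQ_unitary N2 hF x.
elim: k => [|k IH]; first by rewrite !expr0 mulr1.
by rewrite exprSr exprS mulrA -(mulrA _ (calQ e x)) u mulr1.
Qed.

Lemma average_fix x X : X * calQ e x = calQ e x * X -> average x X = X.
Proof.
move=> cX; rewrite /average (eq_bigr (fun=> X)) ?average_cst // => k _.
have cXk : GRing.comm X (calQ e x ^+ k) by apply: commrX.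
by rewrite -cXk -mulrA calQ_pow_star mulr1.
Qed.

Lemma average_gauge x g X : alg_gen gauge_gen g -> average x (g * X) = g * average x X.
Proof.
move=> /gauge_gen_A0[_ /(_ x) cg]; rewrite /average -scalerAr mulr_sumr; congr (_ *: _).
apply: eq_bigr => k _; have cgk : GRing.comm g (calQ e x ^+ k) by apply: commrX.
by rewrite !mulrA cgk.
Qed.

Lemma average_sum x (L : seq (F * seq site)) (P : pred (F * seq site)) (f : F * seq site -> F) :
  average x (\sum_(t <- L | P t) f t) = \sum_(t <- L | P t) average x (f t).
Proof.
rewrite /average -scaler_sumr exchange_big; congr (_ *: _); apply: eq_bigr => k _.
by rewrite mulr_sumr mulr_suml.
Qed.

Lemma calQ_mono x s : twist (zt^-1 ^+ count_mem x s) (calQ e x) (mono s).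
Proof.
elim: s => [|y s IH]; first by rewrite /mono big_nil; apply/twist1; rewrite mulr1 mul1r.
rewrite /mono big_cons -/(mono s) /= exprD; apply: twistMr => //.
have := calQ_QH N2 hF x y; rewrite eq_sym /phase; case: eqP => _ //=.
Qed.

Lemma average_mono x s : average x (mono s) = if (N %| count_mem x s)%N then mono s else 0.
Proof.
have E k : calQ e x ^+ k * mono s * star (calQ e x) ^+ k = (zt^-1 ^+ count_mem x s) ^+ k *: mono s.
  rewrite (twistX k (calQ_mono x s)) -scalerAl -mulrA calQ_pow_star mulr1; congr (_ *: _).
rewrite /average; under eq_bigr do rewrite E.
have zN : (zt^-1 ^+ count_mem x s) ^+ N = 1.
  by rewrite -exprM mulnC exprM exprVn zetaN // invr1 expr1n.
case: ifPn => [dv|ndv].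
  have -> : zt^-1 ^+ count_mem x s = 1.
    by rewrite exprVn; move: dv => /dvdnP[k ->]; rewrite mulnC exprM zetaN // expr1n invr1.
  under eq_bigr do rewrite expr1n scale1r.
  exact: average_cst.
rewrite -scaler_suml geometric_root ?scale0r ?scaler0 //.
rewrite exprVn invr_eq1 -(prim_order_dvd (zeta_primitive R N2)) //.
Qed.

Lemma mono_split x s : mono s = QH e x ^+ count_mem x s * mono [seq y <- s | y != x].
Proof.
elim: s => [|y s IH]; first by rewrite /mono !big_nil mulr1.
rewrite /mono big_cons -/(mono s) IH /=; case: eqP => [->|_] /=.
  by rewrite mulrA -exprS.
rewrite big_cons add0n !mulrA; congr (_ * _).
by apply: (QfamC hF); [|apply: bicomX]; exact: Qfam_QH.
Qed.

Lemma mono_trivial s : (forall x, (N %| count_mem x s)%N) -> mono s = 1.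
Proof.
have [n] := ubnP (size s); elim: n s => // n IH [|x s] sn h; first by rewrite /mono big_nil.
rewrite (mono_split x); have [QN _ _ _] := QH_unitary N2 hF x.
have /dvdnP[k ->] := h x; rewrite mulnC exprM QN expr1n mul1r.
apply: IH => [|y].
  rewrite /= eqxx /= size_filter; apply: leq_ltn_trans (count_size _ _) _.
  by rewrite ltnS in sn.
rewrite count_filter.
have [->|yx] := eqVneq y x; first by rewrite (eq_count (a2 := pred0)) ?count_pred0 // => z /=; case: eqP.
rewrite (eq_count (a2 := pred1 y)) // => z /=.
by case: eqP => // ->; rewrite yx.
Qed.

(** An invariant element is fixed by the averages at all sites. Averaging at the finitely many sites
    of its words leaves only words in which every letter occurs a multiple of N times; those equal
    1, and the coefficients remain. *)
Lemma A0_gauge_gen X : A0alg e X -> alg_gen gauge_gen X.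
Proof.
move=> [/F0_mono_sum[[L hL XL] _] cX].
have red l : X = \sum_(t <- L | all (fun x => N %| count_mem x t.2)%N l) t.1 * mono t.2.
  elim: l => [|x l IH] /=; first by rewrite XL.
  rewrite -{1}(average_fix (cX x)) {1}IH average_sum.
  under [RHS]eq_bigl do rewrite andbC.
  rewrite big_mkcondr big_seq_cond [RHS]big_seq_cond; apply: eq_bigr => t /andP[tL _].
  by rewrite average_gauge ?average_mono; [case: ifP => // _; rewrite mulr0|exact: hL].
(* The list of all sites that occur in some word; at any other site the count is 0, which N
   divides. *)
rewrite (red (flatten [seq t.2 | t <- L])) big_seq_cond.
apply: big_ind => [||t /andP[tL /allP ht]].
- exact: alg_gen_0.
- by move=> ? ?; exact: alg_gen_add.
rewrite mono_trivial ?mulr1; first exact: hL.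
move=> x; have [xt|] := boolP (x \in t.2); last by move=> /count_memPn ->; rewrite dvdn0.
by apply: ht; apply/flattenP; exists t.2 => //; exact: map_f.
Qed.

Section Quotient.
Variables (B0 : starAlgType R) (q : F -> B0).
Hypothesis hq : quotient_B0 e q.
Local Notation U1 := (U1 e q).
Local Notation U3 := (U3 e q).

Lemma U3E b : U3 b = q (Dlink e b). Proof. by []. Qed.

Lemma qZ (a : C) X : A0alg e X -> q (a *: X) = a *: q X.
Proof.
have A0 := A0_0 e.
have q0 : q 0 = 0.
  by have := qt_linear hq (-1) (A0_1 e) (A0_1 e); rewrite !scaleN1r !addNr.
by move=> hX; have := qt_linear hq a hX A0; rewrite !addr0 q0 addr0.
Qed.

Lemma qX X k : A0alg e X -> q (X ^+ k) = q X ^+ k.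
Proof.
move=> hX; elim: k => [|k IH]; first by rewrite !expr0 (qt_one hq).
by rewrite !exprS (qt_mul hq) ?IH //; exact: A0_X.
Qed.

Lemma q_prod (I : Type) (s : seq I) (f : I -> F) : (forall i, A0alg e (f i)) ->
  q (\prod_(i <- s) f i) = \prod_(i <- s) q (f i).
Proof.
move=> h; elim: s => [|i s IH]; first by rewrite !big_nil (qt_one hq).
by rewrite !big_cons (qt_mul hq) ?IH //; exact: A0_prod.
Qed.

Definition starU (x : site) : B0 := \prod_(b <- bonds_from x) U1 b.
Definition plaqU (x : site) : B0 := \prod_(b <- plaq_bonds x) U3 b.

Lemma q_calQ x : q (calQ e x) = 1.
Proof.
have hQ := A0_calQ N2 hF x.
have h : A0alg e (calQ e x - 1).
  by rewrite -(scaleN1r 1) addrC; apply: A0_lin => //; exact: A0_1.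
have /(qt_ker hq h) : Jideal e (calQ e x - 1).
  by move=> I _; apply; exists x, 1%N; rewrite expr1.
rewrite -(scaleN1r 1) addrC (qt_linear hq) //; last exact: A0_1.
by rewrite (qt_one hq) scaleN1r => /eqP; rewrite addrC subr_eq0 => /eqP.
Qed.

Lemma q_dsPG x : q (dsPG e x) = starU x.
Proof. by rewrite /dsPG q_prod // => b; exact: A0_PG. Qed.

(** Gauss's law: [calQ x] becomes 1 in the quotient, so the matter variable P_H equals the product
    of the P_G leaving [x]. *)
Lemma q_PH x : q (PH e x) = starU x.
Proof.
have [_ u] := dsPG_unitary N2 hF x.
have -> : PH e x = calQ e x * dsPG e x by rewrite /calQ -mulrA u mulr1.
by rewrite (qt_mul hq) ?q_calQ ?mul1r ?q_dsPG //; [exact: A0_calQ|exact: A0_dsPG].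
Qed.

Lemma U1_unitary b : [/\ U1 b ^+ N = 1, U1 b * star (U1 b) = 1, star (U1 b) * U1 b = 1 &
  star (U1 b) = U1 (orev b)].
Proof.
have [h1 h2 h3 h4] := PG_unitary N2 hF b; have a b := A0_PG N2 hF b.
rewrite /Defs.U1 -(qt_star hq) // h4 -qX // h1 (qt_one hq) -!(qt_mul hq) // -h4 h2 h3 (qt_one hq).
by split.
Qed.

Lemma D_N b : Dlink e b ^+ N = 1.
Proof.
have [q1 q2 q3 q4] := QH_unitary N2 hF (otgt b).
have [p1 p2 p3 p4] := QH_unitary N2 hF (osrc b).
have [g1 g2 g3 g4] := QG_unitary N2 hF b.
have cQ X Y := @QfamC R N F e hF X Y.
have m1 : bicommutant (Qfam e) _ := Qfam_QH (otgt b).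
have m2 : bicommutant (Qfam e) _ := Qfam_QHs N2 hF (osrc b).
have m3 : bicommutant (Qfam e) _ := Qfam_QGs N2 hF b.
rewrite /Dlink /dQH exprMn_comm; last by apply: cQ => //; exact: bicomM.
rewrite exprMn_comm; last exact: cQ.
by rewrite -!starX q1 p1 g1 star1 !mulr1.
Qed.

Lemma U3_unitary b : [/\ U3 b ^+ N = 1, U3 b * star (U3 b) = 1, star (U3 b) * U3 b = 1 &
  star (U3 b) = U3 (orev b)].
Proof.
have [h2 h3] := D_unitary N2 hF b; have a b := A0_Dlink N2 hF b; have h1 := D_N b.
have h4 := D_star N2 hF b.
rewrite !U3E -(qt_star hq) // h4 -qX // h1 (qt_one hq) -!(qt_mul hq) // -h4 h2 h3 (qt_one hq).
by split.
Qed.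

Definition link_gen : set B0 := [set X | (exists b, X = U1 b) \/ (exists b, X = U3 b)].

Lemma B0_gen Y : alg_gen link_gen Y.
Proof.
have [X /A0_gauge_gen hX <-] := qt_surj hq Y.
elim: hX => {X} [X [[b ->]|[[x ->]|[b ->]]]||X X' hX IH hX' IH'|a X hX IH|X X' hX IH hX' IH'].
- by apply: alg_gen_base; left; exists b.
- rewrite q_PH /starU; elim: (bonds_from x) => [|b s IH].
    by rewrite big_nil; exact: alg_gen_one.
  by rewrite big_cons; apply: alg_gen_mul => //; apply: alg_gen_base; left; exists b.
- by apply: alg_gen_base; right; exists b.
- by rewrite (qt_one hq); exact: alg_gen_one.
- rewrite -[X]scale1r (qt_linear hq) ?scale1r; try exact: gauge_gen_A0.
  exact: alg_gen_add.
- by rewrite qZ; [exact: alg_gen_scale|exact: gauge_gen_A0].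
- by rewrite (qt_mul hq); [exact: alg_gen_mul|exact: gauge_gen_A0|exact: gauge_gen_A0].
Qed.

Lemma commuting_prodM (I : Type) (s : seq I) (G : set F) (f g : I -> F) :
  (forall X Y, bicommutant G X -> bicommutant G Y -> X * Y = Y * X) ->
  (forall i, bicommutant G (f i)) -> (forall i, bicommutant G (g i)) ->
  \prod_(i <- s) (f i * g i) = (\prod_(i <- s) f i) * \prod_(i <- s) g i.
Proof.
move=> cG hf hg; elim: s => [|i s IH]; first by rewrite !big_nil mulr1.
rewrite !big_cons IH !mulrA; congr (_ * _); rewrite -!mulrA; congr (_ * _).
by apply: cG => //; exact: bicom_prod.
Qed.

Lemma prod_rev_comm (I : Type) (s : seq I) (G : set F) (f : I -> F) :
  (forall X Y, bicommutant G X -> bicommutant G Y -> X * Y = Y * X) ->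
  (forall i, bicommutant G (f i)) -> \prod_(i <- rev s) f i = \prod_(i <- s) f i.
Proof.
move=> cG hf; elim: s => [|i s IH]; first by rewrite big_nil.
rewrite rev_cons -cats1 big_cat big_seq1 IH big_cons.
by apply: cG => //; exact: bicom_prod.
Qed.

(** Around a closed loop every site is once a source and once a target, so the Q_H cancel and only
    the adjoints of the Q_G remain. *)
Lemma prod_D_plaq x : \prod_(b <- plaq_bonds x) Dlink e b = star (dQG e x).
Proof.
have cQ X Y := @QfamC R N F e hF X Y.
rewrite /Dlink (commuting_prodM _ cQ) => [||b]; first last.
- exact: Qfam_QGs.
- by move=> b; apply: bicomM; [exact: Qfam_QH|exact: Qfam_QHs].
rewrite /dQG star_prod (prod_rev_comm _ cQ) => [|b]; last exact: Qfam_QGs.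
rewrite -[RHS]mul1r; congr (_ * _).
rewrite /dQH (commuting_prodM _ cQ) => [||b]; first last.
- exact: Qfam_QHs.
- by move=> b; exact: Qfam_QH.
rewrite -[X in _ * X](prod_rev_comm _ cQ) => [|b]; last exact: Qfam_QHs.
rewrite -star_prod.
have -> : \prod_(i <- plaq_bonds x) QH e (otgt i) = \prod_(i <- plaq_bonds x) QH e (osrc i).
  rewrite /plaq_bonds !big_cons !big_nil !mulr1 /otgt /osrc /= /dirv.
  rewrite (addrAC x e2 e1) (mulrA (QH e (x + e1 + e2))) (mulrA (QH e (x + e1))); apply: cQ; last exact: Qfam_QH.
  by do 2?apply: bicomM; exact: Qfam_QH.
by have [] := unitary_prod (plaq_bonds x) (f := fun b => QH e (osrc b))
  (fun b => let: And4 _ a c _ := QH_unitary N2 hF (osrc b) in conj c a).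
Qed.

Lemma q_dQG x : A0alg e (dQG e x) /\ q (dQG e x) = star (plaqU x).
Proof.
have E : dQG e x = star (\prod_(b <- plaq_bonds x) Dlink e b) by rewrite prod_D_plaq starK.
have h : A0alg e (\prod_(b <- plaq_bonds x) Dlink e b) by apply: A0_prod; exact: A0_Dlink.
split; first by rewrite E; exact: A0_star.
by rewrite E (qt_star hq) // q_prod //; exact: A0_Dlink.
Qed.

End Quotient.
End Generation.

(** * Local form of the dynamics *)

Section Boxes.

Lemma mem_box_range n (i : int) : (i \in box_range n) = (`|i| <= n)%N.
Proof.
apply/mapP/idP => [[k]|h].
  rewrite mem_iota => /andP[_ kn] ->; lia.
exists (absz (i + n%:Z)); rewrite ?mem_iota; lia.
Qed.

Lemma mem_box_sites n (x : site) : (x \in box_sites n) = (`|x.1| <= n)%N && (`|x.2| <= n)%N.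
Proof.
rewrite -!mem_box_range; apply/allpairsP/idP => [[[i j] [/= hi hj ->]]|/andP[hi hj]] /=.
  by rewrite hi hj.
by exists x; split=> //; case: (x).
Qed.

Lemma uniq_box_sites n : uniq (box_sites n).
Proof.
have u : uniq (box_range n).
  by rewrite map_inj_uniq ?iota_uniq // => i j /eqP; rewrite subr_eq subrK => /eqP[].
by apply: allpairs_uniq => // [[i j] [i' j']] _ _ /= [-> ->].
Qed.

Lemma uniq_box_bonds n : uniq (box_bonds n).
Proof.
apply: filter_uniq; apply: allpairs_uniq; [exact: uniq_box_sites|by []|].
by move=> [x d] [x' d'] _ _ /= [-> ->].
Qed.

Lemma uniq_box_plaqs n : uniq (box_plaqs n).
Proof. by apply: filter_uniq; exact: uniq_box_sites. Qed.

Lemma near_box_sites (x : site) : \forall n \near \oo, x \in box_sites n.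
Proof.
exists (maxn `|x.1| `|x.2|)%N => // n /=.
by rewrite mem_box_sites geq_max.
Qed.

Lemma near_box_bonds (b : pbond) : \forall n \near \oo, b \in box_bonds n.
Proof.
apply: filterS2 (near_box_sites b.1) (near_box_sites (b.1 + dirv b.2)) => n h1 h2.
rewrite mem_filter h2 andTb; apply/allpairsP; exists b; split=> //; last by case: (b).
by case: (b.2).
Qed.

Lemma near_box_plaqs (x : site) : \forall n \near \oo, x \in box_plaqs n.
Proof.
apply: filterS2 (near_box_sites x) (near_box_sites (x + e1 + e2)) => n h1 h2.
by rewrite mem_filter h2.
Qed.

End Boxes.

Section Dynamics.
Variables (R : realType) (N : nat).
Hypothesis N2 : (2 <= N)%N.
Local Notation C := R[i].
Variables (F : cstarAlgType R) (e : cell -> 'M[C]_N -> F).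
Hypothesis hF : field_algebra e.

Let n0 : (0 < N)%N := ltnW N2.

Lemma sum_rem (I : eqType) (s : seq I) (f : I -> F) x : x \in s ->
  \sum_(i <- s) f i = f x + \sum_(i <- rem x s) f i.
Proof. by move=> xs; rewrite (big_rem x xs). Qed.

Lemma comm_sum (I : eqType) (s : seq I) (f : I -> F) X :
  (forall i, i \in s -> X * f i = f i * X) -> X * (\sum_(i <- s) f i) = (\sum_(i <- s) f i) * X.
Proof.
by move=> h; rewrite mulr_sumr mulr_suml big_seq [RHS]big_seq; apply: eq_bigr.
Qed.

Lemma comm_power_sum (rho : 'I_N -> R) (a b : C) (X u : F) : X * u = u * X ->
  X * (a *: (b *: power_sum rho u)) = (a *: (b *: power_sum rho u)) * X.
Proof.
move=> h; apply: (@commr_scale _ F); apply: (@commr_scale _ F); rewrite /GRing.comm.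
rewrite mulr_sumr mulr_suml; apply: eq_bigr => k _; apply: (@commr_scale _ F); exact: commrX.
Qed.

Lemma prod_torsion (I : Type) (s : seq I) (f : I -> F) (G : set F) :
  (forall X Y, bicommutant G X -> bicommutant G Y -> X * Y = Y * X) ->
  (forall i, bicommutant G (f i)) -> (forall i, f i ^+ N = 1) -> (\prod_(i <- s) f i) ^+ N = 1.
Proof.
move=> cG fG fN; elim: s => [|i s IH]; first by rewrite big_nil expr1n.
rewrite big_cons exprMn_comm ?IH ?fN ?mulr1 //.
by apply: cG => //; exact: bicom_prod.
Qed.

Lemma bicom_sum (G : set F) (I : Type) (s : seq I) (f : I -> F) :
  (forall i, bicommutant G (f i)) -> bicommutant G (\sum_(i <- s) f i).
Proof.
move=> h; elim: s => [|i s IH]; last by rewrite big_cons; exact: bicomD.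
by rewrite big_nil => Z _; rewrite mulr0 mul0r.
Qed.

Lemma bicom_power_sum (G : set F) (rho : 'I_N -> R) (a b : C) (u : F) :
  bicommutant G u -> bicommutant G (a *: (b *: power_sum rho u)).
Proof.
move=> Gu; apply: bicomZ; apply: bicomZ; apply: bicom_sum => k; apply: bicomZ.
exact: bicomX.
Qed.

Lemma bicom_psi (G : set F) (rho : 'I_N -> R) (u : F) : bicommutant G u ->
  bicommutant G (psi rho u) /\ bicommutant G (psiV rho u).
Proof.
move=> Gu; have O : bicommutant G 1 by exact: bicom1.
have M X Y : bicommutant G X -> bicommutant G Y -> bicommutant G (X * Y) by exact: bicomM.
have P (a : C) X Y : bicommutant G X -> bicommutant G Y -> bicommutant G (a *: X + Y).
  by move=> hX hY; apply: bicomD => //; exact: bicomZ.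
by have [] := morph_psi rho (f := idfun) O M P (fun _ _ _ _ _ => erefl) (fun _ _ _ _ => erefl) erefl Gu.
Qed.

Section Conjugation.
Variable G : set F.
Hypothesis GC : forall X Y, bicommutant G X -> bicommutant G Y -> X * Y = Y * X.

Lemma cexp_conj_trivial Y X : diagonalisable (bicommutant G) Y ->
  X * Y = Y * X -> cexp Y * X * cexp (- Y) = X.
Proof.
move=> dY XY; have [u1 _] := cexpN dY.
by rewrite -(cexp_comm dY XY) -mulrA u1 mulr1.
Qed.

(** [cexp Z] commutes with [X] and is cancelled on the other side. [E] and [EV] are given explicitly
    so that they can be taken to the quotient later. *)
Lemma cexp_conj_split Y E EV Z X : diag_exp (bicommutant G) Y E -> EV * E = 1 ->
  diagonalisable (bicommutant G) Z -> X * Z = Z * X ->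
  cexp (Y + Z) * X * cexp (- (Y + Z)) = E * X * EV.
Proof.
move=> hY EE dZ XZ.
have dY : diagonalisable (bicommutant G) Y by exists E.
have M X' Y' : bicommutant G X' -> bicommutant G Y' -> bicommutant G (X' * Y') by exact: bicomM.
have dYZ : diagonalisable (bicommutant G) (Y + Z) by apply: diagonalisableD.
have [u1 _] := cexpN dYZ.
have EYZ : cexp (Y + Z) = E * cexp Z.
  by rewrite (@cexpD _ _ (bicommutant G)) // (diag_cexp hY).
have V : cexp Z * cexp (- (Y + Z)) = EV.
  by rewrite -[LHS]mul1r -EE -mulrA (mulrA E) -EYZ u1 mulr1.
by rewrite EYZ -(mulrA E) -(cexp_comm dZ XZ) -!mulrA V.
Qed.

Lemma diag_power_sum (rho : 'I_N -> R) u : (forall j, complex.Im (fourier rho j) = 0) ->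
  bicommutant G u -> u ^+ N = 1 ->
  diag_exp (bicommutant G) (Defs.half R *: (invsqrtN R N *: power_sum rho u)) (psi rho u).
Proof.
move=> hr Gu uN; apply: psi_diag => //.
- exact: bicom1.
- exact: bicomM.
- exact: bicomD.
- by move=> a X; exact: bicomZ.
Qed.

End Conjugation.

Lemma dQG_N x : dQG e x ^+ N = 1.
Proof.
apply: (@prod_torsion _ _ _ (Qfam e)); first by move=> X Y; exact: QfamC hF X Y.
  by move=> b; exact: Qfam_QG.
by move=> b; have [] := QG_unitary N2 hF b.
Qed.

Lemma dsPG_N x : dsPG e x ^+ N = 1.
Proof.
apply: (@prod_torsion _ _ _ (Pfam e)); first by move=> X Y; exact: PfamC hF X Y.
  by move=> b; exact: Pfam_PG.
by move=> b; have [] := PG_unitary N2 hF b.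
Qed.

Lemma PG_QG_comm b b' : b.1 != b'.1 -> PG e b * QG e b' = QG e b' * PG e b.
Proof.
move=> bb'.
have h : PG e b * QG e (b'.1, false) = QG e (b'.1, false) * PG e b.
  have := PG_Q_twist N2 hF b b'.1; rewrite (negPf bb') /phase invr1.
  by rewrite /QG /=; case: ifP => _ /twist1.
case: b' bb' h => [b' []] bb' h //.
have [_ u1 u2 E] := QG_unitary N2 hF (b', false).
by rewrite -[(b', true)]/(orev (b', false)) -E; apply: comm_star.
Qed.

Lemma PG_D_comm b b' : b.1 != b'.1 -> PG e b * Dlink e b' = Dlink e b' * PG e b.
Proof.
move=> bb'; have [_ u1 u2 _] := QG_unitary N2 hF b'.
have h1 := comm_star u2 u1 (PG_QG_comm bb').
have [_ v1 v2 _] := QH_unitary N2 hF (osrc b').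
have /twist1 h2 := PG_QH_comm N2 hF b (otgt b').
have /twist1/(comm_star v2 v1) h3 := PG_QH_comm N2 hF b (osrc b').
by rewrite /Dlink /dQH; do 2?apply: commrM.
Qed.

Lemma PH_QH_comm x y : x != y -> PH e x * QH e y = QH e y * PH e x.
Proof. by move=> xy; apply: (fa_comm hF); apply: contraNneq xy => -[->]. Qed.

Lemma PH_D_comm x b : x != otgt b -> x != osrc b -> PH e x * Dlink e b = Dlink e b * PH e x.
Proof.
move=> /PH_QH_comm h1 /PH_QH_comm h2.
have [_ u1 u2 _] := QG_unitary N2 hF b.
have [_ v1 v2 _] := QH_unitary N2 hF (osrc b).
have h3 : PH e x * QG e (b.1, false) = QG e (b.1, false) * PH e x by apply: (fa_comm hF).
have h4 : PH e x * QG e b = QG e b * PH e x.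
  case: (b) h3 => [b' []] // h3; have [_ w1 w2 E] := QG_unitary N2 hF (b', false).
  by rewrite -[(b', true)]/(orev (b', false)) -E; apply: comm_star.
by rewrite /Dlink /dQH; do 2?apply: commrM => //; apply: comm_star.
Qed.

(* The plaquettes whose boundary contains [pb] are those at [plaq1 pb] and at
   [pb.1]. *)
Definition plaq1 (pb : pbond) : site := pb.1 - dirv (~~ pb.2).

Lemma PG_dQG_comm pb r p : p != plaq1 pb -> p != pb.1 ->
  PG e (pb, r) * dQG e p = dQG e p * PG e (pb, r).
Proof.
case: pb => [y d] p1 p2; rewrite /dQG /plaq_bonds !big_cons big_nil mulr1.
have p3 : (y == p) = false by rewrite eq_sym (negPf p2).
have p4 : (y == p + dirv (~~ d)) = false.
  by move: p1; rewrite /plaq1 /= eq_sym subr_eq => /negPf.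
by do 3?[apply: commrM]; apply: PG_QG_comm; rewrite /= xpair_eqE;
  clear p1 p2; case: d p4 => //=; rewrite /dirv /= ?andbF ?andbT ?p3 // => ->.
Qed.

Variable c : couplings R N.
Hypotheses (rbg : forall j, complex.Im (fourier (beta_g c) j) = 0)
           (rbh : forall j, complex.Im (fourier (beta_h c) j) = 0)
           (rgg : forall j, complex.Im (fourier (gamma_g c) j) = 0)
           (rgh : forall j, complex.Im (fourier (gamma_h c) j) = 0).

Definition tgt (pb : pbond) : site := pb.1 + dirv pb.2.

(** The factors of e^{B_V/2} that fail to commute with [Dlink e (pb, false)]: the bond itself and
    its two endpoints. *)
Definition Kf (pb : pbond) : F :=
  psi (gamma_g c) (PG e (pb, false)) * (psi (gamma_h c) (PH e pb.1) * psi (gamma_h c) (PH e (tgt pb))).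
Definition KfV (pb : pbond) : F :=
  psiV (gamma_h c) (PH e (tgt pb)) * psiV (gamma_h c) (PH e pb.1) * psiV (gamma_g c) (PG e (pb, false)).
(** The factors of e^{A_V/2} that fail to commute with P_G(pb): the bond itself and the two
    plaquettes that contain it. *)
Definition Lf (pb : pbond) : F :=
  psi (beta_h c) (Dlink e (pb, false)) *
  (psi (beta_g c) (dQG e (plaq1 pb)) * psi (beta_g c) (dQG e pb.1)).
Definition LfV (pb : pbond) : F :=
  psiV (beta_g c) (dQG e pb.1) * psiV (beta_g c) (dQG e (plaq1 pb)) *
  psiV (beta_h c) (Dlink e (pb, false)).

Lemma inverse3 (A : nzRingType) (a b d a' b' d' : A) : a * a' = 1 /\ a' * a = 1 -> b * b' = 1 /\ b' * b = 1 ->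
  d * d' = 1 /\ d' * d = 1 -> a * (b * d) * (d' * b' * a') = 1 /\ d' * b' * a' * (a * (b * d)) = 1.
Proof.
move=> [a1 a2] [b1 b2] [d1 d2]; split.
  by rewrite -!mulrA (mulrA d) d1 mul1r (mulrA b) b1 mul1r.
by rewrite -!mulrA (mulrA a') a2 mul1r (mulrA b') b2 mul1r.
Qed.

Lemma Kf_inv pb : Kf pb * KfV pb = 1 /\ KfV pb * Kf pb = 1.
Proof.
have [h1 _ _ _] := PG_unitary N2 hF (pb, false).
have [h2 _ _ _] := PH_unitary N2 hF pb.1.
have [h3 _ _ _] := PH_unitary N2 hF (tgt pb).
by apply: inverse3; exact: psi_psiV.
Qed.

Lemma Lf_inv pb : Lf pb * LfV pb = 1 /\ LfV pb * Lf pb = 1.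
Proof.
have h1 := D_N N2 hF (pb, false).
by apply: inverse3; apply: psi_psiV => //; exact: dQG_N.
Qed.

Lemma Lf_bicom pb : bicommutant (Qfam e) (Lf pb) /\ bicommutant (Qfam e) (LfV pb).
Proof.
have [a1 a2] := bicom_psi (beta_h c) (Qfam_D N2 hF (pb, false)).
have [b1 b2] := bicom_psi (beta_g c) (Qfam_dQG N2 hF (plaq1 pb)).
have [d1 d2] := bicom_psi (beta_g c) (Qfam_dQG N2 hF pb.1).
by split; do 2?[apply: bicomM].
Qed.

Lemma dirv_neq0 d : dirv d != 0. Proof. by case: d. Qed.

Lemma tgt_neq pb : tgt pb != pb.1.
Proof. by rewrite /tgt -subr_eq0 addrAC subrr add0r dirv_neq0. Qed.

Lemma plaq1_neq pb : plaq1 pb != pb.1.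
Proof. by rewrite /plaq1 -subr_eq0 addrAC subrr add0r oppr_eq0 dirv_neq0. Qed.

Lemma half_sum (I : Type) (s : seq I) (f : I -> F) :
  Defs.half R *: (invsqrtN R N *: (\sum_(i <- s) f i)) =
  \sum_(i <- s) Defs.half R *: (invsqrtN R N *: f i).
Proof. by rewrite !scaler_sumr. Qed.

Lemma diag_AV n : diagonalisable (bicommutant (Qfam e)) (Defs.half R *: AV e c n).
Proof.
have M := @bicomM _ _ (Qfam e); have O : bicommutant (Qfam e) 1 by exact: bicom1.
have cQ := @QfamC R N F e hF.
rewrite /AV scalerDr !half_sum; apply: diagonalisableD => //; apply: diagonalisable_sum => //.
  move=> p; exists (psi (beta_g c) (dQG e p)); apply: diag_power_sum => //; first exact: Qfam_dQG.
  exact: dQG_N.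
move=> b; exists (psi (beta_h c) (Dlink e (b, false))); apply: diag_power_sum => //.
  exact: Qfam_D.
exact: D_N.
Qed.

Lemma diag_BV n : diagonalisable (bicommutant (Pfam e)) (Defs.half R *: BV e c n).
Proof.
have M := @bicomM _ _ (Pfam e); have O : bicommutant (Pfam e) 1 by exact: bicom1.
have cQ := @PfamC R N F e hF.
rewrite /BV scalerDr !half_sum; apply: diagonalisableD => //; apply: diagonalisable_sum => //.
  move=> b; exists (psi (gamma_g c) (PG e (b, false))); apply: diag_power_sum => //.
    exact: Pfam_PG.
  by have [] := PG_unitary N2 hF (b, false).
move=> x; exists (psi (gamma_h c) (PH e x)); apply: diag_power_sum => //.
  exact: Pfam_PH.
by have [] := PH_unitary N2 hF x.
Qed.

Lemma SV_D pb : \forall n \near \oo,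
  SV e c n * Dlink e (pb, false) * SVinv e c n = Kf pb * Dlink e (pb, false) * KfV pb.
Proof.
have M := @bicomM _ _ (Pfam e); have O : bicommutant (Pfam e) 1 by exact: bicom1.
have cP := @PfamC R N F e hF.
near=> n.
have b1 : pb \in box_bonds n by near: n; exact: near_box_bonds.
have b2 : pb.1 \in box_sites n by near: n; exact: near_box_sites.
have b3 : tgt pb \in box_sites n by near: n; exact: near_box_sites.
have cA : Dlink e (pb, false) * (Defs.half R *: AV e c n) = (Defs.half R *: AV e c n) * Dlink e (pb, false).
  rewrite /AV scalerDr !half_sum; apply: commrD; apply: comm_sum => i _; apply: comm_power_sum;
  apply: (QfamC hF); try exact: Qfam_D; exact: Qfam_dQG.
have -> : SV e c n * Dlink e (pb, false) * SVinv e c n =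
    cexp (Defs.half R *: BV e c n) * (cexp (Defs.half R *: AV e c n) * Dlink e (pb, false) *
      cexp (- (Defs.half R *: AV e c n))) * cexp (- (Defs.half R *: BV e c n)).
  by rewrite /SV /SVinv !mulrA.
rewrite (cexp_conj_trivial (diag_AV n) cA).
pose fb (b : pbond) : F := Defs.half R *: (invsqrtN R N *: power_sum (gamma_g c) (PG e (b, false))).
pose fx (x : site) : F := Defs.half R *: (invsqrtN R N *: power_sum (gamma_h c) (PH e x)).
have db b : diag_exp (bicommutant (Pfam e)) (fb b) (psi (gamma_g c) (PG e (b, false))).
  apply: diag_power_sum => //; first exact: Pfam_PG.
  by have [] := PG_unitary N2 hF (b, false).
have dx x : diag_exp (bicommutant (Pfam e)) (fx x) (psi (gamma_h c) (PH e x)).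
  apply: diag_power_sum => //; first exact: Pfam_PH.
  by have [] := PH_unitary N2 hF x.
(* The terms that do not enter [Kf]; cells occur once in the box, so these all commute with the link
   variable. *)
set rb := rem pb (box_bonds n); set rx := rem (tgt pb) (rem pb.1 (box_sites n)).
have tb : tgt pb \in rem pb.1 (box_sites n).
  by rewrite mem_rem_uniq ?uniq_box_sites // inE tgt_neq.
have -> : Defs.half R *: BV e c n = (fb pb + (fx pb.1 + fx (tgt pb))) +
    (\sum_(b <- rb) fb b + \sum_(x <- rx) fx x).
  rewrite /BV scalerDr !half_sum (sum_rem _ b1) (sum_rem _ b2) (sum_rem _ tb).
  by rewrite [X in _ + X = _]addrA addrACA.
apply: (@cexp_conj_split (Pfam e)) => //.
- by do 2?apply: diag_expD.
- by have [] := Kf_inv pb.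
- by apply: diagonalisableD => //; apply: diagonalisable_sum => // i;
    [exists (psi (gamma_g c) (PG e (i, false)))|exists (psi (gamma_h c) (PH e i))].
- apply: commrD; apply: comm_sum => i; rewrite /rb /rx => hi; apply: comm_power_sum.
    symmetry; apply: PG_D_comm => /=.
    by move: hi; rewrite mem_rem_uniq ?uniq_box_bonds // inE => /andP[].
  move: hi; rewrite mem_rem_uniq ?rem_uniq ?uniq_box_sites // inE => /andP[i1].
  rewrite mem_rem_uniq ?uniq_box_sites // inE => /andP[i2 _].
  by symmetry; apply: PH_D_comm.
Unshelve. all: by end_near. Qed.

(** The factor e^{A_V/2} acts first and would turn P_G into its conjugate by [Lf], which no longer
    commutes with B_V. Conjugating by [LfV] beforehand undoes this, and e^{B_V/2} then acts
    trivially. *)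
Lemma SV_PG pb : \forall n \near \oo,
  SV e c n * (LfV pb * PG e (pb, false) * Lf pb) * SVinv e c n = PG e (pb, false).
Proof.
have M := @bicomM _ _ (Qfam e); have O : bicommutant (Qfam e) 1 by exact: bicom1.
have cQ := @QfamC R N F e hF.
near=> n.
have b1 : pb \in box_bonds n by near: n; exact: near_box_bonds.
have b2 : plaq1 pb \in box_plaqs n by near: n; exact: near_box_plaqs.
have b3 : pb.1 \in box_plaqs n by near: n; exact: near_box_plaqs.
have cB : PG e (pb, false) * (Defs.half R *: BV e c n) = (Defs.half R *: BV e c n) * PG e (pb, false).
  rewrite /BV scalerDr !half_sum; apply: commrD; apply: comm_sum => i _; apply: comm_power_sum;
  apply: (PfamC hF); try exact: Pfam_PG; exact: Pfam_PH.
set X := LfV pb * _ * _.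
have -> : SV e c n * X * SVinv e c n =
    cexp (Defs.half R *: BV e c n) * (cexp (Defs.half R *: AV e c n) * X *
      cexp (- (Defs.half R *: AV e c n))) * cexp (- (Defs.half R *: BV e c n)).
  by rewrite /SV /SVinv !mulrA.
suff -> : cexp (Defs.half R *: AV e c n) * X * cexp (- (Defs.half R *: AV e c n)) = PG e (pb, false).
  exact: (cexp_conj_trivial (diag_BV n) cB).
pose fb (b : pbond) : F := Defs.half R *: (invsqrtN R N *: power_sum (beta_h c) (Dlink e (b, false))).
pose fx (x : site) : F := Defs.half R *: (invsqrtN R N *: power_sum (beta_g c) (dQG e x)).
have db b : diag_exp (bicommutant (Qfam e)) (fb b) (psi (beta_h c) (Dlink e (b, false))).
  by apply: diag_power_sum => //; [exact: Qfam_D|exact: D_N].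
have dx x : diag_exp (bicommutant (Qfam e)) (fx x) (psi (beta_g c) (dQG e x)).
  by apply: diag_power_sum => //; [exact: Qfam_dQG|exact: dQG_N].
set rb := rem pb (box_bonds n); set rx := rem pb.1 (rem (plaq1 pb) (box_plaqs n)).
have tb : pb.1 \in rem (plaq1 pb) (box_plaqs n).
  by rewrite mem_rem_uniq ?uniq_box_plaqs // inE eq_sym plaq1_neq.
have -> : Defs.half R *: AV e c n = (fb pb + (fx (plaq1 pb) + fx pb.1)) +
    (\sum_(b <- rb) fb b + \sum_(x <- rx) fx x).
  rewrite /AV scalerDr !half_sum addrC (sum_rem _ b1) (sum_rem _ b2) (sum_rem _ tb).
  by rewrite [X in _ + X = _]addrA addrACA.
have [u1 u2] := Lf_inv pb.
set Z := _ + \sum_(x <- rx) fx x.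
have dZ : diagonalisable (bicommutant (Qfam e)) Z.
  by apply: diagonalisableD => //; apply: diagonalisable_sum => // i;
    [exists (psi (beta_h c) (Dlink e (i, false)))|exists (psi (beta_g c) (dQG e i))].
have GZ : bicommutant (Qfam e) Z.
  by apply: bicomD; apply: bicom_sum => i; apply: bicom_power_sum; [exact: Qfam_D|exact: Qfam_dQG].
have [GL GLV] := Lf_bicom pb.
have PZ : PG e (pb, false) * Z = Z * PG e (pb, false).
  apply: commrD; apply: comm_sum => i; rewrite /rb /rx => hi; apply: comm_power_sum.
    apply: PG_D_comm => /=.
    by move: hi; rewrite mem_rem_uniq ?uniq_box_bonds // inE eq_sym => /andP[].
  move: hi; rewrite mem_rem_uniq ?rem_uniq ?uniq_box_plaqs // inE => /andP[i1].
  rewrite mem_rem_uniq ?uniq_box_plaqs // inE => /andP[i2 _].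
  exact: PG_dQG_comm.
rewrite (@cexp_conj_split (Qfam e) cQ _ (Lf pb) (LfV pb)) //.
- by rewrite /X -(mulrA (LfV pb)) (mulrA (Lf pb)) u1 mul1r -mulrA u1 mulr1.
- by do 2?apply: diag_expD.
(* The remainder [Z] commutes with the outer factors, as all are built from the Q's, and with P_G by
   [PZ]. *)
- rewrite /X -(mulrA _ (Lf pb) Z) (cQ (Lf pb) Z GL GZ) (mulrA _ Z).
  by rewrite -(mulrA (LfV pb) _ Z) PZ (mulrA (LfV pb) Z) (cQ (LfV pb) Z GLV GZ) !mulrA.
Unshelve. all: by end_near. Qed.

End Dynamics.

(** * Symmetries of the dynamics *)

Section AutomorphismTheory.
Variables (R : realType) (N : nat).
Hypothesis N2 : (2 <= N)%N.
Local Notation C := R[i].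
Variable (A : starAlgType R).
Implicit Types (f g : automorphism A).

Lemma aut_one f : f 1 = 1.
Proof. by rewrite -[LHS]mulr1 -[X in _ * X](autVK f 1) -aut_mul mul1r autVK. Qed.

Lemma aut_mul3 f a u b : f (a * u * b) = f a * f u * f b.
Proof. by rewrite aut_mul [f (a * u)]aut_mul. Qed.

Lemma aut_exp f X k : f (X ^+ k) = f X ^+ k.
Proof. by elim: k => [|k IH]; rewrite ?expr0 ?aut_one // !exprS aut_mul IH. Qed.

Lemma aut_prod f (I : Type) (s : seq I) (u : I -> A) :
  f (\prod_(i <- s) u i) = \prod_(i <- s) f (u i).
Proof. exact: (big_morph f (@aut_mul R A f) (aut_one f)). Qed.

Lemma aut_psi f (rho : 'I_N -> R) X : f (psi rho X) = psi rho (f X) /\ f (psiV rho X) = psiV rho (f X).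
Proof.
by have [] := morph_psi rho (S := setT) (f := f) I (fun _ _ _ _ => I) (fun _ _ _ _ _ => I)
  (fun a Y Z _ _ => aut_linear f a Y Z) (fun Y Z _ _ => aut_mul f Y Z) (aut_one f) (I : setT X).
Qed.

Lemma aut_psi3 f (rho sig : 'I_N -> R) u v w :
  f (psi rho u * (psi sig v * psi sig w)) = psi rho (f u) * (psi sig (f v) * psi sig (f w)) /\
  f (psiV sig w * psiV sig v * psiV rho u) = psiV sig (f w) * psiV sig (f v) * psiV rho (f u).
Proof.
have [a1 a2] := aut_psi f rho u; have [b1 b2] := aut_psi f sig v; have [d1 d2] := aut_psi f sig w.
by split; rewrite aut_mul [f (_ * _)]aut_mul ?a1 ?a2 ?b1 ?b2 ?d1 ?d2.
Qed.

Lemma inverse_unique (a b b' : A) : b * a = 1 -> a * b' = 1 -> b = b'.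
Proof. by move=> h1 h2; rewrite -[b]mulr1 -h2 mulrA h1 mul1r. Qed.

Lemma conj_exp (a b u : A) k : a * b = 1 -> b * a = 1 -> (a * u * b) ^+ k = a * u ^+ k * b.
Proof.
move=> ab ba; elim: k => [|k IH]; first by rewrite !expr0 mulr1 ab.
by rewrite !exprS IH !mulrA -(mulrA (a * u)) ba mulr1.
Qed.

Lemma star_conj (a b u : A) : star a = a -> star b = b -> star (a * u * b) = b * star u * a.
Proof. by rewrite !starM mulrA => -> ->. Qed.

Lemma reverse3 (a b d : A) : a * b = b * a -> a * d = d * a -> b * d = d * b -> a * b * d = d * b * a.
Proof. by move=> ab ad bd; rewrite -mulrA bd mulrA ad -mulrA ab mulrA. Qed.

Lemma psiV_inv (rho : 'I_N -> R) (u v : A) : u ^+ N = 1 -> v ^+ N = 1 ->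
  u * v = 1 -> v * u = 1 -> (forall j, complex.Im (fourier rho j) = 0) -> psiV rho v = psiV rho u.
Proof.
move=> uN vN uv vu hr.
have [h1 h2] := psi_psiV N2 rho uN; have [h3 h4] := psi_psiV N2 rho vN.
by apply: (inverse_unique h4); rewrite (psi_inv N2 _ uN vN uv vu).
Qed.

End AutomorphismTheory.

Lemma admissible_dual (R : realType) (N : nat) (c : couplings R N) :
  admissible c -> admissible (dual_couplings c).
Proof. by move=> [h1 h2 h3 [h4 h5 h6]]; split=> //; split. Qed.

Lemma admissible_real (R : realType) (N : nat) (c : couplings R N) : admissible c ->
  [/\ forall j, complex.Im (fourier (beta_g c) j) = 0, forall j, complex.Im (fourier (beta_h c) j) = 0,
      forall j, complex.Im (fourier (gamma_g c) j) = 0 & forall j, complex.Im (fourier (gamma_h c) j) = 0].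
Proof. by move=> [_ _ h3 [h4 h5 h6]]; split=> j; rewrite ?h3 ?h4 ?h5 ?h6. Qed.

Section Relations.
Variables (R : realType) (N : nat).
Hypothesis N2 : (2 <= N)%N.
Local Notation C := R[i].
Variables (F : cstarAlgType R) (e : cell -> 'M[C]_N -> F).
Hypothesis hF : field_algebra e.
Variables (B0 : starAlgType R) (q : F -> B0).
Hypothesis hq : quotient_B0 e q.
Local Notation U1 := (U1 e q).
Local Notation U3 := (U3 e q).
Local Notation starU := (starU e q).
Local Notation plaqU := (plaqU e q).

Let n0 : (0 < N)%N := ltnW N2.

Lemma q_psi (rho : 'I_N -> R) u : A0alg e u ->
  [/\ A0alg e (psi rho u), q (psi rho u) = psi rho (q u),
      A0alg e (psiV rho u) & q (psiV rho u) = psiV rho (q u)].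
Proof.
move=> hu; apply: morph_psi => //.
- exact: A0_1.
- by move=> X Y; exact: A0_M.
- by move=> a X Y; exact: A0_lin.
- exact: (qt_linear hq).
- exact: (qt_mul hq).
- exact: (qt_one hq).
Qed.

Lemma starU_unitary x : [/\ starU x ^+ N = 1, starU x * star (starU x) = 1 & star (starU x) * starU x = 1].
Proof.
have a := A0_dsPG N2 hF x; have a' := A0_star N2 hF a; have [u1 u2] := dsPG_unitary N2 hF x.
rewrite -(q_dsPG N2 hF hq) -(qt_star hq) // -(qX hq) // dsPG_N // (qt_one hq).
by rewrite -!(qt_mul hq) // u1 u2 (qt_one hq).
Qed.

Lemma plaqU_unitary x : [/\ plaqU x ^+ N = 1, plaqU x * star (plaqU x) = 1 & star (plaqU x) * plaqU x = 1].
Proof.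
have [a E] := q_dQG N2 hF hq x; have [u1 u2] := dQG_unitary N2 hF x; have a' := A0_star N2 hF a.
have E' : plaqU x = q (star (dQG e x)) by rewrite (qt_star hq) // E starK.
rewrite E' -(qt_star hq) // starK -(qX hq) // -starX dQG_N // star1 (qt_one hq).
by rewrite -!(qt_mul hq) // u1 u2 (qt_one hq).
Qed.

Section Coupling.
Variable c : couplings R N.

Definition KU (pb : pbond) : B0 :=
  psi (gamma_g c) (U1 (pb, false)) * (psi (gamma_h c) (starU pb.1) * psi (gamma_h c) (starU (tgt pb))).
Definition KUV (pb : pbond) : B0 :=
  psiV (gamma_h c) (starU (tgt pb)) * psiV (gamma_h c) (starU pb.1) * psiV (gamma_g c) (U1 (pb, false)).
Definition LU (pb : pbond) : B0 :=
  psi (beta_h c) (U3 (pb, false)) *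
  (psi (beta_g c) (plaqU (plaq1 pb)) * psi (beta_g c) (plaqU pb.1)).
Definition LUV (pb : pbond) : B0 :=
  psiV (beta_g c) (plaqU pb.1) * psiV (beta_g c) (plaqU (plaq1 pb)) *
  psiV (beta_h c) (U3 (pb, false)).

Hypothesis hc : admissible c.

Let rbg j : complex.Im (fourier (beta_g c) j) = 0. Proof. by have [] := admissible_real hc. Qed.
Let rbh j : complex.Im (fourier (beta_h c) j) = 0. Proof. by have [] := admissible_real hc. Qed.
Let rgg j : complex.Im (fourier (gamma_g c) j) = 0. Proof. by have [] := admissible_real hc. Qed.
Let rgh j : complex.Im (fourier (gamma_h c) j) = 0. Proof. by have [] := admissible_real hc. Qed.

Lemma q_Kf pb : [/\ A0alg e (Kf e c pb), q (Kf e c pb) = KU pb, A0alg e (KfV e c pb) & q (KfV e c pb) = KUV pb].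
Proof.
have [a1 a2 a3 a4] := q_psi (gamma_g c) (A0_PG N2 hF (pb, false)).
have [b1 b2 b3 b4] := q_psi (gamma_h c) (A0_PH N2 hF pb.1).
have [d1 d2 d3 d4] := q_psi (gamma_h c) (A0_PH N2 hF (tgt pb)).
have M X Y := @A0_M R N F e X Y.
split; [exact: M _ _ a1 (M _ _ b1 d1)| |exact: M _ _ (M _ _ d3 b3) a3|].
  by rewrite /Kf !(qt_mul hq) ?a2 ?b2 ?d2 ?(q_PH N2 hF hq) //; exact: M.
by rewrite /KfV !(qt_mul hq) ?a4 ?b4 ?d4 ?(q_PH N2 hF hq) //; exact: M.
Qed.

(** The quotient map sends the plaquette variable to the adjoint of [plaqU]; evenness of [psi]
    absorbs the difference. *)
Lemma psi_plaqU p : psi (beta_g c) (q (dQG e p)) = psi (beta_g c) (plaqU p) /\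
  psiV (beta_g c) (q (dQG e p)) = psiV (beta_g c) (plaqU p).
Proof.
have [_ ->] := q_dQG N2 hF hq p; have [h1 h2 h3] := plaqU_unitary p.
have h4 : star (plaqU p) ^+ N = 1 by rewrite -starX h1 star1.
by split; [exact: psi_inv|exact: psiV_inv].
Qed.

Lemma q_Lf pb : [/\ A0alg e (Lf e c pb), q (Lf e c pb) = LU pb, A0alg e (LfV e c pb) & q (LfV e c pb) = LUV pb].
Proof.
have [a1 a2 a3 a4] := q_psi (beta_h c) (A0_Dlink N2 hF (pb, false)).
have [p1 _] := q_dQG N2 hF hq (plaq1 pb); have [p2 _] := q_dQG N2 hF hq pb.1.
have [b1 b2 b3 b4] := q_psi (beta_g c) p1.
have [d1 d2 d3 d4] := q_psi (beta_g c) p2.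
have [q1 q2] := psi_plaqU (plaq1 pb); have [q3 q4] := psi_plaqU pb.1.
have M X Y := @A0_M R N F e X Y.
split; [exact: M _ _ a1 (M _ _ b1 d1)| |exact: M _ _ (M _ _ d3 b3) a3|].
  by rewrite /Lf !(qt_mul hq) ?a2 ?b2 ?d2 ?q1 ?q3 //; exact: M.
by rewrite /LfV !(qt_mul hq) ?a4 ?b4 ?d4 ?q2 ?q4 //; exact: M.
Qed.

Lemma KU_inv pb : KU pb * KUV pb = 1 /\ KUV pb * KU pb = 1.
Proof.
have [h1 <- h3 <-] := q_Kf pb; have [u1 u2] := Kf_inv N2 hF c pb.
by rewrite -!(qt_mul hq) // u1 u2 (qt_one hq).
Qed.

Lemma LU_inv pb : LU pb * LUV pb = 1 /\ LUV pb * LU pb = 1.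
Proof.
have [h1 <- h3 <-] := q_Lf pb; have [u1 u2] := Lf_inv N2 hF c pb.
by rewrite -!(qt_mul hq) // u1 u2 (qt_one hq).
Qed.

Lemma star3 (A : starAlgType R) (a b d : A) : star a = a -> star b = b -> star d = d ->
  star (a * (b * d)) = d * b * a.
Proof. by rewrite !starM => -> -> ->. Qed.

Lemma KU_star pb : star (KU pb) = KU pb /\ star (KUV pb) = KUV pb.
Proof.
have [v1 v2] := KU_inv pb.
suff E : star (KU pb) = KU pb.
  (* The adjoint of the inverse of a self-adjoint element is again an inverse of it. *)
  by split=> //; apply: (@inverse_unique _ _ (KU pb)) => //; rewrite -{1}E -starM v1 star1.
have [h1 <- h3 _] := q_Kf pb; rewrite -(qt_star hq) //; congr q.
have [s1 s2 s3 _] := PG_unitary N2 hF (pb, false).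
have [t1 t2 t3 _] := PH_unitary N2 hF pb.1.
have [r1 r2 r3 _] := PH_unitary N2 hF (tgt pb).
rewrite star3; try exact: psi_star.
have [a1 _] := bicom_psi (gamma_g c) (Pfam_PG N2 hF (pb, false)).
have [b1 _] := bicom_psi (gamma_h c) (Pfam_PH pb.1 : bicommutant (Pfam e) _).
have [d1 _] := bicom_psi (gamma_h c) (Pfam_PH (tgt pb) : bicommutant (Pfam e) _).
rewrite /Kf (PfamC hF d1 b1); apply: (PfamC hF) => //; exact: bicomM.
Qed.

Lemma LU_star pb : star (LU pb) = LU pb /\ star (LUV pb) = LUV pb.
Proof.
have [v1 v2] := LU_inv pb.
suff E : star (LU pb) = LU pb.
  by split=> //; apply: (@inverse_unique _ _ (LU pb)) => //; rewrite -{1}E -starM v1 star1.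
have [h1 <- h3 _] := q_Lf pb; rewrite -(qt_star hq) //; congr q.
have [s1 s2] := D_unitary N2 hF (pb, false); have s3 := D_N N2 hF (pb, false).
have [t1 t2] := dQG_unitary N2 hF (plaq1 pb).
have [r1 r2] := dQG_unitary N2 hF pb.1.
have t3 := dQG_N N2 hF (plaq1 pb); have r3 := dQG_N N2 hF pb.1.
rewrite star3; try exact: psi_star.
have [a1 _] := bicom_psi (beta_h c) (Qfam_D N2 hF (pb, false)).
have [b1 _] := bicom_psi (beta_g c) (Qfam_dQG N2 hF (plaq1 pb)).
have [d1 _] := bicom_psi (beta_g c) (Qfam_dQG N2 hF pb.1).
rewrite /Lf (QfamC hF d1 b1); apply: (QfamC hF) => //; exact: bicomM.
Qed.

Section Dynamics.
Variable beta : automorphism B0.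
Hypothesis hbeta : dynamics e q c beta.

Lemma dynamics_eq X Y : A0alg e X -> (\forall n \near \oo, SV e c n * X * SVinv e c n = Y) ->
  beta (q X) = q Y.
Proof.
move=> hX hY; have [Y' [_ lim ->]] := hbeta hX; congr q.
apply: ncvg_unique lim _; apply: ncvg_near_eq (ncvg_cst Y).
by apply: filterS hY => n ->.
Qed.

Lemma beta_U3 pb : beta (U3 (pb, false)) = KU pb * U3 (pb, false) * KUV pb.
Proof.
have [h1 <- h3 <-] := q_Kf pb; have h := A0_Dlink N2 hF (pb, false).
rewrite U3E -!(qt_mul hq) //; last exact: A0_M.
by apply: dynamics_eq => //; exact: SV_D.
Qed.

Lemma beta_U1 pb : beta (LUV pb * U1 (pb, false) * LU pb) = U1 (pb, false).
Proof.
have [h1 <- h3 <-] := q_Lf pb; have h := A0_PG N2 hF (pb, false).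
rewrite -!(qt_mul hq) //; last exact: A0_M.
by apply: dynamics_eq; [exact: A0_M (A0_M h3 h) h1|exact: SV_PG].
Qed.

Lemma star_pow (U : B0) : U ^+ N = 1 -> star U * U = 1 -> star U = U ^+ N.-1.
Proof. by move=> h1 h2; have [] := unitary_right N2 h1 h2. Qed.

(** Apply [beta_U3] to the adjoint of U_3, which is a power of it, and take adjoints: [KU] is
    self-adjoint, so it and its inverse trade places and the starred automorphism sends U_3 to K^-1
    U_3 K. *)
Lemma beta_inv_U3 b : beta_star_inv beta (KUV b.1 * U3 b * KU b.1) = U3 b.
Proof.
suff pos pb : beta_star_inv beta (KUV pb * U3 (pb, false) * KU pb) = U3 (pb, false).
  case: b => [pb []]; last exact: pos.
  have [h1 h2 h3 h4] := U3_unitary N2 hF hq (pb, false).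
  have [k1 k2] := KU_inv pb.
  rewrite -[(pb, true)]/(orev (pb, false)) -h4 (star_pow h1 h3) -conj_exp //.
  by rewrite (aut_exp (beta_star_inv beta)) pos.
rewrite -[RHS](beta_star_invK beta); congr (beta_star_inv beta _).
have [h1 h2 h3 _] := U3_unitary N2 hF hq (pb, false).
have [k1 k2] := KU_inv pb; have [s1 s2] := KU_star pb.
by rewrite (star_pow h1 h3) aut_exp beta_U3 conj_exp // star_conj // -(star_pow h1 h3) starK.
Qed.

(** The same adjoint argument applied to [beta_U1]. The result is a conjugation of U_1 by a function
    of the U_3's, dual in form to [beta_U3]. *)
Lemma beta_inv_U1 b : beta_star_inv beta (U1 b) = LU b.1 * U1 b * LUV b.1.
Proof.
suff pos pb : beta_star_inv beta (U1 (pb, false)) = LU pb * U1 (pb, false) * LUV pb.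
  case: b => [pb []]; last exact: pos.
  have [h1 h2 h3 h4] := U1_unitary N2 hF hq (pb, false).
  have [k1 k2] := LU_inv pb.
  by rewrite -[(pb, true)]/(orev (pb, false)) -h4 (star_pow h1 h3) (aut_exp (beta_star_inv beta)) pos conj_exp.
rewrite -[RHS](beta_star_invK beta); congr (beta_star_inv beta _).
have [h1 h2 h3 _] := U1_unitary N2 hF hq (pb, false).
have [k1 k2] := LU_inv pb; have [s1 s2] := LU_star pb.
rewrite star_conj // (star_pow h1 h3) -conj_exp // aut_exp beta_U1 -(star_pow h1 h3).
by rewrite starK.
Qed.

End Dynamics.

(* The conjugated elements generate: [LU] lies in the algebra of the [U3]'s. *)
Lemma hom_eq (f g : automorphism B0) :
  (forall pb, f (U3 (pb, false)) = g (U3 (pb, false))) ->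
  (forall pb, f (LUV pb * U1 (pb, false) * LU pb) = g (LUV pb * U1 (pb, false) * LU pb)) ->
  forall X, f X = g X.
Proof.
move=> hU3 hU1; pose M : set B0 := [set X | f X = g X].
have M1 : M 1 by rewrite /M /= !aut_one.
have MM X Y : M X -> M Y -> M (X * Y) by rewrite /M /= !aut_mul => -> ->.
have MP (a : C) X Y : M X -> M Y -> M (a *: X + Y) by rewrite /M /= !aut_linear => -> ->.
have MX X k : M X -> M (X ^+ k) by rewrite /M /= !aut_exp => ->.
have M0 : M 0 by have := MP (-1) _ _ M1 M1; rewrite scaleN1r addNr.
have Mpsi (rho : 'I_N -> R) X : M X -> M (psi rho X) /\ M (psiV rho X).
  move=> hX; have [] := morph_psi rho (f := idfun) M1 MM MP
    (fun _ _ _ _ _ => erefl) (fun _ _ _ _ => erefl) erefl hX.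
  by [].
have M3 b : M (U3 b).
  case: b => [pb []]; last exact: hU3.
  have [h1 h2 h3 h4] := U3_unitary N2 hF hq (pb, false).
  by rewrite -[(pb, true)]/(orev (pb, false)) -h4 (star_pow h1 h3); apply: MX; exact: hU3.
have Mplaq p : M (plaqU p).
  rewrite /plaqU; elim: (plaq_bonds p) => [|b s IH]; first by rewrite big_nil.
  by rewrite big_cons; exact: MM.
have ML pb : M (LU pb) /\ M (LUV pb).
  have [a1 a2] := Mpsi (beta_h c) _ (M3 (pb, false)).
  have [b1 b2] := Mpsi (beta_g c) _ (Mplaq (plaq1 pb)).
  have [d1 d2] := Mpsi (beta_g c) _ (Mplaq pb.1).
  by split; [exact: MM _ _ a1 (MM _ _ b1 d1)|exact: MM _ _ (MM _ _ d2 b2) a2].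
have M1' b : M (U1 b).
  have pos pb : M (U1 (pb, false)).
    have [k1 k2] := LU_inv pb; have [l1 l2] := ML pb.
    have -> : U1 (pb, false) = LU pb * (LUV pb * U1 (pb, false) * LU pb) * LUV pb.
      by rewrite -(mulrA (LUV pb)) (mulrA (LU pb)) k1 mul1r -mulrA k1 mulr1.
    exact: MM _ _ (MM _ _ l1 (hU1 pb)) l2.
  case: b => [pb []] //; have [h1 h2 h3 h4] := U1_unitary N2 hF hq (pb, false).
  by rewrite -[(pb, true)]/(orev (pb, false)) -h4 (star_pow h1 h3); apply: MX.
move=> X; elim: (B0_gen N2 hF hq X) => {X} [X [[b ->]|[b ->]]||X Y _ hX _ hY|a X _ hX|X Y _ hX _ hY].
- exact: M1'.
- exact: M3.
- exact: M1.
- by have := MP 1 _ _ hX hY; rewrite scale1r.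
- by have := MP a _ _ hX M0; rewrite addr0.
- exact: MM.
Qed.

End Coupling.

Section Symmetries.

Lemma U1_comm b b' : U1 b * U1 b' = U1 b' * U1 b.
Proof.
have a := A0_PG N2 hF b; have a' := A0_PG N2 hF b'.
rewrite -!(qt_mul hq) //; congr q; apply: (PfamC hF); exact: Pfam_PG.
Qed.

Lemma U3_comm b b' : U3 b * U3 b' = U3 b' * U3 b.
Proof.
have a := A0_Dlink N2 hF b; have a' := A0_Dlink N2 hF b'.
rewrite !U3E -!(qt_mul hq) //; congr q; apply: (QfamC hF); exact: Qfam_D.
Qed.

Lemma psi_U1_orient (rho : 'I_N -> R) b : (forall j, complex.Im (fourier rho j) = 0) ->
  psi rho (U1 b) = psi rho (U1 (b.1, false)) /\ psiV rho (U1 b) = psiV rho (U1 (b.1, false)).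
Proof.
move=> hr; case: b => [pb []] //=.
have [h1 h2 h3 h4] := U1_unitary N2 hF hq (pb, false).
have [h5 _ _ _] := U1_unitary N2 hF hq (pb, true).
rewrite /orev /= in h4; rewrite h4 in h2 h3.
by split; [exact: psi_inv|exact: psiV_inv].
Qed.

Lemma psi_U3_orient (rho : 'I_N -> R) b : (forall j, complex.Im (fourier rho j) = 0) ->
  psi rho (U3 b) = psi rho (U3 (b.1, false)) /\ psiV rho (U3 b) = psiV rho (U3 (b.1, false)).
Proof.
move=> hr; case: b => [pb []] //=.
have [h1 h2 h3 h4] := U3_unitary N2 hF hq (pb, false).
have [h5 _ _ _] := U3_unitary N2 hF hq (pb, true).
rewrite /orev /= in h4; rewrite h4 in h2 h3.
by split; [exact: psi_inv|exact: psiV_inv].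
Qed.

Lemma psi_starU (rho : 'I_N -> R) x : (forall j, complex.Im (fourier rho j) = 0) ->
  psi rho (star (starU x)) = psi rho (starU x) /\ psiV rho (star (starU x)) = psiV rho (starU x).
Proof.
move=> hr; have [h1 h2 h3] := starU_unitary x.
have h4 : star (starU x) ^+ N = 1 by rewrite -starX h1 star1.
by split; [exact: psi_inv|exact: psiV_inv].
Qed.

Lemma psi_star_plaqU (rho : 'I_N -> R) x : (forall j, complex.Im (fourier rho j) = 0) ->
  psi rho (star (plaqU x)) = psi rho (plaqU x) /\ psiV rho (star (plaqU x)) = psiV rho (plaqU x).
Proof.
move=> hr; have [h1 h2 h3] := plaqU_unitary x.
have h4 : star (plaqU x) ^+ N = 1 by rewrite -starX h1 star1.
by split; [exact: psi_inv|exact: psiV_inv].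
Qed.

Variable c : couplings R N.
Hypothesis hc : admissible c.

Let rbg j : complex.Im (fourier (beta_g c) j) = 0. Proof. by have [] := admissible_real hc. Qed.
Let rbh j : complex.Im (fourier (beta_h c) j) = 0. Proof. by have [] := admissible_real hc. Qed.
Let rgg j : complex.Im (fourier (gamma_g c) j) = 0. Proof. by have [] := admissible_real hc. Qed.
Let rgh j : complex.Im (fourier (gamma_h c) j) = 0. Proof. by have [] := admissible_real hc. Qed.

(** * Duality and the dynamics *)

Section Duality.
Variable Delta : automorphism B0.
Hypothesis hDelta : duality e q Delta.

(** The translation in [bstar] makes the plaquette with lower left corner [x] dual to the site [x].
    Rotating the star of bonds at [x] gives its boundary reversed, hence the adjoint. *)
Lemma Delta_starU x : Delta (starU x) = star (plaqU x).
Proof.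
have [_ h1 _] := hDelta; rewrite /starU aut_prod /plaqU /bonds_from /plaq_bonds !big_cons !big_nil !mulr1 !h1 !starM.
have E b : star (U3 b) = U3 (orev b) by have [] := U3_unitary N2 hF hq b.
have z1 : x - e1 + e1 = x by exact: subrK.
have z2 : x - e2 + e2 = x by exact: subrK.
rewrite !E /bstar /orev /= z1 z2 !mulrA; congr (_ * _).
by apply: reverse3; exact: U3_comm.
Qed.

Lemma Delta_plaqU x : Delta (plaqU x) = star (starU (x + e1 + e2)).
Proof.
have [_ _ h3] := hDelta; rewrite /plaqU aut_prod /starU /bonds_from /plaq_bonds !big_cons !big_nil !mulr1 !h3 !starM.
have E b : star (U1 b) = U1 (orev b) by have [] := U1_unitary N2 hF hq b.
have z1 : x + e1 + e2 - e1 = x + e2 by rewrite addrAC addrK.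
have z2 : x + e1 + e2 - e2 = x + e1 by exact: addrK.
have z3 : x + e2 + e1 = x + e1 + e2 by exact: addrAC.
rewrite !E /bstar /orev /= z1 z2 z3 -!(mulrA (U1 _)); congr (_ * _); rewrite !mulrA.
by apply: reverse3; exact: U1_comm.
Qed.

(** Under duality the bond goes to the dual bond and its endpoints to the two plaquettes containing
    the dual bond, while the dual couplings put (beta_h, beta_g) in the place of (gamma_g, gamma_h).
    Orientations and adjoints disappear by evenness of [psi]. *)
Lemma Delta_KU pb : Delta (KU (dual_couplings c) pb) = LU c (bstar (pb, false)).1 /\
  Delta (KUV (dual_couplings c) pb) = LUV c (bstar (pb, false)).1.
Proof.
have [_ h1 _] := hDelta; set b' := bstar (pb, false).
have [p1 p2] := psi_U3_orient (orev b') rbh.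
have [p3 p4] := psi_star_plaqU pb.1 rbg; have [p5 p6] := psi_star_plaqU (tgt pb) rbg.
have E1 : plaq1 b'.1 = pb.1 by rewrite /b' /plaq1; case: (pb) => [x []] /=; rewrite /dirv /= addrK.
have E2 : b'.1.1 = tgt pb by rewrite /b' /tgt; case: (pb) => [x []].
have [t1 t2] := aut_psi3 Delta (beta_h c) (beta_g c) (U1 (pb, false)) (starU pb.1) (starU (tgt pb)).
move: t1 t2; rewrite h1 -/b' (Delta_starU pb.1) (Delta_starU (tgt pb)) p1 p2 p3 p4 p5 p6 => t1 t2.
by rewrite /LU /LUV E1 E2; split; [exact: t1|exact: t2].
Qed.

Lemma Delta_LU pb : Delta (LU (dual_couplings c) pb) = KU c (bstar (pb, false)).1 /\
  Delta (LUV (dual_couplings c) pb) = KUV c (bstar (pb, false)).1.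
Proof.
have [_ _ h3] := hDelta; set b' := bstar (pb, false).
have [p1 p2] := psi_U1_orient b' rgg.
have [p3 p4] := psi_starU b'.1.1 rgh; have [p5 p6] := psi_starU (tgt b'.1) rgh.
have E1 : plaq1 pb + e1 + e2 = b'.1.1.
  by rewrite /b' /plaq1; case: (pb) => [x []] /=; rewrite /dirv /= ?subrK // addrAC subrK.
have E2 : pb.1 + e1 + e2 = tgt b'.1.
  by rewrite /b' /tgt; case: (pb) => [x []] //=; rewrite /dirv addrAC.
have [t1 t2] := aut_psi3 Delta (gamma_g c) (gamma_h c) (U3 (pb, false)) (plaqU (plaq1 pb)) (plaqU pb.1).
move: t1 t2; rewrite h3 -/b' (Delta_plaqU (plaq1 pb)) (Delta_plaqU pb.1) E1 E2 p1 p2 p3 p4 p5 p6 => t1 t2.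
by split; [exact: t1|exact: t2].
Qed.

Variables beta beta' : automorphism B0.
Hypotheses (hbeta : dynamics e q c beta) (hbeta' : dynamics e q (dual_couplings c) beta').

(** Checked on the generators attached to the dual couplings: [Delta] carries [beta_U3] for [beta']
    into [beta_inv_U1] for [beta], and [beta_U1] into [beta_inv_U3]. *)
Lemma Delta_beta X : Delta (beta' X) = beta_star_inv beta (Delta X).
Proof.
have hc' := admissible_dual hc; have [_ h1 h3] := hDelta.
apply: (hom_eq hc' (f := aut_comp Delta beta') (g := aut_comp (beta_star_inv beta) Delta)) => pb;
  rewrite -[LHS]/(Delta (beta' _)) -[RHS]/(beta_star_inv beta (Delta _)).
  rewrite (beta_U3 hc' hbeta') aut_mul3 (Delta_KU pb).1 (Delta_KU pb).2 h3.
  by rewrite (beta_inv_U1 hc hbeta).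
rewrite (beta_U1 hc' hbeta') aut_mul3 (Delta_LU pb).1 (Delta_LU pb).2 h1.
by rewrite [RHS](beta_inv_U3 hc hbeta (orev (bstar (pb, false)))).
Qed.

End Duality.

(** * Translations, the dynamics and duality *)

Section Translations.
Variables (tauF : site -> automorphism F) (tau : site -> automorphism B0).
Hypothesis htau : translations e q tauF tau.

Definition shift_bond (x : site) (b : obond) : obond := ((b.1.1 + x, b.1.2), b.2).

Lemma tau_U1 x b : tau x (U1 b) = U1 (shift_bond x b).
Proof.
have [h1 h2 h3 h4] := htau x; rewrite /Defs.U1 h4; last exact: A0_PG.
congr q; rewrite /PG /shift_bond /=; case: b.2; by rewrite ?h1 h3.
Qed.

Lemma tau_U3 x b : tau x (U3 b) = U3 (shift_bond x b).
Proof.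
have [h1 h2 h3 h4] := htau x; rewrite !U3E h4; last exact: A0_Dlink.
congr q; rewrite /Dlink /dQH !aut_mul !h1 /QH /QG !h3 /=.
have E : osrc b + x = osrc (shift_bond x b) by rewrite /osrc /=; case: b.2; rewrite // addrAC.
have E' : otgt b + x = otgt (shift_bond x b) by rewrite /otgt /osrc /=; case: b.2; rewrite //= addrAC.
by rewrite E E'; congr (_ * star _); case: b.2; rewrite ?h1 h3.
Qed.

Lemma tau_starU x y : tau x (starU y) = starU (y + x).
Proof.
rewrite /starU aut_prod /bonds_from !big_cons !big_nil !tau_U1 /shift_bond /=.
by rewrite !(addrAC y _ x).
Qed.

Lemma tau_plaqU x p : tau x (plaqU p) = plaqU (p + x).
Proof.
rewrite /plaqU aut_prod /plaq_bonds !big_cons !big_nil !tau_U3 /shift_bond /=.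
by rewrite !(addrAC p _ x).
Qed.

Definition shift_pbond (x : site) (b : pbond) : pbond := (b.1 + x, b.2).

Lemma tau_KU x pb : tau x (KU c pb) = KU c (shift_pbond x pb) /\ tau x (KUV c pb) = KUV c (shift_pbond x pb).
Proof.
have E : tgt pb + x = tgt (shift_pbond x pb) by rewrite /tgt /= addrAC.
have := aut_psi3 (tau x) (gamma_g c) (gamma_h c) (U1 (pb, false)) (starU pb.1) (starU (tgt pb)).
by rewrite (tau_starU x pb.1) (tau_starU x (tgt pb)) tau_U1 E.
Qed.

Lemma tau_LU x pb : tau x (LU c pb) = LU c (shift_pbond x pb) /\ tau x (LUV c pb) = LUV c (shift_pbond x pb).
Proof.
have E : plaq1 pb + x = plaq1 (shift_pbond x pb) by rewrite /plaq1 /= addrAC.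
have := aut_psi3 (tau x) (beta_h c) (beta_g c) (U3 (pb, false)) (plaqU (plaq1 pb)) (plaqU pb.1).
by rewrite (tau_plaqU x pb.1) (tau_plaqU x (plaq1 pb)) tau_U3 E.
Qed.

Lemma beta_tau (beta : automorphism B0) : dynamics e q c beta ->
  forall x X, beta (tau x X) = tau x (beta X).
Proof.
move=> hbeta x X.
apply: (hom_eq hc (f := aut_comp beta (tau x)) (g := aut_comp (tau x) beta)) => pb /=.
  rewrite tau_U3 (beta_U3 hc hbeta) (aut_mul3 (tau x)) (tau_KU x pb).1 (tau_KU x pb).2 tau_U3.
  exact: (beta_U3 hc hbeta (shift_pbond x pb)).
rewrite (beta_U1 hc hbeta) (aut_mul3 (tau x)) (tau_LU x pb).1 (tau_LU x pb).2 tau_U1.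
exact: (beta_U1 hc hbeta (shift_pbond x pb)).
Qed.

Lemma Delta_tau (Delta : automorphism B0) : duality e q Delta ->
  forall x X, Delta (tau x X) = tau x (Delta X).
Proof.
move=> [_ h1 h3] x X.
have E b : bstar (shift_bond x b) = shift_bond x (bstar b).
  by case: b => [[y []] r]; rewrite /bstar /shift_bond /= addrAC.
have gen b : Delta (tau x (U3 b)) = tau x (Delta (U3 b)).
  by rewrite tau_U3 !h3 E tau_U1.
elim: (B0_gen N2 hF hq X) => {X} [X [[b ->]|[b ->]]||X Y _ hX _ hY|a X _ hX|X Y _ hX _ hY].
- by rewrite tau_U1 !h1 E tau_U3.
- exact: gen.
- by rewrite !aut_one.
- have := aut_linear (aut_comp Delta (tau x)) 1 X Y; have := aut_linear (aut_comp (tau x) Delta) 1 X Y.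
  by rewrite !scale1r /= => -> ->; rewrite hX hY.
- have l0 (f : automorphism B0) : f 0 = 0.
    by have := aut_linear f (-1) 0 0; rewrite !scaleN1r !addNr.
  have := aut_linear (aut_comp Delta (tau x)) a X 0; have := aut_linear (aut_comp (tau x) Delta) a X 0.
  by rewrite !addr0 /= !l0 !addr0 => -> ->; rewrite hX.
- by rewrite !aut_mul hX hY.
Qed.

End Translations.

End Symmetries.

End Relations.

Theorem corollary5p3 (R : realType) (N : nat) (hN : (2 <= N)%N)
  (F : cstarAlgType R) (e : cell -> 'M[R[i]]_N -> F)
  (hF : field_algebra e)
  (B0 : starAlgType R) (q : F -> B0) (hq : quotient_B0 e q)
  (c : couplings R N) (hc : admissible c)
  (beta beta' : automorphism B0)
  (hbeta : dynamics e q c beta) (hbeta' : dynamics e q (dual_couplings c) beta')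
  (tauF : site -> automorphism F) (tau : site -> automorphism B0)
  (htau : translations e q tauF tau)
  (omega : F -> R[i]) (w : B0 -> R[i])
  (hw : vacuum_on e q c tauF (alpha_i beta beta' ord0) omega w)
  (Delta : automorphism B0) (hDelta : duality e q Delta)
  (H : forall a : 'I_4, gns_triple (omega_i w beta Delta a))
  (T : forall a : 'I_4, H a -> H a)
  (hT : forall a, bounded_op (T a) /\
     forall A, T a (gns_rep (H a) A (gns_vac (H a))) =
               gns_rep (H a) (alpha_i beta beta' a A) (gns_vac (H a)))
  (U : forall a : 'I_4, site -> H a -> H a)
  (hU : forall a x, unitary_op (U a x) /\
     forall A, U a x (gns_rep (H a) A (gns_vac (H a))) =
               gns_rep (H a) (tau x A) (gns_vac (H a)))
  (P1 P2 : forall a : 'I_4, H a -> H a)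
  (hP : forall a, momentum (U a) (P1 a) (P2 a)) :
  forall a b : 'I_4,
    joint_spectrum (T a) (P1 a) (P2 a) = joint_spectrum (T b) (P1 b) (P2 b).
Proof.
have tau_star x : star_preserving (tau x) by have [] := htau x.
have Delta_star : star_preserving Delta by have [] := hDelta.
have bt := beta_tau hN hF hq hc htau hbeta.
have Dt := Delta_tau hN hF hq htau hDelta.
have Db := Delta_beta hN hF hq hc hDelta hbeta hbeta'.
have Ds := Delta_beta_star_inv Delta_star Db.
pose i1 : 'I_4 := inord 1; pose i2 : 'I_4 := inord 2; pose i3 : 'I_4 := inord 3.
have v1 : val i1 = 1%N by rewrite /= inordK.
have v2 : val i2 = 2 by rewrite /= inordK.
have v3 : val i3 = 3 by rewrite /= inordK.
have hT1 a : bounded_op (T a) by have [] := hT a.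
have hT2 a A : T a (gns_rep (H a) A (gns_vac (H a))) =
    gns_rep (H a) (alpha_i beta beta' a A) (gns_vac (H a)) by have [] := hT a.
have hU1 a x : bounded_op (U a x) by have [[]] := hU a x.
have hU2 a x A : U a x (gns_rep (H a) A (gns_vac (H a))) =
    gns_rep (H a) (tau x A) (gns_vac (H a)) by have [] := hU a x.
have E01 : joint_spectrum (T ord0) (P1 ord0) (P2 ord0) = joint_spectrum (T i1) (P1 i1) (P2 i1).
  apply: (sqrt_joint_spectrum tau_star bt _ _ (hT1 _) (hT1 _)
    (hU1 _) (hU1 _) _ _ (hU2 _) (hU2 _) (hP _) (hP _)).
  - by have [] := hw.
  - by move=> X; rewrite /omega_i v1.
  - by move=> X; rewrite hT2.
  - by move=> X; rewrite hT2 /alpha_i v1.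
have E30 : joint_spectrum (T i3) (P1 i3) (P2 i3) = joint_spectrum (T ord0) (P1 ord0) (P2 ord0).
  apply: (duality_joint_spectrum Delta_star Dt _ _ (hT1 _) (hT1 _)
    (hU1 _) (hU1 _) (hT2 _) (hT2 _) (hU2 _) (hU2 _) (hP _) (hP _)).
  - by move=> X; rewrite /omega_i v3.
  (* [Delta] turns [beta'] into [beta_star_inv beta] and [beta_star_inv beta'] into [beta], so the
     order of the factors in sector 3 becomes that of sector 0. *)
  - by move=> X; rewrite /alpha_i v3 -[LHS]/(Delta (beta' (beta_star_inv beta' X))) Db Ds.
have E21 : joint_spectrum (T i2) (P1 i2) (P2 i2) = joint_spectrum (T i1) (P1 i1) (P2 i1).
  apply: (duality_joint_spectrum Delta_star Dt _ _ (hT1 _) (hT1 _)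
    (hU1 _) (hU1 _) (hT2 _) (hT2 _) (hU2 _) (hU2 _) (hP _) (hP _)).
  - by move=> X; rewrite /omega_i v1 v2.
  - by move=> X; rewrite /alpha_i v1 v2 -[LHS]/(Delta (beta_star_inv beta' (beta' X))) Ds Db.
suff all0 a : joint_spectrum (T a) (P1 a) (P2 a) = joint_spectrum (T ord0) (P1 ord0) (P2 ord0).
  by move=> a b; rewrite (all0 a) (all0 b).
have ha : [\/ a = ord0, a = i1, a = i2 | a = i3].
  case: a => [[|[|[|[|//]]]] lt]; [apply: Or41|apply: Or42|apply: Or43|apply: Or44];
  by apply: val_inj; rewrite ?v1 ?v2 ?v3.
by case: ha => ->; rewrite ?E30 ?E21 ?E01.
Qed.
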